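(* Let $M$ be any connected compact $2$-manifold. Then: (1) $\mathrm{Brun}_2(M)\cap P_2(M)$ is the normal closure of the element $A_{1,2}=\sigma_1^2$ in $B_2(M)$. (2) $\mathrm{Brun}_2(M)$ is the subgroup of $B_2(M)$ generated by $\mathrm{Brun}_2(M)\cap P_2(M)$ and $\sigma_1$.
   Context: Surfaces may be orientable or not, with or without boundary. $F(M,n)$ is the ordered configuration space of $n$ distinct points of $M$; $B_n(M)=\pi_1(F(M,n)/\Sigma_n)$ and $P_n(M)=\pi_1(F(M,n))=\ker(B_n(M)\to\Sigma_n)$. A simple curve in $M$ is a continuous injection $\theta:[0,\infty)\to M$. The base points $p_1,p_2,\ldots$ of braids are chosen in the interior of a small disk $D^2\subset M\smallsetminus\partial M$, in increasing order along a simple curve $\theta$. For $1\le i\le n$, the function $d_i:B_n(M)\to B_{n-1}(M)$ removes the $i$-th strand (the one starting at $p_i$) and then moves the remaining initial and final endpoints along $\theta$, order-preservingly, to $\{p_1,\dots,p_{n-1}\}$. A braid $\beta\in B_n(M)$ is Brunnian if $d_i(\beta)=1$ for all $1\le i\le n$; $\mathrm{Brun}_n(M)$ is the subgroup of Brunnian braids. Here $\sigma_1\in B_2(M)$ denotes the image of the standard generator of $B_2(D^2)\cong\mathbb{Z}$ under the homomorphism $B_2(D^2)\to B_2(M)$ induced by $D^2\hookrightarrow M$.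
   Formalization: The arcs of the simple curve θ between the base points are required to lie in the interior of the small disk; if the arc from p_1 to p_2 runs around a handle, d_1(σ_1) is nontrivial and (2) fails. *)

(* Defs.v *)
From HB Require Import structures.
From mathcomp Require Import all_boot all_order all_algebra fingroup perm.
From mathcomp Require Import generic_quotient.
From mathcomp Require Import ring lra.
From mathcomp Require Import all_classical all_reals all_analysis homotopy.
Set Implicit Arguments.
Unset Strict Implicit.
Unset Printing Implicit Defensive.
Import Order.TTheory GRing.Theory Num.Theory.
Import numFieldNormedType.Exports.
Local Open Scope classical_set_scope.
Local Open Scope quotient_scope.
Local Open Scope ring_scope.

Section Subgroups.
Context (G : groupType).
Local Open Scope group_scope.

Definition is_subgroup (H : set G) : Prop :=
  H 1 /\ (forall x y, H x -> H y -> H (x * y^-1)).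

Definition is_normal_subgroup (H : set G) : Prop :=
  is_subgroup H /\ (forall x g, H x -> H (x ^ g)).

Definition generated (S : set G) : set G := smallest is_subgroup S.
Definition normal_closure (S : set G) : set G := smallest is_normal_subgroup S.

End Subgroups.

Definition to_set_type (T : Type) (A : set T) (x : T) (Ax : A x) : set_type A :=
  exist (fun y => y \in A) x (mem_set Ax).

Lemma continuous_compT (S T U : topologicalType) (f : S -> T) (g : T -> U) :
  continuous f -> continuous g -> continuous (fun x => g (f x)).
Proof. by move=> cf cg x; exact: (continuous_comp (cf x) (cg (f x))). Qed.

Lemma continuous_pair (S T U : topologicalType) (f : S -> T) (g : S -> U) :
  continuous f -> continuous g -> continuous (fun x => (f x, g x)).
Proof. by move=> cf cg x; exact: (cvg_pair (cf x) (cg x)). Qed.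

Lemma continuous_fst (S T : topologicalType) : continuous (@fst S T).
Proof. by move=> x; exact: cvg_fst. Qed.

Lemma continuous_snd (S T : topologicalType) : continuous (@snd S T).
Proof. by move=> x; exact: cvg_snd. Qed.

Section RealContinuity.
Context (R : realType) (T : topologicalType).
Implicit Types f g : T -> R.

Lemma continuous_addf f g :
  continuous f -> continuous g -> continuous (fun x => f x + g x).
Proof. by move=> cf cg x; exact: (@cvgD R R T _ _ f g _ _ (cf x) (cg x)). Qed.

Lemma continuous_oppf f : continuous f -> continuous (fun x => - f x).
Proof. by move=> cf x; exact: (@cvgN R R T _ _ f _ (cf x)). Qed.

Lemma continuous_mulf f g :
  continuous f -> continuous g -> continuous (fun x => f x * g x).
Proof. by move=> cf cg x; exact: (@cvgM R T _ _ f g _ _ (cf x) (cg x)). Qed.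

End RealContinuity.

Lemma continuous_idfun (T : topologicalType) : continuous (fun x : T => x).
Proof. by move=> x; exact: cvg_id. Qed.

Ltac continuity :=
  try match goal with |- forall x : ?T, @continuous_at ?S ?U x ?f =>
    let g := eval cbv beta in (fun x : T => f x) in
    change (forall x : T, @continuous_at S U x g)
  end;
  lazymatch goal with
  | |- continuous (fun x => @?f x + @?g x) => apply: continuous_addf; continuity
  | |- continuous (fun x => - (@?f x)) => apply: continuous_oppf; continuity
  | |- continuous (fun x => @?f x * @?g x) => apply: continuous_mulf; continuity
  | |- continuous (fun x => (@?f x, @?g x)) => apply: continuous_pair; continuity
  | |- continuous (fun x => x.1) => exact: continuous_fst
  | |- continuous (fun x => x.2) => exact: continuous_snd
  | |- continuous (fun x => x) => exact: continuous_idfun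
  | |- continuous (fun _ => ?c) => exact: cst_continuous
  | |- _ => idtac
  end.

Lemma max_fun_continuous (R : realType) (T : topologicalType) (f g : T -> R) :
  continuous f -> continuous g -> continuous (fun t => Num.max (f t) (g t)).
Proof.
by move=> cf cg t; exact: (@continuous_max R T f g t (cf t) (cg t)).
Qed.

Lemma min_fun_continuous (R : realType) (T : topologicalType) (f g : T -> R) :
  continuous f -> continuous g -> continuous (fun t => Num.min (f t) (g t)).
Proof.
by move=> cf cg t; exact: (@continuous_min R T f g t (cf t) (cg t)).
Qed.

Lemma glue_continuous (R : realType) (T X : topologicalType) (u : T -> R)
    (a : R) (f g : T -> X) :
  continuous u -> continuous f -> continuous g ->
  (forall t, u t = a -> f t = g t) ->
  continuous (fun t => if u t <= a then f t else g t).
Proof.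
move=> /continuous_closedP cu /continuous_closedP cf /continuous_closedP cg fg.
apply/continuous_closedP => W cW.
have -> : (fun t => if u t <= a then f t else g t) @^-1` W =
    (u @^-1` [set z | z <= a] `&` f @^-1` W) `|`
    (u @^-1` [set z | a <= z] `&` g @^-1` W).
  apply/seteqP; split => t /=; case: ifPn => uta Wt.
  - by left.
  - by right; split=> //; rewrite ltW // ltNge.
  - case: Wt => -[] // atu; rewrite -fg //; apply/eqP.
    by rewrite eq_le uta atu.
  - by case: Wt => -[] // uta'; rewrite uta' in uta.
apply: closedU; apply: closedI.
- by apply: cu; exact: closed_le.
- exact: cf.
- by apply: cu; exact: closed_ge.
- exact: cg.
Qed.

Definition interval01 (R : realType) : Type := set_type `[(0 : R), 1]%classic.

Section Interval01.
Context (R : realType).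
Local Notation I := (interval01 R).

HB.instance Definition _ := Topological.on I.

Fact clamp_proof (t : R) : `[(0 : R), 1]%classic (Num.max 0 (Num.min 1 t)).
Proof.
rewrite /= in_itv /=; apply/andP; split; first by rewrite le_max lexx.
by rewrite ge_max ler01 ge_min lexx.
Qed.

Definition clamp (t : R) : I := to_set_type (clamp_proof t).

Definition ival (t : I) : R := \val t.

Lemma ival_itv (t : I) : 0 <= ival t <= 1.
Proof. by rewrite /ival; case: t => t /=; rewrite inE /= in_itv. Qed.

Lemma ival_clamp (t : R) : ival (clamp t) = Num.max 0 (Num.min 1 t).
Proof. by []. Qed.

Lemma ival_inj : injective ival.
Proof. exact: val_inj. Qed.

Lemma clampK (t : R) : 0 <= t <= 1 -> ival (clamp t) = t.
Proof. by move=> /andP[t0 t1]; rewrite ival_clamp (min_idPr t1) (max_idPr t0). Qed.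

Lemma clamp_ival (t : I) : clamp (ival t) = t.
Proof. by apply: ival_inj; rewrite clampK // ival_itv. Qed.

Lemma clamp_le0 (t : R) : t <= 0 -> clamp t = clamp 0.
Proof.
move=> t0; apply: ival_inj; rewrite [RHS]clampK ?lexx ?ler01 // ival_clamp.
by rewrite (min_idPr (le_trans t0 ler01)); apply/max_idPl.
Qed.

Lemma clamp_ge1 (t : R) : 1 <= t -> clamp t = clamp 1.
Proof. by move=> t1; apply: ival_inj; rewrite !ival_clamp (min_idPl t1) minxx. Qed.

Lemma ival_continuous : continuous ival.
Proof. exact: initial_continuous. Qed.

Lemma clamp_continuous : continuous clamp.
Proof.
apply: continuous_comp_initial; apply: max_fun_continuous.
  exact: cst_continuous.
by apply: min_fun_continuous; [exact: cst_continuous | move=> t; exact: cvg_id].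
Qed.

Fact clamp01_neq : clamp 0 != clamp 1.
Proof.
apply/eqP => /(congr1 ival); rewrite !clampK ?lexx ?ler01 // => /eqP.
by rewrite eq_sym oner_eq0.
Qed.

HB.instance Definition _ := isBiPointed.Build I clamp01_neq.

Lemma ival_zero : ival (zero : I) = 0.
Proof. by rewrite clampK // lexx ler01. Qed.

Lemma ival_one : ival (one : I) = 1.
Proof. by rewrite clampK // lexx ler01. Qed.

End Interval01.

Section Paths.
Context (R : realType) (X : topologicalType).
Local Notation I := (interval01 R).

Definition extend_path (x y : X) (p : {path I from x to y}) : R -> X :=
  p \o @clamp R.
Arguments extend_path : simpl never.

Lemma extend_path_continuous (x y : X) (p : {path I from x to y}) :
  continuous (extend_path p).
Proof.
move=> t; apply: continuous_comp; first exact: clamp_continuous.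
exact: cts_fun.
Qed.

Lemma extend_path_val (x y : X) (p : {path I from x to y}) (t : I) :
  extend_path p (ival t) = p t.
Proof. by rewrite /extend_path /= clamp_ival. Qed.

Lemma extend_path_le0 (x y : X) (p : {path I from x to y}) (t : R) :
  t <= 0 -> extend_path p t = x.
Proof. by move=> t0; rewrite /extend_path /= clamp_le0 // path_zero. Qed.

Lemma extend_path_ge1 (x y : X) (p : {path I from x to y}) (t : R) :
  1 <= t -> extend_path p t = y.
Proof. by move=> t1; rewrite /extend_path /= clamp_ge1 // path_one. Qed.

Section Restrict.
Context (x y : X) (f : R -> X).
Context (cf : continuous f) (f0 : f 0 = x) (f1 : f 1 = y).

Fact restrict_continuous : continuous (f \o @ival R : I -> X).
Proof. by move=> t; apply: continuous_comp; [exact: ival_continuous|exact: cf]. Qed.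

Fact restrict_zero : (f \o @ival R) (zero : I) = x.
Proof. by rewrite /comp ival_zero. Qed.

Fact restrict_one : (f \o @ival R) (one : I) = y.
Proof. by rewrite /comp ival_one. Qed.

Definition path_of_fun : {path I from x to y} :=
  mk_path restrict_continuous restrict_zero restrict_one.

End Restrict.

Definition const_path (x : X) : {path I from x to x} :=
  path_of_fun (@cst_continuous R X x) erefl erefl.

Section Concat.
Context (x y z : X) (p : {path I from x to y}) (q : {path I from y to z}).

Definition concat_fun (t : R) : X :=
  if t <= 2^-1 then extend_path p (2 * t) else extend_path q (2 * t - 1).

Fact concat_continuous : continuous concat_fun.
Proof.
apply: glue_continuous.
- by continuity.
- by apply: (continuous_compT _ (@extend_path_continuous _ _ p)); continuity.
- by apply: (continuous_compT _ (@extend_path_continuous _ _ q)); continuity.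
- by move=> t ->; rewrite extend_path_ge1 ?extend_path_le0 //; lra.
Qed.

Fact concat0 : concat_fun 0 = x.
Proof.
by rewrite /concat_fun ifT ?invr_ge0 ?ler0n // extend_path_le0 //; lra.
Qed.

Fact concat1 : concat_fun 1 = z.
Proof.
rewrite /concat_fun ifF; last by apply/negbTE; rewrite -ltNge; lra.
by rewrite extend_path_ge1 //; lra.
Qed.

Definition concat_path : {path I from x to z} :=
  path_of_fun concat_continuous concat0 concat1.

End Concat.

Section Reverse.
Context (x y : X) (p : {path I from x to y}).

Fact reverse_continuous : continuous (fun t : R => extend_path p (1 - t)).
Proof.
by apply: (continuous_compT _ (@extend_path_continuous _ _ p)); continuity.
Qed.

Fact reverse0 : extend_path p (1 - 0) = y.
Proof. by rewrite extend_path_ge1 // subr0. Qed.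

Fact reverse1 : extend_path p (1 - 1) = x.
Proof. by rewrite extend_path_le0 // subrr. Qed.

Definition reverse_path : {path I from y to x} :=
  path_of_fun reverse_continuous reverse0 reverse1.

End Reverse.

Definition homotopic (x y : X) (p q : {path I from x to y}) : Prop :=
  exists H : I * I -> X,
    [/\ continuous H,
        forall t, H (zero, t) = p t, forall t, H (one, t) = q t,
        forall s, H (s, zero) = x & forall s, H (s, one) = y].

Lemma homotopicI (x y : X) (p q : {path I from x to y}) (K : R * R -> X) :
  continuous K ->
  (forall t, 0 <= t <= 1 -> K (0, t) = extend_path p t) ->
  (forall t, 0 <= t <= 1 -> K (1, t) = extend_path q t) ->
  (forall s, 0 <= s <= 1 -> K (s, 0) = x) ->
  (forall s, 0 <= s <= 1 -> K (s, 1) = y) ->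
  homotopic p q.
Proof.
move=> cK K0 K1 Kx Ky; exists (fun u => K (ival u.1, ival u.2)); split.
- apply: (continuous_compT _ cK); apply: continuous_pair;
    apply: (continuous_compT _ (@ival_continuous R)); continuity.
- by move=> t /=; rewrite ival_zero K0 ?extend_path_val // ival_itv.
- by move=> t /=; rewrite ival_one K1 ?extend_path_val // ival_itv.
- by move=> s /=; rewrite ival_zero Kx // ival_itv.
- by move=> s /=; rewrite ival_one Ky // ival_itv.
Qed.

Lemma homotopicE (x y : X) (p q : {path I from x to y}) :
  homotopic p q -> exists K : R * R -> X,
    [/\ continuous K,
        forall t, K (0, t) = extend_path p t,
        forall t, K (1, t) = extend_path q t &
        forall s t, (t <= 0 -> K (s, t) = x) /\ (1 <= t -> K (s, t) = y)].
Proof.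
move=> [H [cH H0 H1 Hx Hy]]; exists (fun u => H (clamp u.1, clamp u.2)); split.
- apply: (continuous_compT _ cH); apply: continuous_pair;
    apply: (continuous_compT _ (@clamp_continuous R)); continuity.
- by move=> t; exact: H0.
- by move=> t; exact: H1.
- move=> s t; split => ht /=; first by rewrite (clamp_le0 ht); exact: Hx.
  by rewrite (clamp_ge1 ht); exact: Hy.
Qed.

Lemma homotopic_refl (x y : X) (p : {path I from x to y}) : homotopic p p.
Proof.
apply: (@homotopicI _ _ _ _ (extend_path p \o snd)) => //=.
- by apply: (continuous_compT _ (@extend_path_continuous _ _ p)); continuity.
- by move=> _ _; exact: extend_path_le0.
- by move=> _ _; exact: extend_path_ge1.
Qed.

Lemma homotopic_sym (x y : X) (p q : {path I from x to y}) :
  homotopic p q -> homotopic q p.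
Proof.
move=> /homotopicE[K [cK K0 K1 Kxy]].
apply: (@homotopicI _ _ _ _ (fun u => K (1 - u.1, u.2))) => /=.
- by apply: (continuous_compT _ cK); continuity.
- by move=> t _; rewrite subr0.
- by move=> t _; rewrite subrr.
- by move=> s _; apply: (Kxy _ _).1.
- by move=> s _; apply: (Kxy _ _).2.
Qed.

Lemma homotopic_trans (x y : X) (p q r : {path I from x to y}) :
  homotopic p q -> homotopic q r -> homotopic p r.
Proof.
move=> /homotopicE[K [cK K0 K1 Kxy]] /homotopicE[L [cL L0 L1 Lxy]].
apply: (@homotopicI _ _ _ _ (fun u => if u.1 <= 2^-1
  then K (2 * u.1, u.2) else L (2 * u.1 - 1, u.2))) => /=.
- apply: glue_continuous.
  + by continuity.
  + by apply: (continuous_compT _ cK); continuity.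
  + by apply: (continuous_compT _ cL); continuity.
  + by move=> u ->; rewrite mulfV ?pnatr_eq0 // subrr K1 L0.
- by move=> t _; rewrite invr_ge0 ler0n mulr0 K0.
- move=> t _; rewrite ifF; last by apply/negbTE; rewrite -ltNge; lra.
  by rewrite (_ : 2 * 1 - 1 = 1) ?L1 //; lra.
- by move=> s _; case: ifP => _; [apply: (Kxy _ _).1 | apply: (Lxy _ _).1].
- by move=> s _; case: ifP => _; [apply: (Kxy _ _).2 | apply: (Lxy _ _).2].
Qed.

Lemma homotopic_reparam (x y x' y' : X) (f : {path I from x' to y'})
    (u v : R -> R) (p q : {path I from x to y}) :
  continuous u -> continuous v -> u 0 = v 0 -> u 1 = v 1 ->
  (forall t, 0 <= t <= 1 -> extend_path p t = extend_path f (u t)) ->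
  (forall t, 0 <= t <= 1 -> extend_path q t = extend_path f (v t)) ->
  homotopic p q.
Proof.
move=> cu cv uv0 uv1 pE qE.
have E0 : extend_path f (u 0) = x.
  by rewrite -pE ?lexx ?ler01 // extend_path_le0.
have E1 : extend_path f (u 1) = y.
  by rewrite -pE ?lexx ?ler01 // extend_path_ge1.
apply: (@homotopicI _ _ _ _ (fun w =>
  extend_path f ((1 - w.1) * u w.2 + w.1 * v w.2))) => /=.
- apply: (continuous_compT _ (@extend_path_continuous _ _ f)); continuity.
  + by apply: (continuous_compT _ cu); continuity.
  + by apply: (continuous_compT _ cv); continuity.
- by move=> t t01; rewrite pE // subr0 mul1r mul0r addr0.
- by move=> t t01; rewrite qE // subrr mul1r mul0r add0r.
- by move=> s _; rewrite -uv0 -mulrDl subrK mul1r.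
- by move=> s _; rewrite -uv1 -mulrDl subrK mul1r.
Qed.

Lemma extend_of_fun (x y : X) (f : R -> X) (cf : continuous f)
    (f0 : f 0 = x) (f1 : f 1 = y) (t : R) :
  0 <= t <= 1 -> extend_path (path_of_fun cf f0 f1) t = f t.
Proof. by move=> t01; rewrite /extend_path /= /mk_path /= clampK. Qed.

Lemma extend_concat (x y z : X) (p : {path I from x to y})
    (q : {path I from y to z}) (t : R) :
  0 <= t <= 1 -> extend_path (concat_path p q) t = concat_fun p q t.
Proof. exact: extend_of_fun. Qed.

Lemma extend_reverse (x y : X) (p : {path I from x to y}) (t : R) :
  0 <= t <= 1 -> extend_path (reverse_path p) t = extend_path p (1 - t).
Proof. exact: extend_of_fun. Qed.

Definition extend_pathE := (extend_concat, extend_reverse).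

Lemma homotopic_concat (x y z : X) (p p' : {path I from x to y})
    (q q' : {path I from y to z}) :
  homotopic p p' -> homotopic q q' ->
  homotopic (concat_path p q) (concat_path p' q').
Proof.
move=> /homotopicE[K [cK K0 K1 Kxy]] /homotopicE[L [cL L0 L1 Lxy]].
apply: (@homotopicI _ _ _ _ (fun u => if u.2 <= 2^-1
  then K (u.1, 2 * u.2) else L (u.1, 2 * u.2 - 1))) => /=.
- apply: glue_continuous.
  + by continuity.
  + by apply: (continuous_compT _ cK); continuity.
  + by apply: (continuous_compT _ cL); continuity.
  + move=> u ->; rewrite mulfV ?pnatr_eq0 // subrr.
    by rewrite (Kxy _ _).2 ?(Lxy _ _).1.
- by move=> t t01; rewrite extend_pathE // /concat_fun K0 L0.
- by move=> t t01; rewrite extend_pathE // /concat_fun K1 L1.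
- by move=> s _; rewrite invr_ge0 ler0n (Kxy _ _).1 ?mulr0.
- move=> s _; rewrite ifF; last by apply/negbTE; rewrite -ltNge; lra.
  by rewrite (Lxy _ _).2 //; lra.
Qed.

Lemma homotopic_reverse (x y : X) (p p' : {path I from x to y}) :
  homotopic p p' -> homotopic (reverse_path p) (reverse_path p').
Proof.
move=> /homotopicE[K [cK K0 K1 Kxy]].
apply: (@homotopicI _ _ _ _ (fun u => K (u.1, 1 - u.2))) => /=.
- by apply: (continuous_compT _ cK); continuity.
- by move=> t t01; rewrite extend_pathE // K0.
- by move=> t t01; rewrite extend_pathE // K1.
- by move=> s _; rewrite (Kxy _ _).2 ?subr0.
- by move=> s _; rewrite (Kxy _ _).1 ?subrr.
Qed.

Lemma homotopic_concatA (w x y z : X) (p : {path I from w to x})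
    (q : {path I from x to y}) (r : {path I from y to z}) :
  homotopic (concat_path p (concat_path q r))
            (concat_path (concat_path p q) r).
Proof.
apply: homotopic_sym.
apply: (@homotopic_reparam _ _ _ _ (concat_path p (concat_path q r))
  (fun t => Num.min (2 * t) (Num.min (t + 4^-1) (2^-1 * t + 2^-1))) id).
- by apply: min_fun_continuous; [|apply: min_fun_continuous]; continuity.
- by continuity.
- by rewrite minEle; case: ifPn; rewrite minEle; case: ifPn; lra.
- by rewrite minEle; case: ifPn; rewrite minEle; case: ifPn; lra.
- move=> t t01; rewrite extend_pathE // /concat_fun.
  set u := Num.min _ _.
  have uE : u = if t <= 4^-1 then 2 * t else
      if t <= 2^-1 then t + 4^-1 else 2^-1 * t + 2^-1.
    by rewrite /u !minEle; do ! case: ifPn => //; rewrite -?ltNge; lra.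
  have u01 : 0 <= u <= 1.
    by rewrite uE; do ! case: ifPn => //; rewrite -?ltNge; lra.
  rewrite [RHS]extend_pathE // /concat_fun.
  have [t2|t2] := leP t 2^-1.
    have t2' : 0 <= 2 * t <= 1 by lra.
    rewrite [LHS]extend_pathE // /concat_fun; have [t4|t4] := leP t 4^-1.
      have uE' : u = 2 * t by rewrite uE t4.
      have -> : u <= 2^-1 by rewrite uE'; lra.
      have -> : 2 * t <= 2^-1 by lra.
      by rewrite uE'.
    have uE' : u = t + 4^-1 by rewrite uE ifF ?t2 //; apply/negbTE; rewrite -ltNge.
    have u1 : 0 <= 2 * u - 1 <= 1 by rewrite uE'; lra.
    have -> : (u <= 2^-1) = false by apply/negbTE; rewrite -ltNge uE'; lra.
    have -> : (2 * t <= 2^-1) = false by apply/negbTE; rewrite -ltNge; lra.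
    rewrite [RHS]extend_pathE // /concat_fun.
    have -> : 2 * u - 1 <= 2^-1 by rewrite uE'; lra.
    by congr extend_path; rewrite uE'; lra.
  have uE' : u = 2^-1 * t + 2^-1.
    by rewrite uE !ifF //; apply/negbTE; rewrite -ltNge; lra.
  have u1 : 0 <= 2 * u - 1 <= 1 by rewrite uE'; lra.
  have -> : (u <= 2^-1) = false by apply/negbTE; rewrite -ltNge uE'; lra.
  rewrite [RHS]extend_pathE // /concat_fun.
  have -> : (2 * u - 1 <= 2^-1) = false.
    by apply/negbTE; rewrite -ltNge uE'; lra.
  by congr extend_path; rewrite uE'; lra.
- by [].
Qed.

Lemma extend_const (x : X) (t : R) : extend_path (const_path x) t = x.
Proof. by []. Qed.

Lemma homotopic_concat1p (x y : X) (p : {path I from x to y}) :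
  homotopic (concat_path (const_path x) p) p.
Proof.
apply: (@homotopic_reparam _ _ _ _ p (fun t => Num.max 0 (2 * t - 1)) id) => //.
- by apply: max_fun_continuous; continuity.
- by continuity.
- by rewrite maxEle; case: ifPn; lra.
- by rewrite maxEle; case: ifPn; lra.
- move=> t t01; rewrite extend_pathE // /concat_fun maxEle.
  have [t2|t2] := leP t 2^-1.
    by rewrite extend_const; case: ifPn => _; rewrite extend_path_le0 //; lra.
  by rewrite ifT //; lra.
Qed.

Lemma homotopic_concatp1 (x y : X) (p : {path I from x to y}) :
  homotopic (concat_path p (const_path y)) p.
Proof.
apply: (@homotopic_reparam _ _ _ _ p (fun t => Num.min 1 (2 * t)) id) => //.
- by apply: min_fun_continuous; continuity.
- by continuity.
- by rewrite minEle; case: ifPn; lra.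
- by rewrite minEle; case: ifPn; lra.
- move=> t t01; rewrite extend_pathE // /concat_fun minEle.
  have [t2|t2] := leP t 2^-1.
    case: ifPn => // t1; have {t1} : 1 <= 2 * t by [].
    by move=> t1; rewrite !extend_path_ge1.
  by rewrite extend_const; case: ifPn => _; rewrite extend_path_ge1 //; lra.
Qed.

Lemma homotopic_concatpV (x y : X) (p : {path I from x to y}) :
  homotopic (concat_path p (reverse_path p)) (const_path x).
Proof.
apply: (@homotopic_reparam _ _ _ _ p (fun t => Num.min (2 * t) (2 - 2 * t))
  (fun _ => 0)) => //.
- by apply: min_fun_continuous; continuity.
- by continuity.
- by rewrite /= minEle; case: ifPn; lra.
- by rewrite /= minEle; case: ifPn; lra.
- move=> t t01; rewrite extend_pathE // /concat_fun minEle.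
  have [t2|t2] := leP t 2^-1; first by rewrite ifT //; lra.
  rewrite extend_pathE; last by lra.
  rewrite ifF; last by apply/negbTE; rewrite -ltNge; lra.
  by congr extend_path; lra.
- by move=> t _; rewrite extend_const extend_path_le0.
Qed.

Lemma homotopic_concatVp (x y : X) (p : {path I from x to y}) :
  homotopic (concat_path (reverse_path p) p) (const_path y).
Proof.
apply: (@homotopic_reparam _ _ _ _ p (fun t => Num.max (1 - 2 * t) (2 * t - 1))
  (fun _ => 1)) => //.
- by apply: max_fun_continuous; continuity.
- by continuity.
- by rewrite /= maxEle; case: ifPn; lra.
- by rewrite /= maxEle; case: ifPn; lra.
- move=> t t01; rewrite extend_pathE // /concat_fun maxEle.
  have [t2|t2] := leP t 2^-1.
    rewrite extend_pathE; last by lra.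
    by case: ifPn => // ?; congr extend_path; lra.
  by rewrite ifT //; lra.
- by move=> t _; rewrite extend_const extend_path_ge1.
Qed.

End Paths.

Section FundamentalGroup.
Context (R : realType) (X : topologicalType) (x : X).
Local Notation I := (interval01 R).
Local Notation loop := {path I from x to x}.

Definition homotopicb (p q : loop) : bool := `[< homotopic p q >].

Fact homotopicb_refl : reflexive homotopicb.
Proof. by move=> p; apply/asboolP; exact: homotopic_refl. Qed.

Fact homotopicb_sym : symmetric homotopicb.
Proof.
by move=> p q; apply/asboolP/asboolP; exact: homotopic_sym.
Qed.

Fact homotopicb_trans : transitive homotopicb.
Proof.
move=> q p r /asboolP pq /asboolP qr; apply/asboolP.
exact: homotopic_trans pq qr.
Qed.

Definition homotopic_equiv :=
  EquivRel homotopicb homotopicb_refl homotopicb_sym homotopicb_trans.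

Definition pi1 : Type := {eq_quot homotopic_equiv}.

HB.instance Definition _ := Choice.on pi1.
HB.instance Definition _ := Quotient.on pi1.

Definition pi1_class (p : loop) : pi1 := \pi_pi1 p.

Lemma pi1_classP (p q : loop) : pi1_class p = pi1_class q <-> homotopic p q.
Proof.
by split=> [/eqmodP/asboolP|pq] //; apply/eqmodP/asboolP.
Qed.

Lemma pi1_ind (P : pi1 -> Prop) : (forall p, P (pi1_class p)) -> forall a, P a.
Proof. by move=> H a; rewrite -(reprK a); exact: H. Qed.

Lemma homotopic_repr (p : loop) : homotopic (repr (pi1_class p)) p.
Proof. by apply/pi1_classP; exact: reprK. Qed.

Definition pi1_mul (a b : pi1) : pi1 :=
  pi1_class (concat_path (repr a) (repr b)).
Definition pi1_inv (a : pi1) : pi1 := pi1_class (reverse_path (repr a)).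
Definition pi1_one : pi1 := pi1_class (const_path R x).

Lemma pi1_mulE (p q : loop) :
  pi1_mul (pi1_class p) (pi1_class q) = pi1_class (concat_path p q).
Proof. by apply/pi1_classP; apply: homotopic_concat; exact: homotopic_repr. Qed.

Lemma pi1_invE (p : loop) : pi1_inv (pi1_class p) = pi1_class (reverse_path p).
Proof. by apply/pi1_classP; apply: homotopic_reverse; exact: homotopic_repr. Qed.

Fact pi1_mulA : associative pi1_mul.
Proof.
elim/pi1_ind=> p; elim/pi1_ind=> q; elim/pi1_ind=> r.
by rewrite !pi1_mulE; apply/pi1_classP; exact: homotopic_concatA.
Qed.

Fact pi1_mul1g : left_id pi1_one pi1_mul.
Proof.
elim/pi1_ind=> p; rewrite pi1_mulE; apply/pi1_classP.
exact: homotopic_concat1p.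
Qed.

Fact pi1_mulg1 : right_id pi1_one pi1_mul.
Proof.
elim/pi1_ind=> p; rewrite pi1_mulE; apply/pi1_classP.
exact: homotopic_concatp1.
Qed.

Fact pi1_mulVg : left_inverse pi1_one pi1_inv pi1_mul.
Proof.
elim/pi1_ind=> p; rewrite pi1_invE pi1_mulE; apply/pi1_classP.
exact: homotopic_concatVp.
Qed.

Fact pi1_mulgV : right_inverse pi1_one pi1_inv pi1_mul.
Proof.
elim/pi1_ind=> p; rewrite pi1_invE pi1_mulE; apply/pi1_classP.
exact: homotopic_concatpV.
Qed.

HB.instance Definition _ := isGroup.Build pi1
  pi1_mulA pi1_mul1g pi1_mulg1 pi1_mulVg pi1_mulgV.

Lemma pi1_classM (p q : loop) :
  (pi1_class p * pi1_class q)%g = pi1_class (concat_path p q).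
Proof. exact: pi1_mulE. Qed.

Lemma pi1_classV (p : loop) : (pi1_class p)^-1%g = pi1_class (reverse_path p).
Proof. exact: pi1_invE. Qed.

End FundamentalGroup.

Section InducedMap.
Context (R : realType) (X Y : topologicalType) (f : X -> Y).
Context (cf : continuous f).
Local Notation I := (interval01 R).

Section MapPath.
Context (x y : X) (x' y' : Y) (ex : f x = x') (ey : f y = y').
Context (p : {path I from x to y}).

Fact map_path_continuous : continuous (f \o p).
Proof. exact: (continuous_compT (@cts_fun _ _ p) cf). Qed.

Fact map_path_zero : (f \o p) zero = x'.
Proof. by rewrite /= path_zero. Qed.

Fact map_path_one : (f \o p) one = y'.
Proof. by rewrite /= path_one. Qed.

Definition map_path : {path I from x' to y'} :=
  mk_path map_path_continuous map_path_zero map_path_one.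

End MapPath.

Definition pi1_map (x : X) (y : Y) (e : f x = y) (a : pi1 R x) : pi1 R y :=
  pi1_class (map_path e e (repr a)).

Lemma pi1_mapE (x : X) (y : Y) (e : f x = y) (p : {path I from x to x}) :
  pi1_map e (pi1_class p) = pi1_class (map_path e e p).
Proof.
apply/pi1_classP; have [H [cH H0 H1 Hx Hy]] := homotopic_repr p.
exists (f \o H); split => [|t|t|s|s] /=.
- exact: (continuous_compT cH cf).
- by rewrite H0.
- by rewrite H1.
- by rewrite Hx.
- by rewrite Hy.
Qed.

Lemma pi1_mapM (x : X) (y : Y) (e : f x = y) :
  {morph pi1_map e : a b / (a * b)%g >-> (a * b)%g}.
Proof.
elim/pi1_ind=> p; elim/pi1_ind=> q.
rewrite pi1_classM !pi1_mapE pi1_classM.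
congr pi1_class; apply/path_eqP => t /=.
rewrite /mk_path /= /mk_path /= /concat_fun /extend_path /=.
by case: ifP.
Qed.

End InducedMap.

Section Configurations.
Context (n : nat) (X : topologicalType).

Definition configurations : set {ptws 'I_n -> X} := [set c : 'I_n -> X | injective c].

Definition conf : Type := set_type configurations.
HB.instance Definition _ := Topological.on conf.

Definition points (c : conf) : 'I_n -> X := \val c.

Lemma points_inj (c : conf) : injective (points c).
Proof. exact: set_mem (valP c). Qed.

Lemma conf_eqP (c d : conf) : points c =1 points d -> c = d.
Proof. by move=> cd; apply: val_inj; exact: funext. Qed.

Definition mk_conf (c : 'I_n -> X) (inj : injective c) : conf :=
  @to_set_type _ configurations c inj.

Lemma conf_continuous (T : topologicalType) (f : T -> conf) :
  (forall j, continuous (fun t => points (f t) j)) -> continuous f.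
Proof.
move=> cf; apply: continuous_comp_initial => t.
by apply/cvg_sup => j; apply: continuous_comp_initial; exact: cf.
Qed.

Lemma points_continuous (j : 'I_n) : continuous (fun c : conf => points c j).
Proof.
apply: (@continuous_compT conf {ptws 'I_n -> X} X set_val (fun c => c j)).
  exact: initial_continuous.
exact: (@proj_continuous _ (fun _ => X) j).
Qed.

Definition conf_perm (c : conf) (s : 'S_n) : conf :=
  mk_conf (inj_comp (@points_inj c) (@perm_inj _ s)).

Lemma points_mk (c : 'I_n -> X) (inj : injective c) : points (mk_conf inj) = c.
Proof. by []. Qed.

Lemma points_perm (c : conf) (s : 'S_n) (j : 'I_n) :
  points (conf_perm c s) j = points c (s j).
Proof. by []. Qed.

Definition same_orbit (c d : conf) : bool :=
  `[< exists s : 'S_n, d = conf_perm c s >].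

Fact same_orbit_refl : reflexive same_orbit.
Proof.
by move=> c; apply/asboolP; exists 1%g; apply: conf_eqP => j; rewrite points_perm perm1.
Qed.

Fact same_orbit_sym : symmetric same_orbit.
Proof.
suff sym c d : same_orbit c d -> same_orbit d c.
  by move=> c d; apply/idP/idP; exact: sym.
move=> /asboolP[s ->]; apply/asboolP; exists s^-1%g.
by apply: conf_eqP => j; rewrite !points_perm permKV.
Qed.

Fact same_orbit_trans : transitive same_orbit.
Proof.
move=> d c e /asboolP[s ->] /asboolP[u ->]; apply/asboolP; exists (u * s)%g.
by apply: conf_eqP => j; rewrite !points_perm permM.
Qed.

Definition orbit_equiv :=
  EquivRel same_orbit same_orbit_refl same_orbit_sym same_orbit_trans.

Definition uconf : Type := {eq_quot orbit_equiv}.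
HB.instance Definition _ := Topological.copy uconf (quotient_topology uconf).
HB.instance Definition _ := Quotient.on uconf.

Definition to_uconf (c : conf) : uconf := \pi_uconf c.

Lemma to_uconf_continuous : continuous to_uconf.
Proof. exact: pi_continuous. Qed.

Lemma to_uconfP (c d : conf) :
  to_uconf c = to_uconf d <-> exists s, d = conf_perm c s.
Proof. by split=> [/eqmodP/asboolP|?] //; apply/eqmodP/asboolP. Qed.

Lemma to_uconf_perm (c : conf) (s : 'S_n) :
  to_uconf (conf_perm c s) = to_uconf c.
Proof. by apply/esym/to_uconfP; exists s. Qed.

End Configurations.

Section ConfMap.
Context (n : nat) (X Y : topologicalType) (f : X -> Y).
Context (cf : continuous f) (injf : injective f).

Definition conf_map (c : conf n X) : conf n Y :=
  mk_conf (inj_comp injf (@points_inj _ _ c)).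

Lemma conf_map_continuous : continuous conf_map.
Proof.
apply: conf_continuous => j.
exact: (continuous_compT (@points_continuous _ _ j) cf).
Qed.

Definition uconf_map (u : uconf n X) : uconf n Y :=
  to_uconf (conf_map (repr u)).

Lemma uconf_mapE (c : conf n X) :
  uconf_map (to_uconf c) = to_uconf (conf_map c).
Proof.
have /to_uconfP[s cE] : to_uconf (repr (to_uconf c)) = to_uconf c by exact: reprK.
rewrite /uconf_map {2}cE -(to_uconf_perm _ s); congr to_uconf.
exact: conf_eqP.
Qed.

Lemma uconf_map_continuous : continuous uconf_map.
Proof.
apply/quotient_continuous.
have -> : uconf_map \o \pi_(uconf n X) = @to_uconf n Y \o conf_map.
  by apply/funext => c; exact: uconf_mapE.
exact: (continuous_compT conf_map_continuous (@to_uconf_continuous _ _)).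
Qed.

End ConfMap.

Section DropPoint.
Context (n : nat) (X : topologicalType).

Definition conf_drop (i : 'I_n.+1) (c : conf n.+1 X) : conf n X :=
  mk_conf (inj_comp (@points_inj _ _ c) (@lift_inj _ i)).

Lemma conf_drop_continuous (i : 'I_n.+1) : continuous (conf_drop i).
Proof. by apply: conf_continuous => j; exact: points_continuous. Qed.

Lemma conf_drop_perm (i : 'I_n.+1) (c : conf n.+1 X) (s : 'S_n.+1) :
  to_uconf (conf_drop i (conf_perm c s)) = to_uconf (conf_drop (s i) c).
Proof.
have ne j : s i != s (lift i j) by rewrite (inj_eq perm_inj) neq_lift.
pose u j := s2val (unlift_some (ne j)).
have uE j : s (lift i j) = lift (s i) (u j).
  by rewrite /u; case: unlift_some.
have injU : injective u.
  by move=> j k jk; apply: (@lift_inj _ i); apply: (@perm_inj _ s); rewrite !uE jk.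
apply/esym/to_uconfP; exists (perm injU); apply: conf_eqP => j.
by rewrite points_perm !points_mk /= permE -uE.
Qed.

End DropPoint.

Record base_points (X : Type) := BasePoints {
  base_point :> nat -> X;
  base_point_inj : injective base_point }.

Section Braids.
Context (R : realType) (X : topologicalType) (p : base_points X).
Local Notation I := (interval01 R).

Definition base_conf (n : nat) : conf n X :=
  @mk_conf n X (fun j => p j) (inj_comp (@base_point_inj _ p) (@ord_inj n)).

Definition braid (n : nat) : Type := pi1 R (to_uconf (base_conf n)).
HB.instance Definition _ n := Group.on (braid n).

(* P_n(X), as the image of pi_1(F(X, n)) in pi_1(F(X, n) / Sigma_n) *)
Definition pure (n : nat) : set (braid n) :=
  range (pi1_map (@to_uconf_continuous n X) (erefl (to_uconf (base_conf n)))
         : pi1 R (base_conf n) -> braid n).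

(* n strands; the strand starting at p j ends at p (s j) *)
Definition strands (n : nat) (s : 'S_n) : Type :=
  {path I from base_conf n to conf_perm (base_conf n) s}.

Definition braid_of (n : nat) (s : 'S_n) (g : strands s) : braid n :=
  pi1_class (map_path (@to_uconf_continuous n X) erefl
                      (to_uconf_perm (base_conf n) s) g).

End Braids.
Arguments pure R {X} p n _.

Section BraidMap.
Context (R : realType) (X Y : topologicalType) (f : X -> Y).
Context (cf : continuous f) (injf : injective f).
Context (p : base_points X) (q : base_points Y) (fpq : forall j, f (p j) = q j).

Fact uconf_map_base (n : nat) :
  uconf_map injf (to_uconf (base_conf p n)) = to_uconf (base_conf q n).
Proof.
by rewrite uconf_mapE; congr to_uconf; apply: conf_eqP => j; exact: fpq.
Qed.

Definition braid_map (n : nat) : braid R p n -> braid R q n :=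
  pi1_map (uconf_map_continuous (n := n) cf (injf := injf)) (uconf_map_base n).

End BraidMap.

(* A simple curve [0, oo) -> X, and the base points at increasing parameters;
   values of curve at negative parameters are irrelevant. *)
Record marked_curve (R : realType) (X : topologicalType) := MarkedCurve {
  curve : R -> X;
  mark : nat -> R;
  curve_continuous : {within `[0, +oo[%classic, continuous curve};
  curve_inj : {in `[0, +oo[ &, injective curve};
  mark_ge0 : forall j, 0 <= mark j;
  mark_lt : forall j k, (j < k)%N -> mark j < mark k }.

Section MarkedCurve.
Context (R : realType) (X : topologicalType) (th : marked_curve R X).
Local Notation I := (interval01 R).

Lemma curve_inj_ge0 (s t : R) :
  0 <= s -> 0 <= t -> curve th s = curve th t -> s = t.
Proof. by move=> s0 t0; apply: curve_inj; rewrite in_itv /= andbT. Qed.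

Lemma mark_inj : injective (mark th).
Proof.
by move=> j k jk; case: (ltngtP j k) => // /(mark_lt th); rewrite jk ltxx.
Qed.

Fact marked_points_inj : injective (curve th \o mark th).
Proof. by move=> j k /curve_inj_ge0-/(_ (mark_ge0 _ _) (mark_ge0 _ _))/mark_inj. Qed.

Definition marked_points : base_points X := BasePoints marked_points_inj.

Section Slide.
Context (n : nat) (i : 'I_n.+1).

Definition slide_time (t : R) (j : 'I_n) : R :=
  (1 - t) * mark th j + t * mark th (lift i j).

Fact slide_time_ge0 (t : R) (j : 'I_n) : 0 <= t <= 1 -> 0 <= slide_time t j.
Proof.
by move=> t01; apply: addr_ge0; apply: mulr_ge0; rewrite ?mark_ge0 //; lra.
Qed.

Fact slide_time_itv (t : I) (j : 'I_n) :
  `[(0 : R), +oo[%classic (slide_time (ival t) j).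
Proof. by rewrite /= in_itv /= andbT slide_time_ge0 // ival_itv. Qed.

Fact slide_time_lt (t : R) (j k : 'I_n) :
  0 <= t <= 1 -> (j < k)%N -> slide_time t j < slide_time t k.
Proof.
move=> t01 jk; have a := mark_lt th jk.
have b : mark th (lift i j) < mark th (lift i k).
  by apply: mark_lt; rewrite /= ltnNge leq_bump2 -ltnNge.
have [t_gt0|t_le0] := ltP 0 t.
  apply: ler_ltD; first by apply: ler_wpM2l; [lra | exact: ltW].
  by rewrite ltr_pM2l.
have -> : t = 0 by lra.
by rewrite /slide_time subr0 !mul1r !mul0r !addr0.
Qed.

Fact slide_inj (t : I) : injective (fun j => curve th (slide_time (ival t) j)).
Proof.
have t01 := ival_itv t.
move=> j k /curve_inj_ge0-/(_ (slide_time_ge0 _ t01) (slide_time_ge0 _ t01)) jk.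
apply: val_inj; case: (ltngtP j k) => //;
  by move=> /(slide_time_lt t01); rewrite jk ltxx.
Qed.

Definition slide_fun (t : I) : conf n X := mk_conf (@slide_inj t).

Fact slide_continuous : continuous slide_fun.
Proof.
apply: conf_continuous => j.
pose u (t : I) : set_type `[(0 : R), +oo[%classic :=
  to_set_type (slide_time_itv t j).
have cu : continuous u.
  apply: continuous_comp_initial.
  apply: (continuous_compT (@ival_continuous R) (g := slide_time ^~ j)).
  by rewrite /slide_time; continuity.
have /subspace_sigL_continuousP cth := @curve_continuous _ _ th.
exact: (continuous_compT cu cth).
Qed.

Fact slide_zero : slide_fun zero = base_conf marked_points n.
Proof.
apply: conf_eqP => j; rewrite !points_mk ival_zero /slide_time.
by rewrite subr0 mul1r mul0r addr0.
Qed.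

Fact slide_one : slide_fun one = conf_drop i (base_conf marked_points n.+1).
Proof.
apply: conf_eqP => j; rewrite !points_mk ival_one /slide_time.
by rewrite subrr mul1r mul0r add0r.
Qed.

Definition slide : {path I from to_uconf (base_conf marked_points n)
    to to_uconf (conf_drop i (base_conf marked_points n.+1))} :=
  map_path (@to_uconf_continuous n X) erefl erefl
    (mk_path slide_continuous slide_zero slide_one).

End Slide.

Local Notation braid n := (braid R marked_points n).

Section RemoveStrand.
Context (n : nat) (i : 'I_n.+1).

(* the geometric braid g without its i-th strand, with both ends moved along
   the curve; the removed strand ends at the base point of index s i *)
Definition remove_strand (s : 'S_n.+1) (g : strands R marked_points s) :
    braid n :=
  pi1_class (concat_path (slide i) (concat_path
    (map_path (continuous_compT (@conf_drop_continuous n X i)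
                                (@to_uconf_continuous n X))
       erefl (conf_drop_perm i (base_conf marked_points n.+1) s) g)
    (reverse_path (slide (s i))))).

(* d_i; a braid is represented by a path g in F(X, n.+1) starting at the base
   configuration, unique up to homotopy when X is Hausdorff because
   F(X, n.+1) is then a covering of F(X, n.+1) / Sigma_n.+1. The default value
   1 is used only for a braid with no such representative. *)
Definition removal (b : braid n.+1) : braid n :=
  xget 1%g [set a | exists s (g : strands R marked_points s),
                      braid_of g = b /\ remove_strand g = a].

End RemoveStrand.

Definition brunnian (n : nat) : set (braid n) :=
  match n with
  | 0 => setT
  | m.+1 => [set b | forall i : 'I_m.+1, removal i b = 1%g]
  end.

End MarkedCurve.
Arguments brunnian {R X} th n _.

Definition homeomorphic (X Y : topologicalType) : Prop :=
  exists (f : X -> Y) (g : Y -> X),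
    [/\ continuous f, continuous g, cancel f g & cancel g f].

Section Surfaces.
Context (R : realType) (M : topologicalType).

Definition half_plane : set (R * R) := [set z | 0 <= z.2].

Definition has_chart (E : set (R * R)) (x : M) : Prop :=
  exists (U : set M) (V : set (R * R)),
    [/\ open_nbhs x U, open V & homeomorphic (set_type U) (set_type (V `&` E))].

(* 2-manifold, possibly with boundary: every point has an open neighborhood
   homeomorphic to a relatively open subset of the closed half-plane *)
Definition surface : Prop :=
  [/\ hausdorff_space M, @second_countable M &
      forall x : M, has_chart half_plane x].

(* M minus its boundary: the points having a chart with values in an open
   subset of the plane *)
Definition surface_interior : set M := [set x | has_chart setT x].

End Surfaces.
Arguments surface_interior : clear implicits.

Section Disk.
Context (R : realType).
Local Notation I := (interval01 R).

Definition closed_disk : set (R * R) := [set z | z.1 ^+ 2 + z.2 ^+ 2 <= 1].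

Definition disk : Type := set_type closed_disk.
HB.instance Definition _ := Topological.on disk.

Definition disk_val (z : disk) : R * R := \val z.

Lemma disk_valP (z : disk) : (disk_val z).1 ^+ 2 + (disk_val z).2 ^+ 2 <= 1.
Proof. exact: set_mem (valP z). Qed.

(* a rotated counterclockwise by the angle pi t around the midpoint of a and b,
   and contracted by 1 + sin (pi t), which keeps it in the disk when both a and
   b are in the disk *)
Definition turn (t : R) (a b : R * R) : R * R :=
  let m := ((a.1 + b.1) / 2, (a.2 + b.2) / 2) in
  let v := ((a.1 - b.1) / 2, (a.2 - b.2) / 2) in
  ((m.1 + (cos (pi * t) * v.1 - sin (pi * t) * v.2)) / (1 + sin (pi * t)),
   (m.2 + (sin (pi * t) * v.1 + cos (pi * t) * v.2)) / (1 + sin (pi * t))).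

Lemma sin_pi_ge0 (t : R) : 0 <= t <= 1 -> 0 <= sin (pi * t).
Proof.
move=> /andP[t0 t1]; apply: sin_ge0_pi; apply/andP; split.
  by rewrite mulr_ge0 // pi_ge0.
by rewrite ler_piMr // pi_ge0.
Qed.

Fact turn_disk (t : R) (a b : disk) :
  0 <= t <= 1 -> closed_disk (turn t (disk_val a) (disk_val b)).
Proof.
move=> /sin_pi_ge0; rewrite /closed_disk /turn /=.
have := cos2Dsin2 (pi * t).
move: (cos _) (sin _) (disk_valP a) (disk_valP b) => C S.
case: (disk_val a) (disk_val b) => [a1 a2] [b1 b2] /= ha hb CS S0.
have C1 : -1 <= C <= 1 by apply/andP; split; nra.
rewrite !expr_div_n -mulrDl ler_pdivrMr ?mul1r; last by nra.
set m1 := (a1 + b1) / 2; set m2 := (a2 + b2) / 2.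
set v1 := (a1 - b1) / 2; set v2 := (a2 - b2) / 2.
have -> : (m1 + (C * v1 - S * v2)) ^+ 2 + (m2 + (S * v1 + C * v2)) ^+ 2 =
    2^-1 * ((1 + C) * (a1 ^+ 2 + a2 ^+ 2) + (1 - C) * (b1 ^+ 2 + b2 ^+ 2)) +
    S * (2 * (m2 * v1 - m1 * v2)) +
    (C ^+ 2 + S ^+ 2 - 1) * (v1 ^+ 2 + v2 ^+ 2).
  by rewrite /m1 /m2 /v1 /v2; field.
rewrite CS subrr mul0r addr0.
have le1 : 2 * (m2 * v1 - m1 * v2) <= 1.
  have := sqr_ge0 (m1 + v2); have := sqr_ge0 (m2 - v1).
  by rewrite /m1 /m2 /v1 /v2; nra.
have le2 : S * (2 * (m2 * v1 - m1 * v2)) <= S by rewrite ler_piMr.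
have le3 : (1 + C) * (a1 ^+ 2 + a2 ^+ 2) <= 1 + C by rewrite ler_piMr //; lra.
have le4 : (1 - C) * (b1 ^+ 2 + b2 ^+ 2) <= 1 - C by rewrite ler_piMr //; lra.
have := sqr_ge0 S; nra.
Qed.

Lemma turn_inj (t : R) (a b : R * R) :
  0 <= t <= 1 -> turn t a b = turn t b a -> a = b.
Proof.
move=> /sin_pi_ge0; rewrite /turn /=.
have := cos2Dsin2 (pi * t).
move: (cos _) (sin _) => C S CS S0.
case: a b => [a1 a2] [b1 b2] /= [].
have D0 : (1 + S)^-1 != 0 by rewrite invr_eq0; apply: lt0r_neq0; nra.
move=> /(mulIf D0) e1 /(mulIf D0) e2.
have f1 : C * (a1 - b1) = S * (a2 - b2) by nra.
have f2 : S * (a1 - b1) = - (C * (a2 - b2)) by nra.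
have g1 : (C ^+ 2 + S ^+ 2) * (a1 - b1) = 0.
  rewrite mulrDl !expr2 -!mulrA f1 f2; ring.
have g2 : (C ^+ 2 + S ^+ 2) * (a2 - b2) = 0.
  have -> : (C ^+ 2 + S ^+ 2) * (a2 - b2) =
    S * (S * (a2 - b2)) + C * (C * (a2 - b2)) by ring.
  have -> : C * (a2 - b2) = - (S * (a1 - b1)) by rewrite f2 opprK.
  by rewrite -f1; ring.
by move: g1 g2; rewrite CS !mul1r => /subr0_eq -> /subr0_eq ->.
Qed.

Lemma turn0 (a b : R * R) : turn 0 a b = a.
Proof.
case: a b => [a1 a2] [b1 b2]; rewrite /turn mulr0 cos0 sin0 /=.
by congr pair; field.
Qed.

Lemma turn1 (a b : R * R) : turn 1 a b = b.
Proof.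
case: a b => [a1 a2] [b1 b2]; rewrite /turn mulr1 cospi sinpi /=.
by congr pair; field.
Qed.

Lemma turn_continuous (a b : R * R) (T : topologicalType) (u : T -> R) :
  continuous u -> (forall t, 0 <= u t <= 1) ->
  continuous (fun t => turn (u t) a b).
Proof.
move=> cu u01.
have cpi : continuous (fun t => pi * u t) by continuity.
have cC := continuous_compT cpi (@continuous_cos R).
have cS := continuous_compT cpi (@continuous_sin R).
have cV : continuous (fun t => (1 + sin (pi * u t))^-1).
  move=> t; apply: cvgV; first by rewrite gt_eqF // ltr_pwDl // sin_pi_ge0.
  by apply: cvgD; [exact: cvg_cst | exact: cS].
by rewrite /turn /=; continuity.
Qed.

Section HalfTwist.
Context (q : base_points disk).

Definition swap : 'S_2 := tperm ord0 ord_max.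

Definition half_twist_point (t : I) (j : 'I_2) : disk :=
  to_set_type (turn_disk (q j) (q (swap j)) (ival_itv t)).

Fact half_twist_inj (t : I) : injective (half_twist_point t).
Proof.
have neq j k : j != k -> swap j = k /\ swap k = j.
  have ord2 (l : 'I_2) : l = ord0 \/ l = ord_max.
    by case: l => -[|[|//]] ?; [left | right]; exact: val_inj.
  by case: (ord2 j) => ->; case: (ord2 k) => ->; rewrite ?eqxx // /swap
    ?tpermL ?tpermR.
move=> j k /(congr1 disk_val) /=; apply: contraPeq => /[dup] jk /neq[jE kE].
rewrite /half_twist_point /disk_val /= jE kE => /(turn_inj (ival_itv t)).
move=> /(@val_inj _ _ disk)/base_point_inj/ord_inj/eqP.
by rewrite (negbTE jk).
Qed.

Definition half_twist_fun (t : I) : conf 2 disk := mk_conf (@half_twist_inj t).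

Fact half_twist_continuous : continuous half_twist_fun.
Proof.
apply: conf_continuous => j; apply: continuous_comp_initial.
exact: (@turn_continuous (disk_val (q j)) (disk_val (q (swap j))) _ _ (@ival_continuous R) (@ival_itv R)).
Qed.

Fact half_twist_zero : half_twist_fun zero = base_conf q 2.
Proof.
apply: conf_eqP => j; apply: val_inj; rewrite !points_mk /=.
by rewrite ival_zero turn0.
Qed.

Fact half_twist_one : half_twist_fun one = conf_perm (base_conf q 2) swap.
Proof.
apply: conf_eqP => j; apply: val_inj; rewrite !points_mk /=.
by rewrite ival_one turn1.
Qed.

Definition half_twist : strands R q swap :=
  mk_path half_twist_continuous half_twist_zero half_twist_one.

Definition disk_sigma1 : braid R q 2 := braid_of half_twist.

End HalfTwist.
End Disk.

(* An embedded closed disk in M minus its boundary (embed is a homeomorphism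
   onto its image when M is Hausdorff, the disk being compact). Its interior
   contains all base points and the arcs of the curve joining them: an arc
   leaving the disk could make the removal of a strand of sigma1 nontrivial. *)
Record base_disk (R : realType) (M : topologicalType) (th : marked_curve R M) :=
  BaseDisk {
    embed : disk R -> M;
    embed_continuous : continuous embed;
    embed_inj : injective embed;
    embed_interior : range embed `<=` surface_interior R M;
    arc_in_disk : forall j s, mark th 0 <= s <= mark th j ->
      (range embed)° (curve th s);
    disk_points : base_points (disk R);
    embed_points : forall j, embed (disk_points j) = marked_points th j }.

Definition sigma1 (R : realType) (M : topologicalType) (th : marked_curve R M)
    (D : base_disk th) : braid R (marked_points th) 2 :=
  braid_map (@embed_continuous _ _ _ D) (@embed_inj _ _ _ D)
    (@embed_points _ _ _ D) (disk_sigma1 (disk_points D)).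

(* Main.v *)
From HB Require Import structures.
From mathcomp Require Import all_boot all_order all_algebra fingroup perm.
From mathcomp Require Import generic_quotient ring lra.
From mathcomp Require Import all_classical all_reals all_analysis homotopy.
Require Import Defs.
Set Implicit Arguments.
Unset Strict Implicit.
Unset Printing Implicit Defensive.
Import Order.TTheory GRing.Theory Num.Theory.
Import numFieldNormedType.Exports.
Local Open Scope classical_set_scope.
Local Open Scope quotient_scope.
Local Open Scope ring_scope.

(** For two strands everything is decided by the ordered configuration space
    F(M, 2), which is M x M minus its diagonal.

    A loop in F(M, 2) represents a pure braid, and removing a strand leaves the
    loop of the other point, conjugated by an arc of the curve. So a pure braid
    is Brunnian if and only if both coordinate loops are null-homotopic in M,
    that is, if the loop becomes null-homotopic in M x M. Filling in the
    diagonal, a subset of codimension two, kills in the fundamental group only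
    the conjugates of its meridians, and as M is connected, all meridians are
    conjugate, up to inversion, to the full twist of two points in the base
    disk, which is the square of sigma1. This is part (1). For part (2), sigma1
    is Brunnian because both loops that it leaves stay in the base disk, so
    multiplying by its inverse makes any Brunnian braid with the nontrivial
    permutation pure.

    The statement on the diagonal is proved without transversality, by a
    continuation argument. Fix a normal subgroup N of the fundamental group of
    F(M, 2). A box U x V in M x M is good if its part off the diagonal is path
    connected and all loops there lie in N, whatever path joins them to the base
    point. Over a good box, classes modulo N of paths from the base point behave
    like the sheets of a trivial covering, even where the box meets the
    diagonal. If the good boxes form a basis, these sheets can be continued
    along any square in M x M ([continuation_rectangle]), and so a loop that
    bounds a square lies in N ([monodromy_null], [collision_null]).

    The basis comes from charts onto convex subsets of the half-plane
    ([chart_cells]). Off the diagonal, boxes over two disjoint charts are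
    simply connected. On the diagonal, a homothety of a convex chart pushes all
    loops of pairs of points towards any chosen point of it, so the square of a
    chart is good as soon as one point of the chart has a neighborhood whose
    square is; this property spreads over the connected surface M from the base
    disk ([cell_loops_in], [all_cells_loops_in]). In the disk, a loop of two
    points is determined up to homotopy by the total variation of the angle of
    the vector that joins them, hence is a power of the full twist
    ([disk_loops_cyclic]).

    Removal is defined on braids through representing paths in F(X, n), so one
    also needs that F(X, n) covers its quotient by the symmetric group. This
    gives existence of representatives and their uniqueness up to homotopy
    ([braid_strands], [braid_of_perm], [braid_of_homotopic]), whence the
    crossed homomorphism law [removalM] for the removal of a strand. *)

(** * Subgroups *)

Section SubgroupLaws.
Context (G : groupType) (H : set G) (subH : is_subgroup H).
Local Open Scope group_scope.

Lemma subgroup1 : H 1. Proof. by case: subH. Qed.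

Lemma subgroupV a : H a -> H a^-1.
Proof. by case: subH => H1 HV /(HV _ _ H1); rewrite mul1g. Qed.

Lemma subgroupM a b : H a -> H b -> H (a * b).
Proof.
by case: subH => H1 HV Ha /subgroupV Hb; have := HV _ _ Ha Hb; rewrite invgK.
Qed.

End SubgroupLaws.

Section SmallestSubgroups.
Context (G : groupType).
Local Open Scope group_scope.

Lemma normal_closure_normal (S : set G) : is_normal_subgroup (normal_closure S).
Proof.
split; first split.
- by move=> H [[[H1 _] _] _].
- by move=> x y Nx Ny H HS; case: (HS) => -[[_ HV] _] _; apply: HV; [exact: Nx|exact: Ny].
- by move=> x g Nx H HS; case: (HS) => -[_ HJ] _; apply: HJ; exact: Nx.
Qed.

Lemma generated_subgroup (S : set G) : is_subgroup (generated S).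
Proof.
split; first by move=> H [[H1 _] _].
by move=> x y Nx Ny H HS; case: (HS) => -[_ HV] _; apply: HV; [exact: Nx|exact: Ny].
Qed.

End SmallestSubgroups.

(** * The fundamental groupoid *)

Section Groupoid.
Context (R : realType) (X : topologicalType).
Local Notation I := (interval01 R).

Section Hom.
Context (x y : X).

Definition homotopic_pathb (p q : {path I from x to y}) : bool :=
  `[< homotopic p q >].

Fact homotopic_pathb_refl : reflexive homotopic_pathb.
Proof. by move=> p; apply/asboolP; exact: homotopic_refl. Qed.

Fact homotopic_pathb_sym : symmetric homotopic_pathb.
Proof. by move=> p q; apply/asboolP/asboolP; exact: homotopic_sym. Qed.

Fact homotopic_pathb_trans : transitive homotopic_pathb.
Proof.
move=> q p r /asboolP pq /asboolP qr; apply/asboolP.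
exact: homotopic_trans pq qr.
Qed.

Definition homotopic_path_equiv := EquivRel homotopic_pathb
  homotopic_pathb_refl homotopic_pathb_sym homotopic_pathb_trans.

Definition hom : Type := {eq_quot homotopic_path_equiv}.

HB.instance Definition _ := Choice.on hom.
HB.instance Definition _ := Quotient.on hom.

Definition path_class (p : {path I from x to y}) : hom := \pi_hom p.

Lemma path_classP (p q : {path I from x to y}) :
  path_class p = path_class q <-> homotopic p q.
Proof. by split=> [/eqmodP/asboolP|pq] //; apply/eqmodP/asboolP. Qed.

Lemma hom_ind (P : hom -> Prop) : (forall p, P (path_class p)) -> forall a, P a.
Proof. by move=> H a; rewrite -(reprK a); exact: H. Qed.

Lemma homotopic_path_repr (p : {path I from x to y}) :
  homotopic (repr (path_class p)) p.
Proof. by apply/path_classP; exact: reprK. Qed.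

End Hom.

Definition hom_comp (x y z : X) (a : hom x y) (b : hom y z) : hom x z :=
  path_class (concat_path (repr a) (repr b)).
Definition hom_inv (x y : X) (a : hom x y) : hom y x :=
  path_class (reverse_path (repr a)).
Definition hom_id (x : X) : hom x x := path_class (const_path R x).

Local Notation "a ** b" := (hom_comp a b) (at level 40, left associativity).

Lemma hom_compE (x y z : X) (p : {path I from x to y}) (q : {path I from y to z}) :
  path_class p ** path_class q = path_class (concat_path p q).
Proof.
by apply/path_classP; apply: homotopic_concat; exact: homotopic_path_repr.
Qed.

Lemma hom_invE (x y : X) (p : {path I from x to y}) :
  hom_inv (path_class p) = path_class (reverse_path p).
Proof.
by apply/path_classP; apply: homotopic_reverse; exact: homotopic_path_repr.
Qed.

Lemma hom_compA (w x y z : X) (a : hom w x) (b : hom x y) (c : hom y z) :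
  a ** (b ** c) = a ** b ** c.
Proof.
elim/hom_ind: a => p; elim/hom_ind: b => q; elim/hom_ind: c => r.
by rewrite !hom_compE; apply/path_classP; exact: homotopic_concatA.
Qed.

Lemma hom_comp1p (x y : X) (a : hom x y) : hom_id x ** a = a.
Proof.
elim/hom_ind: a => p; rewrite hom_compE; apply/path_classP.
exact: homotopic_concat1p.
Qed.

Lemma hom_compp1 (x y : X) (a : hom x y) : a ** hom_id y = a.
Proof.
elim/hom_ind: a => p; rewrite hom_compE; apply/path_classP.
exact: homotopic_concatp1.
Qed.

Lemma hom_compVp (x y : X) (a : hom x y) : hom_inv a ** a = hom_id y.
Proof.
elim/hom_ind: a => p; rewrite hom_invE hom_compE; apply/path_classP.
exact: homotopic_concatVp.
Qed.

Lemma hom_comppV (x y : X) (a : hom x y) : a ** hom_inv a = hom_id x.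
Proof.
elim/hom_ind: a => p; rewrite hom_invE hom_compE; apply/path_classP.
exact: homotopic_concatpV.
Qed.

Lemma hom_compK (x y z : X) (a : hom x y) (b : hom y z) : a ** b ** hom_inv b = a.
Proof. by rewrite -hom_compA hom_comppV hom_compp1. Qed.

Lemma hom_compKV (x y z : X) (a : hom x y) (b : hom z y) : a ** hom_inv b ** b = a.
Proof. by rewrite -hom_compA hom_compVp hom_compp1. Qed.

Lemma hom_compI (x y z : X) (b : hom y z) : injective (fun a : hom x y => a ** b).
Proof. by move=> a a' aa'; rewrite -(hom_compK a b) aa' hom_compK. Qed.

Lemma hom_invK (x y : X) (a : hom x y) : hom_inv (hom_inv a) = a.
Proof. by apply: (@hom_compI _ _ _ (hom_inv a)); rewrite hom_comppV hom_compVp. Qed.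

Lemma hom_invM (x y z : X) (a : hom x y) (b : hom y z) :
  hom_inv (a ** b) = hom_inv b ** hom_inv a.
Proof.
by apply: (@hom_compI _ _ _ (a ** b)); rewrite hom_compVp hom_compA hom_compKV hom_compVp.
Qed.

Lemma hom_inv1 (x : X) : hom_inv (hom_id x) = hom_id x.
Proof. by rewrite -[LHS]hom_compp1 hom_compVp. Qed.

Definition hom_simpl := (hom_compA, hom_invM, hom_invK, hom_inv1, hom_comp1p,
  hom_compp1, hom_compK, hom_compKV, hom_compVp, hom_comppV).

(** The fundamental group and the loops of the groupoid are different quotients
    of the same type of paths. *)
Definition loop_class (x : X) (a : hom x x) : pi1 R x := pi1_class (repr a).

Lemma loop_classE (x : X) (p : {path I from x to x}) :
  loop_class (path_class p) = pi1_class p.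
Proof. by apply/pi1_classP; exact: homotopic_path_repr. Qed.

Lemma loop_classM (x : X) (a b : hom x x) :
  loop_class (a ** b) = (loop_class a * loop_class b)%g.
Proof.
elim/hom_ind: a => p; elim/hom_ind: b => q.
by rewrite hom_compE !loop_classE pi1_classM.
Qed.

Lemma loop_classV (x : X) (a : hom x x) :
  loop_class (hom_inv a) = (loop_class a)^-1%g.
Proof. by elim/hom_ind: a => p; rewrite hom_invE !loop_classE pi1_classV. Qed.

Lemma loop_class1 (x : X) : loop_class (hom_id x) = 1%g.
Proof. by rewrite loop_classE. Qed.

Lemma loop_class_inj (x : X) : injective (@loop_class x).
Proof.
move=> a b; elim/hom_ind: a => p; elim/hom_ind: b => q.
by rewrite !loop_classE => /pi1_classP pq; apply/path_classP.
Qed.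

(** Two paths that factor through the plane with the same end points there are
    homotopic, because the plane is convex. *)
Lemma homotopic_plane (x y : X) (p q : {path I from x to y}) (f : R * R -> X)
    (u v : R -> R * R) :
  continuous f -> continuous u -> continuous v -> u 0 = v 0 -> u 1 = v 1 ->
  (forall t, 0 <= t <= 1 -> extend_path p t = f (u t)) ->
  (forall t, 0 <= t <= 1 -> extend_path q t = f (v t)) ->
  homotopic p q.
Proof.
move=> cf cu cv uv0 uv1 pE qE.
have E0 : f (u 0) = x by rewrite -pE ?lexx ?ler01 // extend_path_le0.
have E1 : f (u 1) = y by rewrite -pE ?lexx ?ler01 // extend_path_ge1.
have lin (r z : R) : (1 - r) * z + r * z = z by rewrite -mulrDl subrK mul1r.
apply: (@homotopicI _ _ _ _ _ _ (fun w =>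
  f ((1 - w.1) * (u w.2).1 + w.1 * (v w.2).1,
     (1 - w.1) * (u w.2).2 + w.1 * (v w.2).2))) => /=.
- apply: (continuous_compT _ cf); continuity.
  + by apply: (continuous_compT _ (@continuous_fst R R));
      apply: (continuous_compT _ cu); continuity.
  + by apply: (continuous_compT _ (@continuous_fst R R));
      apply: (continuous_compT _ cv); continuity.
  + by apply: (continuous_compT _ (@continuous_snd R R));
      apply: (continuous_compT _ cu); continuity.
  + by apply: (continuous_compT _ (@continuous_snd R R));
      apply: (continuous_compT _ cv); continuity.
- move=> t t01; rewrite pE // subr0 !mul1r !mul0r !addr0.
  by case: (u t).
- move=> t t01; rewrite qE // subrr !mul1r !mul0r !add0r.
  by case: (v t).
- by move=> s _; rewrite -uv0 !lin -[RHS]E0; case: (u 0).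
- by move=> s _; rewrite -uv1 !lin -[RHS]E1; case: (u 1).
Qed.

(** Both ways around a square are images of paths in the plane. A free homotopy
    of loops is the case where the sides [b] and [t] coincide: it exhibits [l]
    as a conjugate of [r]. *)
Lemma square_commutes (x00 x10 x01 x11 : X) (f : R * R -> X)
    (b : {path I from x00 to x10}) (r : {path I from x10 to x11})
    (l : {path I from x00 to x01}) (t : {path I from x01 to x11}) :
  continuous f ->
  (forall s, 0 <= s <= 1 -> extend_path b s = f (s, 0)) ->
  (forall s, 0 <= s <= 1 -> extend_path r s = f (1, s)) ->
  (forall s, 0 <= s <= 1 -> extend_path l s = f (0, s)) ->
  (forall s, 0 <= s <= 1 -> extend_path t s = f (s, 1)) ->
  path_class b ** path_class r = path_class l ** path_class t.
Proof.
move=> cf bE rE lE tE; rewrite !hom_compE; apply/path_classP.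
have cmin : continuous (fun s : R => Num.min 1 (2 * s)).
  by apply: min_fun_continuous; continuity.
have cmax : continuous (fun s : R => Num.max 0 (2 * s - 1)).
  by apply: max_fun_continuous; continuity.
apply: (@homotopic_plane _ _ _ _ f
  (fun s => (Num.min 1 (2 * s), Num.max 0 (2 * s - 1)))
  (fun s => (Num.max 0 (2 * s - 1), Num.min 1 (2 * s)))) => //.
- exact: continuous_pair cmin cmax.
- exact: continuous_pair cmax cmin.
- by rewrite minEle maxEle; congr pair; do ! case: ifPn; lra.
- by rewrite minEle maxEle; congr pair; do ! case: ifPn; lra.
- move=> s s01; rewrite extend_pathE // /concat_fun minEle maxEle.
  have [s2|s2] := leP s 2^-1.
    rewrite bE; last by lra.
    by congr (f (_, _)); case: ifPn; lra.
  rewrite rE; last by lra.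
  by congr (f (_, _)); case: ifPn; lra.
- move=> s s01; rewrite extend_pathE // /concat_fun minEle maxEle.
  have [s2|s2] := leP s 2^-1.
    rewrite lE; last by lra.
    by congr (f (_, _)); case: ifPn; lra.
  rewrite tE; last by lra.
  by congr (f (_, _)); case: ifPn; lra.
Qed.

End Groupoid.

Notation "a ** b" := (hom_comp a b) (at level 40, left associativity).

Section HomMap.
Context (R : realType) (X Y : topologicalType) (f : X -> Y).
Context (cf : continuous f).
Local Notation I := (interval01 R).

Lemma map_path_concat (x y z : X) (x' y' z' : Y) (ex : f x = x') (ey : f y = y')
    (ez : f z = z') (p : {path I from x to y}) (q : {path I from y to z}) :
  map_path cf ex ez (concat_path p q) =
    concat_path (map_path cf ex ey p) (map_path cf ey ez q).
Proof.
apply/path_eqP => t /=.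
rewrite /mk_path /= /mk_path /= /concat_fun /extend_path /=.
by case: ifP.
Qed.

Lemma map_path_reverse (x y : X) (x' y' : Y) (ex : f x = x') (ey : f y = y')
    (p : {path I from x to y}) :
  map_path cf ey ex (reverse_path p) = reverse_path (map_path cf ex ey p).
Proof. exact/path_eqP. Qed.

Lemma homotopic_map (x y : X) (x' y' : Y) (ex : f x = x') (ey : f y = y')
    (p q : {path I from x to y}) :
  homotopic p q -> homotopic (map_path cf ex ey p) (map_path cf ex ey q).
Proof.
move=> [H [cH H0 H1 Hx Hy]].
exists (f \o H); split => [|t|t|s|s] /=.
- exact: (continuous_compT cH cf).
- by rewrite H0.
- by rewrite H1.
- by rewrite Hx.
- by rewrite Hy.
Qed.

Definition hom_map (x y : X) (x' y' : Y) (ex : f x = x') (ey : f y = y')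
    (a : hom R x y) : hom R x' y' := path_class (map_path cf ex ey (repr a)).

Lemma hom_mapE (x y : X) (x' y' : Y) (ex : f x = x') (ey : f y = y')
    (p : {path I from x to y}) :
  hom_map ex ey (path_class p) = path_class (map_path cf ex ey p).
Proof.
by apply/path_classP; apply: homotopic_map; exact: homotopic_path_repr.
Qed.

Lemma hom_mapM (x y z : X) (x' y' z' : Y) (ex : f x = x') (ey : f y = y')
    (ez : f z = z') (a : hom R x y) (b : hom R y z) :
  hom_map ex ez (a ** b) = hom_map ex ey a ** hom_map ey ez b.
Proof.
elim/hom_ind: a => p; elim/hom_ind: b => q.
by rewrite hom_compE !hom_mapE hom_compE (map_path_concat ex ey ez).
Qed.

Lemma hom_mapV (x y : X) (x' y' : Y) (ex : f x = x') (ey : f y = y')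
    (a : hom R x y) :
  hom_map ey ex (hom_inv a) = hom_inv (hom_map ex ey a).
Proof.
elim/hom_ind: a => p.
by rewrite hom_invE !hom_mapE hom_invE map_path_reverse.
Qed.

Lemma loop_class_map (x : X) (y : Y) (e : f x = y) (a : hom R x x) :
  loop_class (hom_map e e a) = pi1_map cf e (loop_class a).
Proof. by elim/hom_ind: a => p; rewrite hom_mapE !loop_classE pi1_mapE. Qed.

End HomMap.

Section Pi1Map.
Context (R : realType) (X Y : topologicalType) (f : X -> Y) (cf : continuous f).
Context (x : X) (y : Y) (e : f x = y).

Lemma pi1_map1 : pi1_map cf e (1%g : pi1 R x) = 1%g.
Proof.
have : pi1_map cf e ((1 * 1)%g : pi1 R x) = (pi1_map cf e 1 * pi1_map cf e 1)%g.
  exact: pi1_mapM.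
by rewrite mulg1 -[LHS]mulg1 => /mulgI/esym.
Qed.

Lemma pi1_mapV (a : pi1 R x) : pi1_map cf e (a^-1)%g = (pi1_map cf e a)^-1%g.
Proof.
have : pi1_map cf e (a * a^-1)%g = (pi1_map cf e a * pi1_map cf e a^-1)%g.
  exact: pi1_mapM.
by rewrite mulgV pi1_map1 => E; rewrite -[LHS](mulKg (pi1_map cf e a)) -E mulg1.
Qed.

Lemma preimage_subgroup (N : set (pi1 R y)) :
  is_subgroup N -> is_subgroup (pi1_map cf e @^-1` N).
Proof.
move=> [N1 NV]; split=> [|a b Na Nb]; rewrite /preimage /=; first by rewrite pi1_map1.
by rewrite pi1_mapM pi1_mapV; exact: NV.
Qed.

Lemma preimage_normal (N : set (pi1 R y)) :
  is_normal_subgroup N -> is_normal_subgroup (pi1_map cf e @^-1` N).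
Proof.
move=> [subN NJ]; split; first exact: preimage_subgroup.
move=> a b Na; rewrite /preimage /= /conjg !pi1_mapM pi1_mapV; exact: NJ.
Qed.

End Pi1Map.

(** * Gluing on intervals, rectangles and connected sets *)

Section LocalToGlobal.
Context (R : realType).

(** A local property of intervals that is stable under juxtaposition is global:
    consider the supremum of the [t] such that it holds on [a, t]. *)
Lemma interval_gluing (P : R -> R -> Prop) :
  (forall x, exists2 e, 0 < e &
     forall a b, x - e < a -> a <= b -> b < x + e -> P a b) ->
  (forall a b c, a <= b -> b <= c -> P a b -> P b c -> P a c) ->
  forall a b, a <= b -> P a b.
Proof.
move=> loc glue a b ab.
pose S := [set t | a <= t <= b /\ P a t].
have Sa : S a.
  split; first by rewrite lexx.
  by have [e e0 He] := loc a; apply: He => //; rewrite ?ltrBlDr ltrDl.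
have supS : has_sup S by split; [exists a | exists b => t [/andP[]]].
have [e e0 He] := loc (sup S).
have [t [/andP[at_ tb] Pat] ts] := sup_adherent e0 supS.
have ts' : t <= sup S by apply: ub_le_sup => //; [case: supS | split; rewrite ?at_].
(* either [b], or a point beyond the supremum, which is absurd *)
pose u := Num.min b (sup S + e / 2).
have uE : u = b \/ sup S < u /\ u = sup S + e / 2.
  by rewrite /u minEle; case: ifPn => _; [left | right; split=> //; lra].
have tu : t <= u by rewrite /u le_min tb; lra.
have ub : u <= b by rewrite /u ge_min lexx.
have us : u < sup S + e by rewrite /u gt_min; apply/orP; right; lra.
have Pau : P a u by apply: (glue a t u) => //; exact: He.
case: uE => [<- //|[su _]].
have : u <= sup S.
  by apply: ub_le_sup; [case: supS | split=> //; rewrite (le_trans at_ tu)].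
by rewrite leNgt su.
Qed.

(** The interval principle applied twice: in the second direction to a property
    of thin rectangles around a vertical line, then in the first direction. *)
Lemma rectangle_gluing (P : R -> R -> R -> R -> Prop) :
  (forall x y, exists2 e, 0 < e & forall a b c d,
     x - e < a -> a <= b -> b < x + e ->
     y - e < c -> c <= d -> d < y + e -> P a b c d) ->
  (forall a b e c d, a <= b -> b <= e -> c <= d ->
     P a b c d -> P b e c d -> P a e c d) ->
  (forall a b c d e, a <= b -> c <= d -> d <= e ->
     P a b c d -> P a b d e -> P a b c e) ->
  forall a b c d, a <= b -> c <= d -> P a b c d.
Proof.
move=> loc glueh gluev a b c d ab cd.
apply: (interval_gluing (P := fun a b => P a b c d)) (ab) => [x|]; last first.
  by move=> *; apply: glueh; eauto.
apply: (interval_gluing (P := fun c d => exists2 e, 0 < e &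
  forall a b, x - e < a -> a <= b -> b < x + e -> P a b c d)) (cd).
  move=> y; have [e e0 He] := loc x y; exists e => // c' d' *.
  by exists e => // *; exact: He.
move=> c' d' e' cd' de' [e1 e10 He1] [e2 e20 He2].
exists (Num.min e1 e2); first by rewrite lt_min e10.
move=> a' b' xa ab' bx; have m1 : Num.min e1 e2 <= e1 by rewrite ge_min lexx.
have m2 : Num.min e1 e2 <= e2 by rewrite ge_min lexx orbT.
by apply: (gluev _ _ _ d') => //; [apply: He1 | apply: He2] => //; lra.
Qed.

Lemma connected_ind (T : topologicalType) (A : set T) (G : T -> Prop) :
  connected A ->
  (forall q, A q -> \forall q' \near q, A q' -> (G q <-> G q')) ->
  forall q0 q, A q0 -> G q0 -> A q -> G q.
Proof.
move=> cA loc q0 q Aq0 Gq0 Aq.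
suff BA : [set q | A q /\ G q] = A by move: Aq; rewrite -{1}BA => -[].
apply: cA; first by exists q0.
- exists ([set q | A q -> G q]°); first exact: open_interior.
  apply/seteqP; split => [t [At Gt]|t [At /interior_subset/(_ At) Gt]] //.
  split=> //; have := loc t At; apply: filterS => t' H At'.
  by apply/(H At').
- exists (~` [set q | A q -> ~ G q]°); first exact/open_closedC/open_interior.
  apply/seteqP; split => [t [At Gt]|t [At Gt]]; split=> //.
    by move=> /interior_subset/(_ At).
  apply: contrapT => nGt; apply: Gt.
  by have := loc t At; apply: filterS => t' H At' Gt'; apply/nGt/(H At').
Qed.

Lemma connected_setT_real : connected [set: R].
Proof. by apply/connected_intervalP => x y _ _ z _. Qed.

End LocalToGlobal.

(** * Lifting through coverings *)

Section Lifting.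
Context (R : realType) (C B : topologicalType) (f : C -> B).

(** Together with [locally_injective], this is the part of the notion of
    covering that lifting squares requires. *)
Definition has_local_sections : Prop := forall b : B, exists2 O, open_nbhs b O &
  forall c, O (f c) -> exists s : B -> C, s (f c) = c /\
    forall b', O b' -> f (s b') = b' /\ {for b', continuous s}.

Definition locally_injective : Prop := forall c : C, exists2 O, nbhs c O &
  forall c1 c2, O c1 -> O c2 -> f c1 = f c2 -> c1 = c2.

Context (hausC : hausdorff_space C) (secf : has_local_sections).
Context (injf : locally_injective).

(** The set where two lifts agree is open by local injectivity, and closed
    because the target is Hausdorff. *)
Lemma lift_unique (T : topologicalType) (u v : T -> C) (t0 t : T) :
  connected [set: T] -> continuous u -> continuous v ->
  (forall t, f (u t) = f (v t)) -> u t0 = v t0 -> u t = v t.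
Proof.
move=> cT cu cv uv uv0.
apply: (connected_ind (G := fun t => u t = v t) cT _ (I : setT t0) uv0) => // q _.
have [uvq|uvq] := pselect (u q = v q).
  have [W Ou inj] := injf (u q).
  have Ov : nbhs (v q) W by rewrite -uvq.
  have cuO : \forall q' \near q, W (u q') := cu q _ Ou.
  have cvO : \forall q' \near q, W (v q') := cv q _ Ov.
  by near=> q' => _; split=> // _; apply: inj => //; near: q'.
move: hausC; rewrite open_hausdorff => /(_ (u q) (v q)).
move=> /(_ (introN eqP uvq)) [[U V] [/= Uu Vv] [oU oV UV]].
have nU : nbhs (u q) U by apply: open_nbhs_nbhs; split=> //; exact: set_mem.
have nV : nbhs (v q) V by apply: open_nbhs_nbhs; split=> //; exact: set_mem.
have cuU : \forall q' \near q, U (u q') := cu q _ nU.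
have cvV : \forall q' \near q, V (v q') := cv q _ nV.
near=> q' => _; split=> // uvq'.
have : (U `&` V) (u q') by split; [near: q' | rewrite uvq'; near: q'].
by rewrite (eqP UV).
Unshelve. all: by end_near. Qed.

Definition clip (a b t : R) : R := Num.max a (Num.min b t).

Lemma clip_continuous (a b : R) : continuous (clip a b).
Proof.
apply: max_fun_continuous; first exact: cst_continuous.
by apply: min_fun_continuous; [exact: cst_continuous | move=> t; exact: cvg_id].
Qed.

Lemma clip_itv (a b t : R) : a <= b -> a <= clip a b t <= b.
Proof. by move=> ab; rewrite /clip le_max lexx ge_max ab ge_min lexx. Qed.

Lemma clip_id (a b t : R) : a <= t <= b -> clip a b t = t.
Proof. by move=> /andP[a0 b0]; rewrite /clip (min_idPr b0) (max_idPr a0). Qed.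

(** On a small rectangle a local section gives the lift; two lifts that agree at
    a vertex of a common side agree on it. Each lift is precomposed with the
    retraction onto its rectangle, which makes it continuous on the plane. *)
Lemma lift_rectangle (h : R * R -> B) : continuous h ->
  forall a b c d, a <= b -> c <= d -> forall c0, f c0 = h (a, c) ->
  exists L : R * R -> C, [/\ continuous L, L (a, c) = c0 &
    forall x y, a <= x <= b -> c <= y <= d -> f (L (x, y)) = h (x, y)].
Proof.
move=> ch.
apply: (rectangle_gluing (P := fun a b c d => forall c0, f c0 = h (a, c) ->
  exists L : R * R -> C, [/\ continuous L, L (a, c) = c0 &
    forall x y, a <= x <= b -> c <= y <= d -> f (L (x, y)) = h (x, y)])).
- move=> x y; have [W [oO Oh] sec] := secf (h (x, y)).
  have : nbhs (x, y) (h @^-1` W) by apply: ch; exact: open_nbhs_nbhs.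
  move=> /nbhs_ballP[e e0 He]; exists e => // a b c d xa ab bx yc cd dy c0 c0E.
  have Orect u v : a <= u <= b -> c <= v <= d -> W (h (u, v)).
    move=> uab vcd; apply: (He (u, v)).
    by split; rewrite /ball /= ltr_distlC; lra.
  have [|s [s0 Os]] := sec c0; first by rewrite c0E; apply: Orect; rewrite lexx.
  exists (fun q => s (h (clip a b q.1, clip c d q.2))); split.
  + move=> q; apply: (@continuous_comp _ _ _
      (fun q => h (clip a b q.1, clip c d q.2)) s).
      apply: (continuous_compT _ ch (f := fun q : R * R => (clip a b q.1, clip c d q.2))).
      by apply: continuous_pair;
        apply: (continuous_compT _ (@clip_continuous _ _)); continuity.
    by apply: (Os _ _).2; apply: Orect; exact: clip_itv.
  + by rewrite /= !clip_id ?lexx // -c0E.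
  + move=> u v uab vcd /=; rewrite !clip_id //.
    by apply: (Os _ _).1; exact: Orect.
- move=> a b e c d ab be cd P1 P2 c0 c0E.
  have [L1 [cL1 L10 L1h]] := P1 c0 c0E.
  have [|L2 [cL2 L20 L2h]] := P2 (L1 (b, c)); first by rewrite L1h ?lexx // ab.
  have agree y : L1 (b, clip c d y) = L2 (b, clip c d y).
    apply: (@lift_unique R (fun y => L1 (b, clip c d y))
      (fun y => L2 (b, clip c d y)) c y).
    + exact: connected_setT_real.
    + apply: (continuous_compT _ cL1); apply: continuous_pair; first by continuity.
      exact: clip_continuous.
    + apply: (continuous_compT _ cL2); apply: continuous_pair; first by continuity.
      exact: clip_continuous.
    + by move=> t; rewrite L1h ?L2h ?clip_itv ?lexx ?ab ?be.
    + by rewrite clip_id ?lexx.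
  exists (fun q => if q.1 <= b then L1 (q.1, clip c d q.2)
                   else L2 (q.1, clip c d q.2)); split.
  + apply: glue_continuous; first by continuity.
    * apply: (continuous_compT _ cL1); apply: continuous_pair; first by continuity.
      by apply: (continuous_compT _ (@clip_continuous _ _)); continuity.
    * apply: (continuous_compT _ cL2); apply: continuous_pair; first by continuity.
      by apply: (continuous_compT _ (@clip_continuous _ _)); continuity.
    * by move=> q ->; exact: agree.
  + by rewrite /= ab clip_id ?lexx.
  + move=> x y xae ycd /=; rewrite clip_id //.
    by have [xb|xb] := leP x b; [apply: L1h | apply: L2h] => //; lra.
- move=> a b c d e ab cd de P1 P2 c0 c0E.
  have [L1 [cL1 L10 L1h]] := P1 c0 c0E.
  have [|L2 [cL2 L20 L2h]] := P2 (L1 (a, d)); first by rewrite L1h ?lexx // cd.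
  have agree y : L1 (clip a b y, d) = L2 (clip a b y, d).
    apply: (@lift_unique R (fun y => L1 (clip a b y, d))
      (fun y => L2 (clip a b y, d)) a y).
    + exact: connected_setT_real.
    + apply: (continuous_compT _ cL1); apply: continuous_pair; last by continuity.
      exact: clip_continuous.
    + apply: (continuous_compT _ cL2); apply: continuous_pair; last by continuity.
      exact: clip_continuous.
    + by move=> t; rewrite L1h ?L2h ?clip_itv ?lexx ?cd ?de.
    + by rewrite clip_id ?lexx.
  exists (fun q => if q.2 <= d then L1 (clip a b q.1, q.2)
                   else L2 (clip a b q.1, q.2)); split.
  + apply: glue_continuous; first by continuity.
    * apply: (continuous_compT _ cL1); apply: continuous_pair; last by continuity.
      by apply: (continuous_compT _ (@clip_continuous _ _)); continuity.
    * apply: (continuous_compT _ cL2); apply: continuous_pair; last by continuity.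
      by apply: (continuous_compT _ (@clip_continuous _ _)); continuity.
    * by move=> q ->; exact: agree.
  + by rewrite /= cd clip_id ?lexx.
  + move=> x y xae ycd /=; rewrite clip_id //.
    by have [xb|xb] := leP y d; [apply: L1h | apply: L2h] => //; lra.
Qed.

End Lifting.

(** * Configuration spaces cover their orbit spaces *)

Lemma separate_points (T : topologicalType) (x y : T) :
  hausdorff_space T -> x <> y -> exists U V : set T,
    [/\ nbhs x U, nbhs y V & forall z, U z -> V z -> False].
Proof.
rewrite open_hausdorff => /(_ x y) H /eqP/H[[U V] [/= Uu Vv] [oU oV UV]].
exists U, V; split.
- by apply: open_nbhs_nbhs; split=> //; exact: set_mem.
- by apply: open_nbhs_nbhs; split=> //; exact: set_mem.
- move=> z Uz Vz; have : (U `&` V) z by [].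
  by rewrite (eqP UV).
Qed.

Section ConfCovering.
Context (n : nat) (X : topologicalType) (hausX : hausdorff_space X).
Local Notation C := (conf n X).

Lemma nbhs_points (c : C) (j : 'I_n) (U : set X) :
  nbhs (points c j) U -> \forall d \near c, U (points d j).
Proof. by move=> cU; exact: (@points_continuous n X j c _ cU). Qed.

Lemma conf_hausdorff : hausdorff_space C.
Proof.
move=> c d cd; apply: conf_eqP => j; apply: contrapT => cdj.
have [U [V [cU dV UV]]] := separate_points hausX cdj.
have [e [Ue Ve]] := cd _ _ (nbhs_points cU) (nbhs_points dV).
exact: (UV (points e j)).
Qed.

Lemma conf_perm_continuous (s : 'S_n) : continuous (@conf_perm n X ^~ s).
Proof. by apply: conf_continuous => j; exact: points_continuous. Qed.

Lemma conf_permM (c : C) (s u : 'S_n) :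
  conf_perm (conf_perm c s) u = conf_perm c (u * s)%g.
Proof. by apply: conf_eqP => j; rewrite !points_perm permM. Qed.

Lemma conf_perm1 (c : C) : conf_perm c 1%g = c.
Proof. by apply: conf_eqP => j; rewrite !points_perm perm1. Qed.

Lemma conf_perm_inj (c : C) : injective (@conf_perm n X c).
Proof.
move=> s u su; apply/permP => j; apply: (@points_inj _ _ c).
by rewrite -!points_perm su.
Qed.

Lemma to_uconf_open (W : set C) : open W -> open (@to_uconf n X @` W).
Proof.
move=> oW; rewrite /open /= /quotient_open.
have -> : \pi_(uconf n X) @^-1` [set to_uconf x | x in W] =
    \bigcup_(s in [set: 'S_n]) (@conf_perm n X ^~ s) @^-1` W.
  apply/seteqP; split => [d [c Wc cd]|d [s _ Ws]].
    have /to_uconfP[s cE] : to_uconf d = to_uconf c by [].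
    by exists s => //=; rewrite -cE.
  by exists (conf_perm d s) => //; exact: to_uconf_perm.
apply: bigcup_open => s _.
by have /continuousP := @conf_perm_continuous s; apply.
Qed.

(** The symmetric group permutes the points of [c] freely, and distinct points
    have disjoint neighborhoods. As the group is finite, finitely many
    conditions on the neighborhood of [c] suffice. *)
Lemma free_nbhs (c : C) : exists2 W, open_nbhs c W &
  forall d s, W d -> W (conf_perm d s) -> s = 1%g.
Proof.
have /choice[N HN] : forall s : 'S_n, exists Ns : set C, nbhs c Ns /\
    forall d, Ns d -> Ns (conf_perm d s) -> s = 1%g.
  move=> s.
  have [s1|s1] := pselect (s = 1%g); first by exists setT; split=> //; exact: filterT.
  have [j sj] : exists j, s j <> j.
    by apply/not_existsP => sid; apply: s1; apply/permP => j; rewrite perm1;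
      apply: contrapT => /sid.
  have csj : points c j <> points c (s j) by move=> /points_inj/esym.
  have [U [V [cU dV UV]]] := separate_points hausX csj.
  exists [set d | U (points d j) /\ V (points d (s j))]; split.
    by apply: filterI; exact: nbhs_points.
  move=> d [_ Vd] [Ud _]; rewrite points_perm in Ud.
  by case: (UV _ Ud Vd).
have nW : \forall d \near c, forall s, N s d.
  have : Filter (nbhs c) by exact: nbhs_filter.
  by move=> /(@filter_forall _ _ N _); apply => s; exact: (HN s).1.
exists ([set d | forall s, N s d]°); first by split=> //; exact: open_interior.
move=> d s /interior_subset Wd /interior_subset Wds.
exact: ((HN s).2 d (Wd s) (Wds s)).
Qed.

Lemma to_uconf_locally_injective : locally_injective (@to_uconf n X).
Proof.
move=> c; have [W oW Wfree] := free_nbhs c.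
exists W; first exact: open_nbhs_nbhs.
move=> c1 c2 W1 + /to_uconfP[s c2E]; rewrite c2E => /(Wfree _ _ W1) ->.
by rewrite conf_perm1.
Qed.

(** A free neighborhood [W] meets each orbit at most once, so the orbits that
    meet it have a representative in [W], which depends continuously on the
    orbit as the quotient map is open. A permutation of this section passes
    through any given point of the fiber. *)
Lemma to_uconf_has_local_sections : has_local_sections (@to_uconf n X).
Proof.
move=> b; have [c <-] : exists c, to_uconf c = b by exists (repr b); exact: reprK.
have [W [oW Wc] Wfree] := free_nbhs c.
have oO := to_uconf_open oW.
exists (@to_uconf n X @` W); first by split=> //; exists c.
move=> c' [d0 Wd0 /esym/to_uconfP[s0 d0E]].
have /choice[r Hr] : forall b' : uconf n X, exists d : C,
    (@to_uconf n X @` W) b' -> W d /\ to_uconf d = b'.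
  move=> b'.
  have [[d Wd dE]|no] := pselect ((@to_uconf n X @` W) b'); first by exists d.
  by exists c => /no.
have uniq d1 d2 : W d1 -> W d2 -> to_uconf d1 = to_uconf d2 -> d1 = d2.
  move=> W1 + /to_uconfP[s d2E]; rewrite d2E => /(Wfree _ _ W1) ->.
  by rewrite conf_perm1.
exists (fun b' => conf_perm (r b') s0^-1%g); split.
  have [|Wr rE] := Hr (to_uconf c'); first by exists d0 => //; rewrite d0E to_uconf_perm.
  have -> : r (to_uconf c') = d0.
    by apply: uniq => //; rewrite rE d0E to_uconf_perm.
  by rewrite d0E conf_permM mulVg conf_perm1.
move=> b' Ob'; have [Wr rE] := Hr b' Ob'; split; first by rewrite to_uconf_perm.
apply: (@continuous_comp _ _ _ r (@conf_perm n X ^~ s0^-1%g)); last first.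
  exact: conf_perm_continuous.
move=> V; rewrite nbhsE => -[V' [oV' V'r] V'V].
have : open_nbhs b' (@to_uconf n X @` (W `&` V')).
  by split; [apply: to_uconf_open; exact: openI | exists (r b')].
move=> /open_nbhs_nbhs; apply: filterS => b'' [d [Wd Vd] dE]; apply: V'V.
have [|Wr' rE'] := Hr b''; first by exists d.
by rewrite /= (uniq _ _ Wr' Wd) // rE'.
Qed.

End ConfCovering.

(** * Braids as homotopy classes of strands *)

Section Strands.
Context (R : realType) (X : topologicalType) (hausX : hausdorff_space X).
Context (p : base_points X) (n : nat).
Local Notation I := (interval01 R).

Local Notation base := (base_conf p n).

Lemma lift_square (h : R * R -> uconf n X) : continuous h ->
  h (0, 0) = to_uconf base -> exists L : R * R -> conf n X,
    [/\ continuous L, L (0, 0) = base &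
    forall x y, 0 <= x <= 1 -> 0 <= y <= 1 -> to_uconf (L (x, y)) = h (x, y)].
Proof.
move=> ch h0; have hausC := @conf_hausdorff n X hausX.
apply: (@lift_rectangle R _ _ (@to_uconf n X)) => //.
- exact: to_uconf_has_local_sections.
- exact: to_uconf_locally_injective.
Qed.

Let I0 : 0 <= (0 : R) <= 1. Proof. by rewrite lexx ler01. Qed.
Let I1 : 0 <= (1 : R) <= 1. Proof. by rewrite lexx ler01. Qed.

(** The lift of a square that is constant in one direction is the lift of a
    path; it ends in the orbit of its starting point. *)
Lemma braid_strands (b : braid R p n) :
  exists s (g : strands R p s), braid_of g = b.
Proof.
elim/pi1_ind: b => l.
have [||L [cL L0 Ll]] := @lift_square (fun q => extend_path l q.2).
- by apply: (continuous_compT _ (@extend_path_continuous _ _ _ _ l)); continuity.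
- by rewrite /= extend_path_le0.
have [s L1] : exists s, L (0, 1) = conf_perm base s.
  by apply/to_uconfP; rewrite Ll //= extend_path_ge1.
have cL' : continuous (fun t : R => L (0, t)).
  by apply: (continuous_compT _ cL); continuity.
exists s, (path_of_fun cL' L0 L1); rewrite /braid_of; congr pi1_class.
by apply/path_eqP => t; rewrite -[RHS]extend_path_val; exact: (Ll _ _ I0 (ival_itv t)).
Qed.

Lemma lift_segment_unique (u v : R -> conf n X) (t : R) :
  continuous u -> continuous v ->
  (forall t, 0 <= t <= 1 -> to_uconf (u t) = to_uconf (v t)) ->
  u 0 = v 0 -> 0 <= t <= 1 -> u t = v t.
Proof.
move=> cu cv uv uv0 t01; rewrite -(clip_id t01).
apply: (@lift_unique _ _ (@to_uconf n X) (@conf_hausdorff n X hausX)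
  (to_uconf_locally_injective hausX) R (fun t => u (clip 0 1 t))
  (fun t => v (clip 0 1 t)) 0) => [|||z|].
- exact: connected_setT_real.
- exact: (continuous_compT (@clip_continuous _ _ _) cu).
- exact: (continuous_compT (@clip_continuous _ _ _) cv).
- by apply: uv; exact: clip_itv.
- by rewrite clip_id.
Qed.

(** The lift of a homotopy between two braids starts at the given strands, as
    lifts of paths are unique, and it is constant along the two sides where the
    homotopy is. *)
Lemma braid_of_lift (s s' : 'S_n) (g : strands R p s) (g' : strands R p s') :
  braid_of g = braid_of g' -> exists L : R * R -> conf n X, [/\ continuous L,
    forall t, 0 <= t <= 1 -> L (0, t) = extend_path g t,
    forall t, 0 <= t <= 1 -> L (1, t) = extend_path g' t,
    forall r, 0 <= r <= 1 -> L (r, 0) = base &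
    forall r, 0 <= r <= 1 -> L (r, 1) = conf_perm base s].
Proof.
move=> /pi1_classP/homotopicE[K [cK K0 K1 Kxy]].
have [|L [cL L0 Ll]] := lift_square cK; first by rewrite (Kxy _ _).1.
have cLv x : continuous (fun t => L (x, t)).
  by apply: (continuous_compT _ cL); continuity.
have cLh y : continuous (fun t => L (t, y)).
  by apply: (continuous_compT _ cL); continuity.
have L0t t : 0 <= t <= 1 -> L (0, t) = extend_path g t.
  apply: (lift_segment_unique (cLv 0) (@extend_path_continuous _ _ _ _ g)).
    by move=> z z01; rewrite Ll // K0.
  by rewrite L0 extend_path_le0.
have Lr0 r : 0 <= r <= 1 -> L (r, 0) = base.
  apply: (lift_segment_unique (cLh 0) (@cst_continuous _ _ base)) => //.
  by move=> z z01; rewrite Ll // (Kxy _ _).1.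
exists L; split=> // [t t01|r r01].
  apply: (lift_segment_unique (cLv 1) (@extend_path_continuous _ _ _ _ g')) => //.
    by move=> z z01; rewrite Ll // K1.
  by rewrite Lr0 // extend_path_le0.
rewrite -[RHS](extend_path_ge1 g (lexx 1)) -L0t //.
apply: (lift_segment_unique (cLh 1) (@cst_continuous _ _ (L (0, 1)))) => //.
by move=> z z01; rewrite !Ll // !(Kxy _ _).2.
Qed.

Lemma braid_of_perm (s s' : 'S_n) (g : strands R p s) (g' : strands R p s') :
  braid_of g = braid_of g' -> s = s'.
Proof.
move=> /braid_of_lift[L [_ _ L1 _ Lr1]]; apply: (@conf_perm_inj _ _ base).
by rewrite -(Lr1 1) // L1 // extend_path_ge1.
Qed.

Lemma braid_of_homotopic (s : 'S_n) (g g' : strands R p s) :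
  braid_of g = braid_of g' -> homotopic g g'.
Proof.
move=> /braid_of_lift[L [cL L0 L1 Lx Ly]].
exact: (@homotopicI _ _ _ _ _ _ L).
Qed.

End Strands.

Section BraidPerm.
Context (R : realType) (X : topologicalType) (hausX : hausdorff_space X).
Context (p : base_points X) (n : nat).
Local Notation I := (interval01 R).
Local Notation base := (base_conf p n).

(** The permutation of a braid, as a relation, which is functional when the
    space is Hausdorff. *)
Definition braid_perm (b : braid R p n) (s : 'S_n) : Prop :=
  exists g : strands R p s, braid_of g = b.

Lemma braid_perm_fun (b : braid R p n) (s s' : 'S_n) :
  braid_perm b s -> braid_perm b s' -> s = s'.
Proof. by move=> [g gb] [g' gb']; apply: (braid_of_perm hausX (etrans gb (esym gb'))). Qed.

Fact conf_perm_comp (s s' : 'S_n) :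
  conf_perm (conf_perm base s') s = conf_perm base (s * s')%g.
Proof. exact: conf_permM. Qed.

(** The second factor starts where the first one ends, so its points are
    renumbered by the permutation of the first. *)
Definition strands_comp (s s' : 'S_n) (g : strands R p s) (g' : strands R p s') :
    strands R p (s * s')%g :=
  concat_path g
    (map_path (@conf_perm_continuous n X s) erefl (conf_perm_comp s s') g').

Lemma braid_of_comp (s s' : 'S_n) (g : strands R p s) (g' : strands R p s') :
  braid_of (strands_comp g g') = (braid_of g * braid_of g')%g.
Proof.
rewrite pi1_classM; congr pi1_class; rewrite /strands_comp.
rewrite (map_path_concat _ _ (to_uconf_perm base s)); congr concat_path.
by apply/path_eqP => t; exact: to_uconf_perm.
Qed.

Lemma braid_permM (b b' : braid R p n) (s s' : 'S_n) :
  braid_perm b s -> braid_perm b' s' -> braid_perm (b * b')%g (s * s')%g.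
Proof. by move=> [g <-] [g' <-]; exists (strands_comp g g'); exact: braid_of_comp. Qed.

Lemma pureP (b : braid R p n) : pure R p n b <-> braid_perm b 1%g.
Proof.
split=> [[a _ <-]|[g <-]].
  elim/pi1_ind: a => l.
  exists (map_path (@continuous_idfun _) erefl (esym (conf_perm1 base)) l).
  by rewrite pi1_mapE; congr pi1_class; exact/path_eqP.
pose l : {path I from base to base} :=
  map_path (@continuous_idfun _) erefl (conf_perm1 base) g.
exists (pi1_class l) => //.
by rewrite pi1_mapE; congr pi1_class; exact/path_eqP.
Qed.

Lemma pureM (b b' : braid R p n) : pure R p n b -> pure R p n b' ->
  pure R p n (b * b')%g.
Proof.
move=> /pureP pb /pureP pb'; apply/pureP.
by have := braid_permM pb pb'; rewrite mulg1.
Qed.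

Lemma braid_perm1 : braid_perm 1%g 1%g.
Proof.
apply/pureP; exists 1%g => //; rewrite pi1_mapE.
by congr pi1_class; exact/path_eqP.
Qed.

Lemma braid_permV (b : braid R p n) (s : 'S_n) :
  braid_perm b s -> braid_perm b^-1%g s^-1%g.
Proof.
move=> pb; have [s' pb'] := braid_strands hausX b^-1%g.
have := braid_permM pb pb'; rewrite mulgV => /(braid_perm_fun braid_perm1) ss'.
by rewrite -[s^-1%g]mulg1 ss' mulKg.
Qed.

Lemma pure_conj (b c : braid R p n) : pure R p n b -> pure R p n (b ^ c)%g.
Proof.
have [s pc] := braid_strands hausX c.
rewrite !pureP /conjg => pb.
have := braid_permM (braid_permV pc) (braid_permM pb pc).
by rewrite mul1g mulVg.
Qed.

End BraidPerm.

(** * Removing strands *)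

Section Removal.
Context (R : realType) (X : topologicalType) (hausX : hausdorff_space X).
Context (th : marked_curve R X) (n : nat).
Local Notation I := (interval01 R).
Local Notation base := (base_conf (marked_points th) n.+1).
Local Notation braid := (braid R (marked_points th)).
Implicit Types (i j k : 'I_n.+1) (s : 'S_n.+1).

(* The index [k] at which the removed strand ends is a variable equal to
   [s i], so that strands with different permutations can be composed without
   casting paths. *)
Fact conf_drop_perm_eq i k s : s i = k ->
  to_uconf (conf_drop i (conf_perm base s)) = to_uconf (conf_drop k base).
Proof. by move=> <-; exact: conf_drop_perm. Qed.

Definition drop_strand i k s (e : s i = k) (g : strands R (marked_points th) s) :
    hom R (to_uconf (conf_drop i base)) (to_uconf (conf_drop k base)) :=
  path_class (map_path (continuous_compT (@conf_drop_continuous n X i)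
                                         (@to_uconf_continuous n X))
    erefl (conf_drop_perm_eq e) g).

Lemma remove_strandE i k s (e : s i = k) (g : strands R (marked_points th) s) :
  remove_strand i g = loop_class (path_class (slide th i) ** drop_strand e g
    ** hom_inv (path_class (slide th k))).
Proof.
case: k / e; rewrite /remove_strand -loop_classE -!hom_compE hom_compA -hom_invE.
congr (loop_class (_ ** _ ** _)); congr path_class; exact/path_eqP.
Qed.

(** The strand of a product that starts at [i] follows the first factor to
    [s i], where it becomes the strand of the second factor to be removed. *)
Lemma drop_strand_comp i j k s s' (e : s i = j) (e' : s' j = k)
    (e'' : (s * s')%g i = k) (g : strands R (marked_points th) s)
    (g' : strands R (marked_points th) s') :
  drop_strand e'' (strands_comp g g') = drop_strand e g ** drop_strand e' g'.
Proof.
rewrite /drop_strand hom_compE; congr path_class.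
pose cd := continuous_compT (@conf_drop_continuous n X i)
                            (@to_uconf_continuous n X).
rewrite /strands_comp (map_path_concat cd _ (conf_drop_perm_eq e)).
congr concat_path; apply/path_eqP => t.
by have := conf_drop_perm i (g' t) s; rewrite e.
Qed.

Lemma removal_braid_of i s (g : strands R (marked_points th) s) :
  removal i (braid_of g) = remove_strand i g.
Proof.
have ex : exists a, (exists s' (g' : strands R (marked_points th) s'),
    braid_of g' = braid_of g /\ remove_strand i g' = a).
  by exists (remove_strand i g), s, g.
have := @xgetPex _ 1%g _ ex; rewrite -/(removal i (braid_of g)).
move=> [s' [g' [gg' <-]]]; have ss' := braid_of_perm hausX gg'.
move: g' gg'; rewrite {}ss' => g' /(braid_of_homotopic hausX) gg'.
apply/pi1_classP; apply: homotopic_concat; first exact: homotopic_refl.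
apply: homotopic_concat; last exact: homotopic_refl.
exact: homotopic_map.
Qed.

(** Removal is a crossed homomorphism: the arc of the curve that ends the first
    factor and the one that begins the second cancel, as both avoid the end
    point [s i] of the removed strand. *)
Lemma removalM i s (b b' : braid n.+1) : braid_perm b s ->
  removal i (b * b')%g = (removal i b * removal (s i) b')%g.
Proof.
move=> [g <-]; have [s' [g' <-]] := braid_strands hausX b'.
rewrite -braid_of_comp !removal_braid_of.
have e'' : (s * s')%g i = s' (s i) by rewrite permM.
rewrite (remove_strandE e'') (remove_strandE (erefl (s i))).
rewrite (remove_strandE (erefl (s' (s i)))) -loop_classM.
by rewrite (drop_strand_comp (erefl (s i)) (erefl (s' (s i)))) !hom_simpl.
Qed.

Lemma removal1 i : removal i (1%g : braid n.+1) = 1%g.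
Proof.
have := removalM i 1%g (@braid_perm1 R X (marked_points th) n.+1).
by rewrite mulg1 perm1 -[LHS]mulg1 => /mulgI.
Qed.

Lemma brunnian_subgroup : is_subgroup (brunnian th n.+1).
Proof.
split=> [i|b c Bb Bc i]; first exact: removal1.
have [s pb] := braid_strands hausX (b * c^-1)%g.
have := removalM i c pb; rewrite mulgKV Bb Bc mulg1; exact: esym.
Qed.

(** By the crossed homomorphism law for [c * b ^ c = b * c], the braid obtained
    from [b ^ c] by removing the strand [s i] is trivial; here [s] is the
    permutation of [c], so that [s i] is an arbitrary index. *)
Lemma brunnian_pure_normal :
  is_normal_subgroup (brunnian th n.+1 `&` pure R (marked_points th) n.+1).
Proof.
have [B1 BV] := brunnian_subgroup; split; first split.
- by split=> //; apply/pureP; exact: braid_perm1.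
- move=> b c [Bb Pb] [Bc Pc]; split; first exact: BV.
  apply: pureM => //; apply/pureP; rewrite -[1%g]invg1.
  by apply: (braid_permV hausX); exact/pureP.
- move=> b c [Bb Pb]; split; last exact: (pure_conj hausX).
  have [s pc] := braid_strands hausX c.
  move=> i; have := removalM (s^-1%g i) (b ^ c)%g pc.
  rewrite permKV -conjgC (removalM _ _ (proj1 (pureP _) Pb)) Bb mul1g perm1.
  by rewrite -[LHS]mulg1 => /mulgI/esym.
Qed.

End Removal.

(** * Continuation of germs *)

Section Sheets.
Context (R : realType) (X : topologicalType) (Y E : Type).
Context (pos : Y -> X) (pr : E -> Y) (good : set X -> Prop).
Context (sheet : set X -> E -> E -> Prop).
Implicit Types (x : X) (U V W Z N : set X) (e : E).
Local Notation at_ e := (pos (pr e)).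

(** Modelled on the classes [e] of paths in a subspace [Y] of [X], up to some
    equivalence: [pos] is the inclusion, [pr e] is the end of [e], and
    [sheet W e e'] says that [e'] is obtained from [e] by following a path in
    [W]. By [sheet_lift] and [sheet_fiber] the covering of [Y] by such classes
    is trivial over each good set, although this set may contain points of [X]
    outside [Y]. *)
Record sheet_system : Prop := SheetSystem {
  good_open : forall W, good W -> open W;
  good_basis : forall x N, nbhs x N -> exists W, [/\ good W, W x & W `<=` N];
  good_inhabited : forall W x, good W -> W x -> exists y, W (pos y);
  sheet_refl : forall W e, W (at_ e) -> sheet W e e;
  sheet_sym : forall W e e', sheet W e e' -> sheet W e' e;
  sheet_trans : forall W e e' e'', sheet W e e' -> sheet W e' e'' -> sheet W e e'';
  sheet_mono : forall W W' e e', W `<=` W' -> sheet W e e' -> sheet W' e e';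
  sheet_lift : forall W e y, good W -> W (at_ e) -> W (pos y) ->
    exists e', pr e' = y /\ sheet W e e';
  sheet_fiber : forall W W' e e', good W -> sheet W e e' -> pr e = pr e' ->
    W' (at_ e) -> sheet W' e e' }.

Context (S : sheet_system).

(** A sheet over a good set, represented by any of its elements. *)
Definition germ : Type := (set X * E)%type.
Implicit Types t : germ.

Definition germ_at x t : Prop := [/\ good t.1, t.1 x & t.1 (at_ t.2)].

(** The two sheets coincide over a neighborhood of [x]. *)
Definition same_germ x t t' : Prop := [/\ germ_at x t, germ_at x t' &
  exists Z e, [/\ good Z, Z x, Z `<=` t.1 `&` t'.1, Z (at_ e) &
    sheet t.1 t.2 e /\ sheet t'.1 t'.2 e]].

Lemma germ_shrink x N t : germ_at x t -> nbhs x N ->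
  exists Z e, [/\ good Z, Z x, Z `<=` t.1 `&` N, Z (at_ e) & sheet t.1 t.2 e].
Proof.
move=> [gV Vx Ve] xN.
have [Z [gZ Zx ZVN]] : exists W, [/\ good W, W x & W `<=` t.1 `&` N].
  apply: (good_basis S); apply: filterI => //; apply: open_nbhs_nbhs.
  by split=> //; exact: (good_open S).
have [y Zy] := good_inhabited S gZ Zx.
have [e [ey te]] := sheet_lift S gV Ve (ZVN _ Zy).1.
by exists Z, e; rewrite ey; split.
Qed.

Lemma same_germ_refl x t : germ_at x t -> same_germ x t t.
Proof.
move=> tx; have [Z [e [gZ Zx ZV Ze te]]] := germ_shrink tx (filterT : nbhs x setT).
by split=> //; exists Z, e; split=> // z /ZV[].
Qed.

Lemma same_germ_sym x t t' : same_germ x t t' -> same_germ x t' t.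
Proof.
move=> [tx tx' [Z [e [gZ Zx ZV Ze [te te']]]]]; split=> //.
by exists Z, e; split=> //; rewrite setIC.
Qed.

(** A sheet over [Z] has elements over any smaller good set, as good sets are
    inhabited off the removed set. *)
Lemma same_germ_shrink x N t t' : same_germ x t t' -> nbhs x N ->
  exists Z e, [/\ good Z, Z x, Z `<=` t.1 `&` t'.1 `&` N, Z (at_ e) &
    sheet t.1 t.2 e /\ sheet t'.1 t'.2 e].
Proof.
move=> [_ _ [Z [e [gZ Zx ZV Ze [te te']]]]] xN.
have gZe : germ_at x (Z, e) by [].
have [Z' [e' [gZ' Zx' ZV' Ze' ee']]] := germ_shrink gZe xN.
exists Z', e'; split=> //; first by move=> z /ZV'[/ZV].
by split; [apply: (sheet_trans S te) | apply: (sheet_trans S te')];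
  apply: (sheet_mono S _ ee') => z /ZV[].
Qed.

Lemma same_germ_trans x t t' t'' :
  same_germ x t t' -> same_germ x t' t'' -> same_germ x t t''.
Proof.
move=> [tx tx' [Z [e [gZ Zx ZV Ze [te te']]]]] tt''.
have [_ tx'' _] := tt''.
have nZ : nbhs x Z by apply: open_nbhs_nbhs; split=> //; exact: (good_open S).
have [Z1 [e1 [gZ1 Z1x Z1V Z1e [te1' te1'']]]] := same_germ_shrink tt'' nZ.
have [e2 [e2E ee2]] := sheet_lift S gZ Ze (Z1V _ Z1e).2.
split=> //; exists Z1, e2; split=> //.
- move=> z /Z1V[[_ Vz''] Zz]; split=> //.
  exact: (ZV _ Zz).1.
- by rewrite e2E.
- split.
    apply: (sheet_trans S te); apply: (sheet_mono S _ ee2) => z /ZV[] //.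
  apply: (sheet_trans S te1''); apply: (sheet_fiber S (W := t'.1)) => //.
  + by case: tx'.
  + apply: (sheet_trans S (sheet_sym S te1')); apply: (sheet_trans S te').
    by apply: (sheet_mono S _ ee2) => z /ZV[].
  + by case: (Z1V _ Z1e) => -[].
Qed.

Lemma same_germ_fiber t t' W : same_germ (at_ t.2) t t' -> pr t.2 = pr t'.2 ->
  W (at_ t.2) -> sheet W t.2 t'.2.
Proof.
move=> [[gV Vx _] [gV' Vx' _] [Z [e [gZ Zx ZV Ze [te te']]]]] tt' Wt.
have [e1 [e1E ee1]] := sheet_lift S gZ Ze Zx.
have ee1V : sheet t.1 e e1 by apply: (sheet_mono S _ ee1) => z /ZV[].
have ee1V' : sheet t'.1 e e1 by apply: (sheet_mono S _ ee1) => z /ZV[].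
apply: (sheet_trans S (e' := e1)).
  by apply: (sheet_fiber S gV (sheet_trans S te ee1V)).
apply: (sheet_sym S); apply: (sheet_fiber S gV' (sheet_trans S te' ee1V')).
  by rewrite e1E.
by rewrite -tt'.
Qed.

Lemma near_germ_at x t : germ_at x t -> \forall x' \near x, germ_at x' t.
Proof.
move=> [gV Vx Ve]; have : nbhs x t.1.
  by apply: open_nbhs_nbhs; split=> //; exact: (good_open S).
by apply: filterS.
Qed.

(** Around [x], both being the same germ and not being it are open conditions:
    over a good neighborhood on which both sheets are defined they either
    coincide or have no germ in common. *)
Lemma near_same_germ x t t' : germ_at x t -> germ_at x t' ->
  \forall x' \near x, same_germ x t t' <-> same_germ x' t t'.
Proof.
move=> tx tx'; have nt := near_germ_at tx; have nt' := near_germ_at tx'.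
have [tt'|ntt'] := pselect (same_germ x t t').
  have [_ _ [Z [e [gZ Zx ZV Ze te]]]] := tt'.
  have nZ : nbhs x Z by apply: open_nbhs_nbhs; split=> //; exact: (good_open S).
  near=> x'; split=> // _; split; [by near: x' | by near: x' |].
  by exists Z, e; split=> //; near: x'.
have nV' : nbhs x t'.1.
  by case: tx' => gV Vx _; apply: open_nbhs_nbhs; split=> //; exact: (good_open S).
have [Z [e [gZ Zx ZV Ze te]]] := germ_shrink tx nV'.
have nZ : nbhs x Z by apply: open_nbhs_nbhs; split=> //; exact: (good_open S).
near=> x'; split=> // tt'; exfalso; apply: ntt'.
have nZ' : nbhs x' Z.
  apply: open_nbhs_nbhs; split; first exact: (good_open S).
  by near: x'.
have [Z1 [e1 [gZ1 Z1x Z1V Z1e te1]]] := same_germ_shrink tt' nZ'.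
split=> //; exists Z, e1; split=> //.
exact: (Z1V _ Z1e).2.
Unshelve. all: by end_near. Qed.

Section Families.
Context (Q : topologicalType) (h : Q -> X) (ch : continuous h).

Definition continuation (A : set Q) (T : Q -> germ) : Prop := forall q, A q ->
  germ_at (h q) (T q) /\ \forall q' \near q, A q' -> same_germ (h q') (T q) (T q').

Lemma near_same_germ_along q t t' : germ_at (h q) t -> germ_at (h q) t' ->
  \forall q' \near q, same_germ (h q) t t' <-> same_germ (h q') t t'.
Proof. by move=> tx tx'; exact: (ch (near_same_germ tx tx')). Qed.

Lemma continuation_subset (A B : set Q) T :
  B `<=` A -> continuation A T -> continuation B T.
Proof.
move=> BA cT q Bq; have [Tq nT] := cT q (BA _ Bq); split=> //.
by apply: filterS nT => q' H /BA.
Qed.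

Lemma continuation_cst (A : set Q) t :
  (forall q, A q -> germ_at (h q) t) -> continuation A (fun=> t).
Proof.
move=> At q Aq; split; first exact: At.
by apply: filterE => q' Aq'; apply: same_germ_refl; exact: At.
Qed.

Lemma continuation_unique (A : set Q) T T' q0 q : connected A ->
  continuation A T -> continuation A T' ->
  A q0 -> same_germ (h q0) (T q0) (T' q0) -> A q -> same_germ (h q) (T q) (T' q).
Proof.
move=> cA cT cT'.
apply: (connected_ind (G := fun q => same_germ (h q) (T q) (T' q)) cA) => {}q Aq.
have [Tq nT] := cT q Aq; have [Tq' nT'] := cT' q Aq.
have nTT' := near_same_germ_along Tq Tq'.
near=> q' => Aq'.
have H : same_germ (h q') (T q) (T q') by move: Aq'; near: q'.
have H' : same_germ (h q') (T' q) (T' q') by move: Aq'; near: q'.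
have -> : same_germ (h q) (T q) (T' q) <-> same_germ (h q') (T q) (T' q).
  by near: q'.
split=> K.
  exact: same_germ_trans (same_germ_sym H) (same_germ_trans K H').
exact: same_germ_trans H (same_germ_trans K (same_germ_sym H')).
Unshelve. all: by end_near. Qed.

(** At a point of both closed sets, the two continuations have the same germ,
    hence also at nearby points. *)
Lemma continuation_glue (A B : set Q) T T' : closed A -> closed B ->
  continuation A T -> continuation B T' ->
  (forall q, A q -> B q -> same_germ (h q) (T q) (T' q)) ->
  continuation (A `|` B) (fun q => if `[< A q >] then T q else T' q).
Proof.
move=> clA clB cT cT' TT' q ABq.
have out (D : set Q) : closed D -> ~ D q -> \forall q' \near q, ~ D q'.
  by move=> /closed_openC oD Dq; apply: open_nbhs_nbhs.
have [Aq|nAq] := asboolP (A q).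
  have [Tq nT] := cT q Aq; split=> //.
  have [Bq|nBq] := pselect (B q).
    have [Tq' nT'] := cT' q Bq; have TTq := TT' q Aq Bq.
    have nTT' := near_same_germ_along Tq Tq'.
    near=> q' => ABq'; case: asboolP => [Aq'|nAq'].
      by move: Aq'; near: q'.
    have H : same_germ (h q') (T q) (T' q).
      apply/(_ : same_germ (h q) (T q) (T' q) <-> _) => //; by near: q'.
    apply: same_germ_trans H _.
    by case: ABq' => // Bq'; move: Bq'; near: q'.
  have nB := out B clB nBq.
  near=> q' => ABq'; case: asboolP => [Aq'|nAq'].
    by move: Aq'; near: q'.
  by case: ABq' => // Bq'; exfalso; move: Bq'; near: q'.
have Bq : B q by case: ABq.
have [Tq' nT'] := cT' q Bq; split=> //; have nA := out A clA nAq.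
near=> q' => ABq'; case: asboolP => [Aq'|nAq'].
  by exfalso; move: Aq'; near: q'.
by case: ABq' => // Bq'; move: Bq'; near: q'.
Unshelve. all: by end_near. Qed.

End Families.

Lemma continuation_comp (Q Q' : topologicalType) (h : Q -> X) (u : Q' -> Q)
    (A : set Q) (B : set Q') T : continuous u -> (forall q, B q -> A (u q)) ->
  continuation h A T -> continuation (h \o u) B (T \o u).
Proof.
move=> cu BA cT q Bq; have [Tq nT] := cT (u q) (BA _ Bq); split=> //.
have : \forall q' \near q, A (u q') -> same_germ (h (u q')) (T (u q)) (T (u q')).
  exact: cu nT.
by apply: filterS => q' H /BA.
Qed.

Definition rectangle (a b c d : R) : set (R * R) :=
  [set q | a <= q.1 <= b /\ c <= q.2 <= d].

Lemma closed_rectangle (a b c d : R) : closed (rectangle a b c d).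
Proof.
have -> : rectangle a b c d = (fst @^-1` `[a, b]) `&` (snd @^-1` `[c, d]).
  by apply/seteqP; split=> q /=; rewrite !in_itv.
have /continuous_closedP c1 := @continuous_fst R R.
have /continuous_closedP c2 := @continuous_snd R R.
by apply: closedI; [apply: c1 | apply: c2]; exact: interval_closed.
Qed.

Lemma connected_path (T : topologicalType) (u : R -> T) (a b : R) :
  continuous u -> connected (u @` `[a, b]).
Proof.
move=> cu; apply: connected_continuous_connected; first exact: segment_connected.
exact: continuous_subspaceT.
Qed.

(** Over a good set a single sheet is a continuation, and two adjacent
    rectangles meet in a segment, along which continuations are unique. *)
Lemma continuation_rectangle (h : R * R -> X) : continuous h ->
  forall a b c d, a <= b -> c <= d -> forall t, germ_at (h (a, c)) t ->
  exists T, continuation h (rectangle a b c d) T /\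
    same_germ (h (a, c)) t (T (a, c)).
Proof.
move=> ch; apply: (rectangle_gluing (P := fun a b c d => forall t,
  germ_at (h (a, c)) t -> exists T, continuation h (rectangle a b c d) T /\
    same_germ (h (a, c)) t (T (a, c)))).
- move=> x y; have [W [gW Wx _]] := good_basis S (filterT : nbhs (h (x, y)) setT).
  have : nbhs (x, y) (h @^-1` W).
    by apply: ch; apply: open_nbhs_nbhs; split=> //; exact: (good_open S).
  move=> /nbhs_ballP[r r0 Hr]; exists r => // a b c d xa ab bx yc cd dy t tx.
  have Wrect q : rectangle a b c d q -> W (h q).
    case: q => u v [/= uab vcd]; apply: (Hr (u, v)).
    by split; rewrite /ball /= ltr_distlC; lra.
  have Wac : W (h (a, c)) by apply: Wrect; split; rewrite /= lexx.
  have nW : nbhs (h (a, c)) W.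
    by apply: open_nbhs_nbhs; split=> //; exact: (good_open S).
  have [Z [e [gZ Zx ZVW Ze te]]] := germ_shrink tx nW.
  have We : W (at_ e) := (ZVW _ Ze).2.
  exists (fun=> (W, e)); split.
    by apply: continuation_cst => q /Wrect.
  split=> //; exists Z, e; split=> //; split=> //; exact: (sheet_refl S).
- move=> a b e c d ab be cd P1 P2 t tx.
  have [T1 [cT1 T10]] := P1 t tx.
  have [|T2 [cT2 T20]] := P2 (T1 (b, c)).
    by apply: (cT1 _ _).1; split; rewrite /= ?lexx ?ab.
  pose A := rectangle a b c d; pose B := rectangle b e c d.
  have AB : A `&` B = (fun y => (b, y)) @` `[c, d].
    apply/seteqP; split=> [[x y] [[/= ax yc] [/= xb _]]|_ [y /= ycd <-]].
      by exists y; rewrite /= ?in_itv //; congr pair; lra.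
    by rewrite in_itv /= in ycd; split; split=> //=; rewrite lexx ?ab ?be.
  exists (fun q => if `[< A q >] then T1 q else T2 q); split.
    apply: (continuation_subset (A := A `|` B)).
      by move=> [x y] [/= /andP[ax xe] ycd]; have [xb|xb] := leP x b;
        [left | right]; split=> //=; rewrite ?ax ?xb ?xe ?(ltW xb).
    apply: continuation_glue => //; [exact: closed_rectangle|exact: closed_rectangle|].
    move=> q Aq Bq; apply: (@continuation_unique _ h ch (A `&` B) T1 T2 (b, c)) => //.
    + rewrite AB; apply: connected_path; continuity.
    + by apply: continuation_subset cT1 => z [].
    + by apply: continuation_subset cT2 => z [].
    + by rewrite AB; exists c => //=; rewrite in_itv /= lexx.
  have -> : `[< A (a, c) >] by apply/asboolP; split; rewrite /= lexx.
  exact: T10.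
- move=> a b c d e ab cd de P1 P2 t tx.
  have [T1 [cT1 T10]] := P1 t tx.
  have [|T2 [cT2 T20]] := P2 (T1 (a, d)).
    by apply: (cT1 _ _).1; split; rewrite /= ?lexx ?cd ?ab.
  pose A := rectangle a b c d; pose B := rectangle a b d e.
  have AB : A `&` B = (fun y => (y, d)) @` `[a, b].
    apply/seteqP; split=> [[x y] [[/= ax yc] [/= _ xb]]|_ [y /= ycd <-]].
      by exists x; rewrite /= ?in_itv //; congr pair; lra.
    by rewrite in_itv /= in ycd; split; split=> //=; rewrite lexx ?cd ?de.
  exists (fun q => if `[< A q >] then T1 q else T2 q); split.
    apply: (continuation_subset (A := A `|` B)).
      by move=> [x y] [/= xab /andP[cy ye]]; have [xb|xb] := leP y d;
        [left | right]; split=> //=; rewrite ?cy ?xb ?ye ?(ltW xb).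
    apply: continuation_glue => //; [exact: closed_rectangle|exact: closed_rectangle|].
    move=> q Aq Bq; apply: (@continuation_unique _ h ch (A `&` B) T1 T2 (a, d)) => //.
    + rewrite AB; apply: connected_path; continuity.
    + by apply: continuation_subset cT1 => z [].
    + by apply: continuation_subset cT2 => z [].
    + by rewrite AB; exists a => //=; rewrite in_itv /= lexx.
  have -> : `[< A (a, c) >] by apply/asboolP; split; rewrite /= lexx.
  exact: T10.
Qed.

Lemma continuation_path_unique (h : R -> X) T T' r0 r1 : continuous h ->
  continuation h `[0, 1] T -> continuation h `[0, 1] T' ->
  `[0, 1]%classic r0 -> `[0, 1]%classic r1 ->
  same_germ (h r0) (T r0) (T' r0) -> same_germ (h r1) (T r1) (T' r1).
Proof.
move=> ch cT cT' r0_01 r1_01 H.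
apply: (continuation_unique ch (@segment_connected R 0 1) cT cT') r0_01 H r1_01.
Qed.

(** The germ [t0] continues over the square. Along the three sides mapped to
    [x0] the continuation is constant, and along the fourth side it agrees with
    [T'] by uniqueness. *)
Lemma monodromy_null (x0 : X) (h : R * R -> X) t0 (T' : R -> germ) :
  continuous h ->
  (forall s, 0 <= s <= 1 -> h (s, 0) = x0) ->
  (forall s, 0 <= s <= 1 -> h (s, 1) = x0) ->
  (forall s, 0 <= s <= 1 -> h (1, s) = x0) ->
  continuation (fun s => h (0, s)) `[0, 1] T' ->
  same_germ x0 t0 (T' 0) -> same_germ x0 t0 (T' 1).
Proof.
move=> ch h0 h1 hr cT' t0T'.
have I0 : 0 <= (0 : R) <= 1 by rewrite lexx ler01.
have I1 : 0 <= (1 : R) <= 1 by rewrite lexx ler01.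
have J0 : `[0, 1]%classic (0 : R) by rewrite /= in_itv.
have J1 : `[0, 1]%classic (1 : R) by rewrite /= in_itv.
have [t0x _ _] := t0T'.
have [|T [cT T0]] := continuation_rectangle ch ler01 ler01 (t := t0).
  by rewrite h0.
rewrite h0 // in T0.
have edge (u : R -> R * R) : continuous u ->
    (forall s, 0 <= s <= 1 -> rectangle 0 1 0 1 (u s)) ->
    continuation (h \o u) `[0, 1] (T \o u).
  move=> cu u01; apply: (continuation_comp cu) cT => s /=.
  by rewrite in_itv /=; exact: u01.
have cst_edge (u : R -> R * R) r0 r1 : continuous u ->
    (forall s, 0 <= s <= 1 -> rectangle 0 1 0 1 (u s)) ->
    (forall s, 0 <= s <= 1 -> h (u s) = x0) -> 0 <= r0 <= 1 -> 0 <= r1 <= 1 ->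
    same_germ x0 (T (u r0)) t0 -> same_germ x0 (T (u r1)) t0.
  move=> cu u01 hu r0_01 r1_01 H; rewrite -(hu r1) //.
  apply: (@continuation_path_unique (h \o u) (T \o u) (fun=> t0) r0 r1).
  + exact: (continuous_compT cu ch).
  + exact: edge.
  + apply: continuation_cst => s /=; rewrite in_itv /= => s01.
    by rewrite hu.
  + by rewrite /= in_itv.
  + by rewrite /= in_itv.
  + by rewrite /= hu.
have left : same_germ x0 (T (0, 1)) (T' 1).
  rewrite -(h1 0) //; apply: (@continuation_path_unique (fun s => h (0, s))
    (T \o (fun s => (0, s))) T' 0 1) => //.
  - by apply: (continuous_compT _ ch); continuity.
  - by apply: edge; [continuity | move=> s s01; split].
  - by rewrite h0 //=; apply: same_germ_trans t0T'; exact: same_germ_sym.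
apply: same_germ_trans left; apply: same_germ_sym.
apply: (cst_edge (fun s => (s, 1)) 1 0) => //; first by continuity.
apply: (cst_edge (fun s => (1, s)) 0 1) => //; first by continuity.
apply: (cst_edge (fun s => (s, 0)) 0 1) => //; first by continuity.
exact: same_germ_sym.
Qed.

End Sheets.

(** * Loops that become trivial once the two points may collide *)

Section Subpaths.
Context (R : realType) (X : topologicalType) (x y : X).
Context (p : {path interval01 R from x to y}).
Local Notation f := (extend_path p).

Let cf : continuous f := @extend_path_continuous _ _ _ _ p.

Fact path_prefix_continuous (s : R) : continuous (fun u : R => f (u * s)).
Proof. by apply: (continuous_compT _ cf); continuity. Qed.
Fact path_prefix0 (s : R) : f (0 * s) = x.
Proof. by rewrite mul0r extend_path_le0. Qed.
Fact path_prefix1 (s : R) : f (1 * s) = f s.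
Proof. by rewrite mul1r. Qed.
Definition path_prefix (s : R) :=
  path_of_fun (@path_prefix_continuous s) (path_prefix0 s) (path_prefix1 s).

Fact subpath_continuous (s r : R) : continuous (fun u : R => f ((1 - u) * s + u * r)).
Proof. by apply: (continuous_compT _ cf); continuity. Qed.
Fact subpath0 (s r : R) : f ((1 - 0) * s + 0 * r) = f s.
Proof. by rewrite subr0 mul1r mul0r addr0. Qed.
Fact subpath1 (s r : R) : f ((1 - 1) * s + 1 * r) = f r.
Proof. by rewrite subrr mul1r mul0r add0r. Qed.
Definition subpath (s r : R) :=
  path_of_fun (@subpath_continuous s r) (subpath0 s r) (subpath1 s r).

Lemma path_prefix_subpath (s r : R) :
  path_class (path_prefix s) ** path_class (subpath s r) = path_class (path_prefix r).
Proof.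
rewrite hom_compE; apply/path_classP.
apply: (@homotopic_reparam _ _ _ _ _ _ p
  (fun t => if t <= 2^-1 then 2 * t * s else (2 - 2 * t) * s + (2 * t - 1) * r)
  (fun t => t * r)).
- by apply: glue_continuous; try continuity; move=> t ->; lra.
- by continuity.
- by rewrite invr_ge0 ler0n !mulr0 !mul0r.
- by rewrite ifF; [ring | apply/negbTE; rewrite -ltNge; lra].
- move=> t t01; rewrite extend_pathE // /concat_fun.
  have [t2|t2] := leP t 2^-1.
    by rewrite extend_of_fun //; lra.
  by rewrite extend_of_fun; [congr f; ring | lra].
- by move=> t t01; rewrite extend_of_fun.
Qed.

End Subpaths.

Section Collisions.
Context (R : realType) (M : topologicalType) (c0 : conf 2 M).
Context (N : set (pi1 R c0)) (subN : is_subgroup N).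
Local Notation I := (interval01 R).
Implicit Types (c : conf 2 M) (W : set (M * M)).

Definition positions c : M * M := (points c ord0, points c ord_max).

Lemma positions_continuous : continuous positions.
Proof. by apply: continuous_pair; exact: points_continuous. Qed.

(** The path classes that play the part of the universal covering. *)
Definition pointed_conf : Type := {c : conf 2 M & hom R c0 c}.
Implicit Types e : pointed_conf.

(** The tail [d] ranges over all paths from the base configuration, as there is
    no preferred path from there to [W]. *)
Definition loops_in W : Prop := forall c (l : {path I from c to c}) (d : hom R c0 c),
  (forall t, W (positions (l t))) -> N (loop_class (d ** path_class l ** hom_inv d)).

(** What a neighborhood in [M * M] must satisfy for the classes modulo [N] to form
    a trivial covering of its part off the diagonal. *)
Record good_set W : Prop := GoodSet {
  good_set_open : open W;
  good_set_inhabited : forall x, W x -> exists c, W (positions c);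
  good_set_connected : forall c c', W (positions c) -> W (positions c') ->
    exists l : {path I from c to c'}, forall t, W (positions (l t));
  good_set_loops : loops_in W }.

Definition conf_sheet W e e' : Prop :=
  exists l : {path I from projT1 e to projT1 e'}, (forall t, W (positions (l t))) /\
    N (loop_class (projT2 e ** path_class l ** hom_inv (projT2 e'))).

Lemma concat_path_in (X : topologicalType) (A : set X) (x y z : X)
    (p : {path I from x to y}) (q : {path I from y to z}) :
  (forall t, A (p t)) -> (forall t, A (q t)) -> forall t, A (concat_path p q t).
Proof.
move=> Ap Aq t; rewrite -(extend_path_val (concat_path p q)) extend_concat ?ival_itv //.
by rewrite /concat_fun; case: ifP => _; [exact: Ap | exact: Aq].
Qed.

Lemma reverse_path_in (X : topologicalType) (A : set X) (x y : X)
    (p : {path I from x to y}) :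
  (forall t, A (p t)) -> forall t, A (reverse_path p t).
Proof.
move=> Ap t; rewrite -(extend_path_val (reverse_path p)) extend_reverse ?ival_itv //.
exact: Ap.
Qed.

Context (basis : forall x O, nbhs x O -> exists W, [/\ good_set W, W x & W `<=` O]).

Lemma conf_sheet_system :
  @sheet_system (M * M)%type (conf 2 M) pointed_conf positions
    (fun e => projT1 e) good_set conf_sheet.
Proof.
have trans W e e' e'' : conf_sheet W e e' -> conf_sheet W e' e'' -> conf_sheet W e e''.
  case: e e' e'' => [c d] [c' d'] [c'' d''] [/= l [Wl Nl]] [/= m [Wm Nm]].
  exists (concat_path l m); split.
    exact: (concat_path_in (A := fun c => W (positions c))).
  by have := subgroupM subN Nl Nm; rewrite -loop_classM -hom_compE !hom_simpl.
have sym W e e' : conf_sheet W e e' -> conf_sheet W e' e.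
  case: e e' => [c d] [c' d'] [/= l [Wl Nl]].
  exists (reverse_path l); split.
    exact: (reverse_path_in (A := fun c => W (positions c))).
  by have := subgroupV subN Nl; rewrite -loop_classV -hom_invE !hom_simpl.
have fiber W W' e e' : good_set W -> conf_sheet W e e' -> projT1 e = projT1 e' ->
    W' (positions (projT1 e)) -> conf_sheet W' e e'.
  case: e e' => [c d] [c' d'] gW [/= l [Wl Nl]] cc'; case: c' / cc' d' l Wl Nl.
  move=> d' l Wl Nl W'c; exists (const_path R c); split=> [t /=|] //.
  have := subgroupM subN (subgroupV subN (good_set_loops gW d Wl)) Nl.
  rewrite -/(hom_id R c) hom_compp1 -loop_classV -loop_classM.
  by rewrite !hom_simpl.
split=> //.
- exact: good_set_open.
- by move=> W x gW Wx; exact: good_set_inhabited gW x Wx.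
- move=> W [c d] /= Wc; exists (const_path R c); split=> [t|] //=.
  by rewrite -/(hom_id R c) !hom_simpl loop_class1; exact: (subgroup1 subN).
- move=> W W' e e' WW' [l [Wl Nl]]; exists l; split=> // t; exact: WW'.
- move=> W [c d] c' gW /= Wc Wc'.
  have [l Wl] := good_set_connected gW Wc Wc'.
  exists (existT _ c' (d ** path_class l)); split=> //.
  exists l; split=> //=; rewrite hom_comppV loop_class1; exact: (subgroup1 subN).
Qed.

(** A null-homotopy of [g] in [M * M] is a square of which three sides are
    constant. Along the side [g] the classes of the initial parts of [g] are a
    continuation, from the trivial class to the class of [g]. *)
Lemma collision_null (g : {path I from c0 to c0}) :
  homotopic (map_path positions_continuous erefl erefl g)
            (const_path R (positions c0)) ->
  N (pi1_class g).
Proof.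
have S := conf_sheet_system.
move=> /homotopicE[K [cK K0 K1 Kxy]].
have I0 : 0 <= (0 : R) <= 1 by rewrite lexx ler01.
have I1 : 0 <= (1 : R) <= 1 by rewrite lexx ler01.
have /choice[Wf HW] : forall s : R, exists W, good_set W /\ W (positions (extend_path g s)).
  move=> s; have [W [gW Wx _]] :=
    basis (filterT : nbhs (positions (extend_path g s)) setT).
  by exists W.
pose T s : germ (M * M)%type pointed_conf :=
  (Wf s, existT (hom R c0) (extend_path g s) (path_class (path_prefix g s))).
pose e0 : pointed_conf := existT (hom R c0) c0 (hom_id R c0).
pose e1 : pointed_conf := existT (hom R c0) c0 (path_class g).
have g0 : extend_path g 0 = c0 by rewrite extend_path_le0.
have g1 : extend_path g 1 = c0 by rewrite extend_path_ge1.
(* the class of an initial part of [g], with its end point replaced by an equal one *)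
have recast s c (e : extend_path g s = c) (a : hom R c0 c) W :
    W (positions c) ->
    a = hom_map (@continuous_idfun (conf 2 M)) erefl e (path_class (path_prefix g s)) ->
    conf_sheet W (T s).2 (existT (hom R c0) c a).
  move=> Wc ->; case: c / e Wc {a} => Wc; exists (const_path R _); split=> [t|] //=.
  rewrite -/(hom_id R _) hom_compp1.
  have -> : hom_map (@continuous_idfun _) erefl erefl (path_class (path_prefix g s)) =
      path_class (path_prefix g s) by rewrite hom_mapE; congr path_class; exact/path_eqP.
  by rewrite hom_comppV loop_class1; exact: (subgroup1 subN).
have cpg : continuous (fun s => positions (extend_path g s)).
  apply: (continuous_compT _ positions_continuous); exact: extend_path_continuous.
have h0E s : K (0, s) = positions (extend_path g s) by rewrite K0.
have cT : continuation positions (fun e => projT1 e) good_set conf_sheet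
    (fun s => K (0, s)) `[0, 1] T.
  move=> s _; have [gW Ws] := HW s.
  split; first by split=> //=; rewrite h0E.
  have : nbhs s ((fun s => positions (extend_path g s)) @^-1` Wf s).
    by apply: cpg; apply: open_nbhs_nbhs; split=> //; exact: good_set_open.
  move=> /nbhs_ballP[r r0 Hr]; apply/nbhs_ballP; exists r => // s' ss' _.
  have [gW' Ws'] := HW s'; rewrite h0E.
  have Wss' : Wf s (positions (extend_path g s')) by exact: Hr.
  split; [by split|by split|].
  have [Z [gZ Zx ZW]] := basis (filterI (F := nbhs (positions (extend_path g s')))
    (open_nbhs_nbhs (conj (good_set_open gW) Wss'))
    (open_nbhs_nbhs (conj (good_set_open gW') Ws'))).
  exists Z, (T s').2; split=> //; split; last exact: (sheet_refl S).
  exists (subpath g s s'); split.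
    move=> t; rewrite -(extend_path_val (subpath g s s')) extend_of_fun ?ival_itv //.
    apply: Hr; move: ss'; rewrite /ball /= !ltr_distlC.
    have := ival_itv t; move: (ival t) => u u01 ss'.
    have : 0 <= u by lra.
    have : 0 <= 1 - u by lra.
    by move=> ? ?; apply/andP; split; nra.
  by rewrite /T /= path_prefix_subpath hom_comppV loop_class1; exact: (subgroup1 subN).
have [gW0 Ws0] := HW 0; have [gW1 Ws1] := HW 1.
rewrite g0 in Ws0; rewrite g1 in Ws1.
have E0 : same_germ positions (fun e => projT1 e) good_set conf_sheet
    (positions c0) (Wf 0, e0) (T 0).
  split; [by split|by split=> //=; rewrite g0|].
  exists (Wf 0), e0; split=> //; split; first exact: (sheet_refl S).
  apply: (recast _ _ g0) => //; rewrite hom_mapE; congr path_class.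
  apply/path_eqP => t; rewrite [LHS]/= [RHS]/= /mk_path /=.
  by rewrite mulr0.
have E1 : same_germ positions (fun e => projT1 e) good_set conf_sheet
    (positions c0) (T 1) (Wf 1, e1).
  split; [by split=> //=; rewrite g1|by split|].
  exists (Wf 1), e1; split=> //; split; last exact: (sheet_refl S).
  apply: (recast _ _ g1) => //; rewrite hom_mapE; congr path_class.
  apply/path_eqP => t; rewrite [RHS]/= /mk_path /=.
  by rewrite mulr1 extend_path_val.
have := monodromy_null S cK _ _ _ cT E0.
move=> /(_ (fun s _ => (Kxy s 0).1 (lexx 0))) /(_ (fun s _ => (Kxy s 1).2 (lexx 1))).
move=> /(_ (fun s _ => K1 s)) E01.
have E := same_germ_trans S E01 E1.
have [l [Wl Nl]] := same_germ_fiber S E (W := Wf 1) erefl Ws1.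
have := good_set_loops gW1 (hom_id R c0) Wl.
move=> /(subgroupV subN) Nl'; have := subgroupV subN (subgroupM subN Nl' Nl).
rewrite -loop_classV -loop_classM -loop_classV /= -loop_classE.
by rewrite !hom_simpl.
Qed.

End Collisions.

(** * Convex charts *)

Lemma within_comp (S T V : topologicalType) (A : set T) (f : S -> T) (g : T -> V) :
  continuous f -> (forall s, A (f s)) -> {within A, continuous g} ->
  continuous (fun s => g (f s)).
Proof.
move=> cf Af /subspace_sigL_continuousP cg.
pose u s : set_type A := to_set_type (Af s).
have cu : continuous u by exact: continuous_comp_initial.
exact: (continuous_compT cu cg).
Qed.

Lemma ord2_ind (P : 'I_2 -> Prop) : P ord0 -> P ord_max -> forall j, P j.
Proof.
move=> P0 P1 j; have [->//|->//] : j = ord0 \/ j = ord_max.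
by case: j => -[|[|//]] ?; [left | right]; exact: val_inj.
Qed.

Section Segment.
Context (R : realType).
Implicit Types a b w z : R * R.

Definition segment (t : R) a b : R * R :=
  ((1 - t) * a.1 + t * b.1, (1 - t) * a.2 + t * b.2).

Lemma segment_continuous (T : topologicalType) (t : T -> R) (f g : T -> R * R) :
  continuous t -> continuous f -> continuous g ->
  continuous (fun x => segment (t x) (f x) (g x)).
Proof.
move=> ct cf cg.
have c1 := continuous_compT cf (@continuous_fst R R).
have c2 := continuous_compT cf (@continuous_snd R R).
have c3 := continuous_compT cg (@continuous_fst R R).
have c4 := continuous_compT cg (@continuous_snd R R).
by rewrite /segment; continuity.
Qed.

Lemma segment0 a b : segment 0 a b = a.
Proof. by case: a b => [a1 a2] [b1 b2]; rewrite /segment /=; congr pair; ring. Qed.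

Lemma segment1 a b : segment 1 a b = b.
Proof. by case: a b => [a1 a2] [b1 b2]; rewrite /segment /=; congr pair; ring. Qed.

Lemma segmentxx t a : segment t a a = a.
Proof. by case: a => [a1 a2]; rewrite /segment /=; congr pair; ring. Qed.

Definition det w z : R := w.1 * z.2 - w.2 * z.1.

End Segment.

Section Cells.
Context (R : realType) (M : topologicalType).
Local Notation I := (interval01 R).

(** A chart [phi] with inverse [psi] from an open set [U] onto a bounded convex
    set [K] of the plane that lies on no line: it contains chords transverse to
    any given vector [w]. *)
Record cell (U : set M) (K : set (R * R)) (phi : M -> R * R) (psi : R * R -> M)
    : Prop := Cell {
  cell_open : open U;
  cell_phi_continuous : {within U, continuous phi};
  cell_psi_continuous : {within K, continuous psi};
  cell_phi : forall x, U x -> K (phi x);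
  cell_psi : forall z, K z -> U (psi z);
  cell_phiK : forall x, U x -> psi (phi x) = x;
  cell_psiK : forall z, K z -> phi (psi z) = z;
  cell_convex : forall a b t, K a -> K b -> 0 <= t <= 1 -> K (segment t a b);
  cell_spread : forall w, w <> (0, 0) -> exists a b,
    [/\ K a, K b & det w (a - b) != 0];
  cell_bounded : exists r : R, forall z, K z -> `|z.1| <= r /\ `|z.2| <= r }.

Section OneCell.
Context (U : set M) (K : set (R * R)) (phi : M -> R * R) (psi : R * R -> M).
Context (cU : cell U K phi psi).

Lemma cell_psi_inj a b : K a -> K b -> psi a = psi b -> a = b.
Proof. by move=> Ka Kb ab; rewrite -(cell_psiK cU Ka) ab (cell_psiK cU Kb). Qed.

Lemma cell_conf (n : nat) (T : topologicalType) (z : T -> 'I_n -> R * R) :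
  (forall j, continuous (z ^~ j)) -> (forall t j, K (z t j)) ->
  (forall t, injective (z t)) ->
  exists f : T -> conf n M, continuous f /\
    forall t j, points (f t) j = psi (z t j).
Proof.
move=> cz Kz injz.
have inj t : injective (fun j => psi (z t j)).
  by move=> j k /(cell_psi_inj (Kz t j) (Kz t k))/injz.
exists (fun t => mk_conf (inj t)); split=> //.
apply: conf_continuous => j.
exact: (within_comp (cz j) (Kz ^~ j) (cell_psi_continuous cU)).
Qed.

Lemma cell_phi_comp (T : topologicalType) (f : T -> M) :
  continuous f -> (forall t, U (f t)) -> continuous (fun t => phi (f t)).
Proof. by move=> cf Uf; apply: within_comp cf Uf (cell_phi_continuous cU). Qed.

(** Move both points along segments. The vector between them moves along the
    segment between two linearly independent vectors, which avoids zero. *)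
Lemma cell_path_transverse (c c' : conf 2 M) :
  (forall j, U (points c j)) -> (forall j, U (points c' j)) ->
  det (phi (points c ord0) - phi (points c ord_max))
      (phi (points c' ord0) - phi (points c' ord_max)) != 0 ->
  exists l : {path I from c to c'}, forall t j, U (points (l t) j).
Proof.
move=> Uc Uc' det0.
pose z (t : I) (j : 'I_2) := segment (ival t) (phi (points c j)) (phi (points c' j)).
have injz t : injective (z t).
  have ne : z t ord0 <> z t ord_max.
    rewrite /z /segment => -[]; move: det0; rewrite /det /=.
    case: (phi (points c ord0)) (phi (points c ord_max)) => [a1 a2] [b1 b2].
    case: (phi (points c' ord0)) (phi (points c' ord_max)) => [a1' a2'] [b1' b2'] /=.
    move: (ival t) => u det0 e1 e2.
    have f1 : (1 - u) * (a1 - b1) = - (u * (a1' - b1')) by lra.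
    have f2 : (1 - u) * (a2 - b2) = - (u * (a2' - b2')) by lra.
    set d := _ - _ in det0.
    have d1 : (1 - u) * d = 0.
      have -> : (1 - u) * d = ((1 - u) * (a1 - b1)) * (a2' - b2') -
        ((1 - u) * (a2 - b2)) * (a1' - b1') by rewrite /d; ring.
      by rewrite f1 f2; ring.
    have d2 : u * d = 0.
      have -> : u * d = (a1 - b1) * (u * (a2' - b2')) -
        (a2 - b2) * (u * (a1' - b1')) by rewrite /d; ring.
      have -> : u * (a1' - b1') = - ((1 - u) * (a1 - b1)) by lra.
      have -> : u * (a2' - b2') = - ((1 - u) * (a2 - b2)) by lra.
      by ring.
    by move/eqP: det0; apply; lra.
  by elim/ord2_ind; elim/ord2_ind => // /esym.
have [j|t j|f [cf fz]] := @cell_conf 2 _ z _ _ injz.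
- apply: segment_continuous; first exact: ival_continuous.
    exact: cst_continuous.
  exact: cst_continuous.
- by apply: (cell_convex cU); [apply: (cell_phi cU) | apply: (cell_phi cU) | exact: ival_itv].
have f0 : f zero = c.
  by apply: conf_eqP => j; rewrite fz /z ival_zero segment0 (cell_phiK cU).
have f1 : f one = c'.
  by apply: conf_eqP => j; rewrite fz /z ival_one segment1 (cell_phiK cU).
exists (mk_path cf f0 f1) => t j; rewrite /mk_path /= fz.
by apply: (cell_psi cU); apply: (cell_convex cU);
  [exact: (cell_phi cU) | exact: (cell_phi cU) | exact: ival_itv].
Qed.

Lemma cell_conf_mk (a b : R * R) : K a -> K b -> a <> b -> exists c : conf 2 M,
  points c ord0 = psi a /\ points c ord_max = psi b.
Proof.
move=> Ka Kb ab.
have inj : injective (fun j : 'I_2 => if j == ord0 then psi a else psi b).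
  have ne : psi a <> psi b by move=> /(cell_psi_inj Ka Kb).
  by elim/ord2_ind; elim/ord2_ind => //= /esym/ne.
by exists (mk_conf inj).
Qed.

(** If the vectors between the points of [c] and of [c'] are parallel, pass
    through two points of [K] whose difference is transverse to both. *)
Lemma cell_path_connected (c c' : conf 2 M) :
  (forall j, U (points c j)) -> (forall j, U (points c' j)) ->
  exists l : {path I from c to c'}, forall t j, U (points (l t) j).
Proof.
move=> Uc Uc'.
pose w (c : conf 2 M) := phi (points c ord0) - phi (points c ord_max).
have w0 d : (forall j, U (points d j)) -> w d <> (0, 0).
  move=> Ud /subr0_eq /(congr1 psi); rewrite !(cell_phiK cU) // => /points_inj.
  by [].
have [det0|det0] := eqVneq (det (w c) (w c')) 0; last exact: cell_path_transverse.
have [a [b [Ka Kb dab]]] := cell_spread cU (w0 c Uc).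
have ab : a <> b.
  by move=> ab; move: dab; rewrite ab subrr /det /= !mulr0 subrr eqxx.
have [m [m0 m1]] := cell_conf_mk Ka Kb ab.
have Um j : U (points m j).
  by elim/ord2_ind: j; rewrite ?m0 ?m1; exact: (cell_psi cU).
have wm : w m = a - b by rewrite /w m0 m1 !(cell_psiK cU).
have [l1 Ul1] : exists l : {path I from c to m}, forall t j, U (points (l t) j).
  by apply: cell_path_transverse => //; rewrite -/(w m) wm.
have [l2 Ul2] : exists l : {path I from m to c'}, forall t j, U (points (l t) j).
  apply: cell_path_transverse => //; rewrite -/(w m) -/(w c') wm.
  move: (w0 c Uc) (w0 c' Uc') det0 dab; rewrite /det.
  case: (w c) (w c') (a - b) => [x1 x2] [y1 y2] [z1 z2] /= xn yn xy xz.
  apply/eqP => zy; move/eqP: xz; apply.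
  have zy' : z2 * y1 - z1 * y2 = 0 by lra.
  have e1 : y1 * (x1 * z2 - x2 * z1) = 0.
    transitivity (x1 * (z2 * y1 - z1 * y2) + z1 * (x1 * y2 - x2 * y1)); first by ring.
    by rewrite xy zy'; ring.
  have e2 : y2 * (x1 * z2 - x2 * z1) = 0.
    transitivity (x2 * (z2 * y1 - z1 * y2) + z2 * (x1 * y2 - x2 * y1)); first by ring.
    by rewrite xy zy'; ring.
  apply/eqP; case: eqP => // /eqP n0; exfalso; apply: yn.
  move/eqP: e1; move/eqP: e2; rewrite !mulf_eq0 (negbTE n0) !orbF.
  by move=> /eqP -> /eqP ->.
exists (concat_path l1 l2).
exact: (concat_path_in (A := fun c => forall j, U (points c j))).
Qed.

End OneCell.
End Cells.

(** * Pairs of points near the diagonal and away from it *)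

Lemma conf2_map (M T : topologicalType) (x y : T -> M) :
  continuous x -> continuous y -> (forall t, x t <> y t) ->
  exists f : T -> conf 2 M, [/\ continuous f, forall t, points (f t) ord0 = x t &
    forall t, points (f t) ord_max = y t].
Proof.
move=> cx cy xy.
have inj t : injective (fun j : 'I_2 => if j == ord0 then x t else y t).
  by elim/ord2_ind; elim/ord2_ind => //= e; case: (xy t); rewrite e.
exists (fun t => mk_conf (@inj t)); split=> //.
by apply: conf_continuous; elim/ord2_ind.
Qed.

Section Products.
Context (M : topologicalType).

Definition box (U V : set M) : set (M * M) := [set z | U z.1 /\ V z.2].

Lemma open_box (U V : set M) : open U -> open V -> open (box U V).
Proof.
move=> oU oV.
have /continuousP c1 := @continuous_fst M M.
have /continuousP c2 := @continuous_snd M M.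
by have := openI (c1 _ oU) (c2 _ oV).
Qed.

Lemma box_positions (U : set M) (c : conf 2 M) :
  box U U (positions c) <-> forall j, U (points c j).
Proof. by split=> [[U0 U1]|Uc]; [elim/ord2_ind | split; exact: Uc]. Qed.

End Products.

Section GoodBoxes.
Context (R : realType) (M : topologicalType) (c0 : conf 2 M).
Context (N : set (pi1 R c0)) (subN : is_subgroup N).
Local Notation I := (interval01 R).

Section OneCell.
Context (U : set M) (K : set (R * R)) (phi : M -> R * R) (psi : R * R -> M).
Context (cU : cell U K phi psi).

(** A homothety centered at [b] of small ratio, as [K] is bounded. *)
Lemma cell_shrink (b : M) (O : set M) : U b -> nbhs b O -> exists2 e : R,
  0 < e <= 1 & forall z, K z -> O (psi (segment e (phi b) z)).
Proof.
move=> Ub bO; have Kb := cell_phi cU Ub.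
have /subspace_continuousP cpsi := cell_psi_continuous cU.
have : nbhs (psi (phi b)) O by rewrite (cell_phiK cU Ub).
move=> /(cpsi _ Kb); rewrite /= => /nbhs_ballP[d /= d0 Hd].
have [r Hr] := cell_bounded cU.
have r0 : 0 <= r by have [] := Hr _ Kb; have := normr_ge0 (phi b).1; lra.
have D0 : 0 < 2 * r + 1 + d by lra.
pose e := d / (2 * r + 1 + d).
have e0 : 0 < e by rewrite divr_gt0.
have e1 : e <= 1 by rewrite ler_pdivrMr //; lra.
have ed : e * (2 * r) < d.
  by rewrite mulrAC ltr_pdivrMr // ltr_pM2l //; lra.
exists e => [|z Kz]; first by rewrite e0 e1.
have Kez : K (segment e (phi b) z) by apply: (cell_convex cU) => //; rewrite e1 ltW.
apply: Hd Kez; have [b1 b2] := Hr _ Kb; have [z1 z2] := Hr _ Kz.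
have close (u v : R) : `|u| <= r -> `|v| <= r -> ball u d ((1 - e) * u + e * v).
  rewrite !ler_norml => /andP[u1 u2] /andP[v1 v2].
  rewrite /ball /= ltr_distlC.
  have h1 : e * (u - v) <= e * (2 * r) by rewrite ler_pM2l //; lra.
  have h2 : e * (v - u) <= e * (2 * r) by rewrite ler_pM2l //; lra.
  by apply/andP; split; lra.
by split; exact: close.
Qed.

(** The homotheties centered at [b] of ratios from 1 to [e] move a loop of pairs
    of points freely to a loop near [b]. They are injective and preserve the
    convex set [K], so the points remain distinct and in the cell. *)
Lemma cell_loops_in (b : M) (O : set M) : U b -> nbhs b O ->
  loops_in N (box O O) -> loops_in N (box U U).
Proof.
move=> Ub bO LO c l d Ul.
have [e /andP[e0 e1] He] := cell_shrink Ub bO.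
have {}Ul t j : U (points (l t) j) by move: j; apply/box_positions.
pose rho (s : I) : R := 1 - ival s + ival s * e.
have rho01 s : 0 < rho s <= 1.
  have := ival_itv s; rewrite /rho; move: (ival s) => u /andP[u0 u1].
  by apply/andP; split; nra.
pose z (q : I * I) (j : 'I_2) := segment (rho q.1) (phi b) (phi (points (l q.2) j)).
have [j|q j|q|f [cf fz]] := cell_conf cU (z := z).
- apply: segment_continuous.
  + rewrite /rho; continuity.
    * by apply: (continuous_compT _ (@ival_continuous R)); continuity.
    * by apply: (continuous_compT _ (@ival_continuous R)); continuity.
  + exact: cst_continuous.
  + apply: (cell_phi_comp cU); last by move=> q; exact: Ul.
    apply: (continuous_compT _ (@points_continuous _ _ j)).
    by apply: (continuous_compT _ (@cts_fun _ _ l)); continuity.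
- apply: (cell_convex cU); [exact: (cell_phi cU)|exact: (cell_phi cU)|].
  by have /andP[/ltW -> ->] := rho01 q.1.
- move=> j k; rewrite /z /segment; have /andP[r0 _] := rho01 q.1.
  move=> [/addrI/(mulfI (lt0r_neq0 r0)) e11 /addrI/(mulfI (lt0r_neq0 r0)) e22].
  have : phi (points (l q.2) j) = phi (points (l q.2) k).
    by move: e11 e22; do 2 case: (phi _) => ? ? /=; move=> -> ->.
  by move=> /(congr1 psi); rewrite !(cell_phiK cU) // => /points_inj.
have f0 t : f (zero, t) = l t.
  apply: conf_eqP => j; rewrite fz /z /rho /= ival_zero subr0 mul0r addr0.
  by rewrite segment1 (cell_phiK cU).
have f1 s : f (s, one) = f (s, zero).
  by apply: conf_eqP => j; rewrite !fz /z /= path_zero path_one.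
have ch s : continuous (fun t => f (s, t)).
  by apply: (continuous_compT _ cf); continuity.
have cv t : continuous (fun s => f (s, t)).
  by apply: (continuous_compT _ cf); continuity.
have f00 : f (zero, zero) = c by rewrite f0 path_zero.
pose l' : {path I from f (one, zero) to f (one, zero)} :=
  mk_path (ch one) erefl (f1 one).
pose tau : {path I from c to f (one, zero)} := mk_path (cv zero) f00 erefl.
have comm : path_class tau ** path_class l' = path_class l ** path_class tau.
  apply: (@square_commutes _ _ _ _ _ _ (fun q => f (clamp q.1, clamp q.2))) => //.
  - apply: (continuous_compT _ cf); apply: continuous_pair;
      apply: (continuous_compT _ (@clamp_continuous R)); continuity.
  - by move=> s _; exact: esym (f0 (clamp s)).
have -> : d ** path_class l ** hom_inv d =
    (d ** path_class tau) ** path_class l' ** hom_inv (d ** path_class tau).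
  by rewrite -(hom_compA d (path_class tau)) comm !hom_simpl.
apply: LO => t; apply/box_positions => j.
rewrite /l' /mk_path /= fz; rewrite /z /rho /= ival_one subrr add0r mul1r.
by apply: He; exact: (cell_phi cU).
Qed.

Lemma good_square : loops_in N (box U U) -> good_set N (box U U).
Proof.
move=> LU; split=> //.
- by apply: open_box; exact: (cell_open cU).
- move=> _ _.
  have [|a [b [Ka Kb dab]]] := cell_spread cU (w := (1, 0)).
    by move=> [] /eqP; rewrite oner_eq0.
  have ab : a <> b.
    by move=> ab; move: dab; rewrite ab subrr /det /= !mulr0 subrr eqxx.
  have [m [m0 m1]] := cell_conf_mk cU Ka Kb ab.
  by exists m; rewrite /positions m0 m1; split; exact: (cell_psi cU).
- move=> c c' /box_positions Uc /box_positions Uc'.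
  have [l Ul] := cell_path_connected cU Uc Uc'.
  by exists l => t; apply/box_positions => j.
Qed.

End OneCell.

Section TwoCells.
Context (U : set M) (K : set (R * R)) (phi : M -> R * R) (psi : R * R -> M).
Context (V : set M) (L : set (R * R)) (chi : M -> R * R) (xi : R * R -> M).
Context (cU : cell U K phi psi) (cV : cell V L chi xi).
Context (UV : forall x, U x -> V x -> False).

(** Each point moves along a segment in its own cell, and the cells are
    disjoint, so the two points never collide. *)
Lemma disjoint_cells_homotopy (T : topologicalType) (r : T -> R) (u v : T -> conf 2 M) :
  continuous r -> (forall t, 0 <= r t <= 1) -> continuous u -> continuous v ->
  (forall t, box U V (positions (u t))) -> (forall t, box U V (positions (v t))) ->
  exists f : T -> conf 2 M, [/\ continuous f,
    forall t, box U V (positions (f t)),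
    forall t, r t = 0 -> f t = u t,
    forall t, r t = 1 -> f t = v t & forall t, u t = v t -> f t = u t].
Proof.
move=> cr r01 cu cv Wu Wv.
pose x t := segment (r t) (phi (points (u t) ord0)) (phi (points (v t) ord0)).
pose y t := segment (r t) (chi (points (u t) ord_max)) (chi (points (v t) ord_max)).
have Ux t : U (psi (x t)).
  by apply: (cell_psi cU); apply: (cell_convex cU) => //; apply: (cell_phi cU);
    [case: (Wu t) | case: (Wv t)].
have Kx t : K (x t).
  by apply: (cell_convex cU) => //; apply: (cell_phi cU);
    [case: (Wu t) | case: (Wv t)].
have Ly t : L (y t).
  by apply: (cell_convex cV) => //; apply: (cell_phi cV);
    [case: (Wu t) | case: (Wv t)].
have Vy t : V (xi (y t)) by apply: (cell_psi cV).
have cp (w : T -> conf 2 M) j : continuous w -> continuous (fun t => points (w t) j).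
  by move=> cw; apply: (continuous_compT cw (@points_continuous _ _ j)).
have [||t|f [cf f0 f1]] := @conf2_map M T (fun t => psi (x t)) (fun t => xi (y t)).
- apply: (within_comp (A := K)) => //; last exact: (cell_psi_continuous cU).
  apply: segment_continuous => //; apply: (cell_phi_comp cU); try exact: cp.
    by move=> t; case: (Wu t).
  by move=> t; case: (Wv t).
- apply: (within_comp (A := L)) => //; last exact: (cell_psi_continuous cV).
  apply: segment_continuous => //; apply: (cell_phi_comp cV); try exact: cp.
    by move=> t; case: (Wu t).
  by move=> t; case: (Wv t).
- by move=> xy; apply: (UV (x := psi (x t))) => //; rewrite xy.
exists f; split=> // t.
- by split; rewrite /positions /= ?f0 ?f1.
- move=> rt; apply: conf_eqP; have [Wu1 Wu2] := Wu t.
  elim/ord2_ind; rewrite ?f0 ?f1 /x /y rt segment0 ?(cell_phiK cU) //.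
  by rewrite (cell_phiK cV).
- move=> rt; apply: conf_eqP; have [Wu1 Wu2] := Wv t.
  elim/ord2_ind; rewrite ?f0 ?f1 /x /y rt segment1 ?(cell_phiK cU) //.
  by rewrite (cell_phiK cV).
- move=> uv; apply: conf_eqP; have [Wu1 Wu2] := Wu t.
  elim/ord2_ind; rewrite ?f0 ?f1 /x /y -uv segmentxx ?(cell_phiK cU) //.
  by rewrite (cell_phiK cV).
Qed.

Lemma good_disjoint_box : good_set N (box U V).
Proof.
split.
- by apply: open_box; [exact: (cell_open cU) | exact: (cell_open cV)].
- move=> [x y] [/= Ux Vy].
  have [|||f [_ f0 f1]] := @conf2_map M M (fun=> x) (fun=> y).
  + exact: cst_continuous.
  + exact: cst_continuous.
  + by move=> _ xy; apply: (UV Ux); rewrite xy.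
  + by exists (f x); rewrite /positions f0 f1.
- move=> c c' Wc Wc'.
  have [||||||f [cf Wf f0 f1 _]] := @disjoint_cells_homotopy I (@ival R)
    (fun=> c) (fun=> c') => //.
  + exact: ival_continuous.
  + exact: ival_itv.
  + exact: cst_continuous.
  + exact: cst_continuous.
  + by exists (mk_path cf (f0 zero (ival_zero R)) (f1 one (ival_one R))).
- move=> c l d Wl.
  suff -> : path_class l = hom_id R c.
    by rewrite hom_compp1 hom_comppV loop_class1; exact: (subgroup1 subN).
  apply/path_classP.
  have Wc : box U V (positions c) by have := Wl zero; rewrite path_zero.
  have [||||||f [cf Wf f0 f1 fu]] := @disjoint_cells_homotopy (I * I)%type
    (fun q => ival q.1) (fun q => l q.2) (fun=> c) => //.
  + by apply: (continuous_compT _ (@ival_continuous R)); continuity.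
  + by move=> q; exact: ival_itv.
  + by apply: (continuous_compT _ (@cts_fun _ _ l)); continuity.
  + exact: cst_continuous.
  + exists f; split=> // [t|t|s|s].
    * by rewrite f0 //= ival_zero.
    * by rewrite f1 //= ival_one.
    * by rewrite fu /= path_zero.
    * by rewrite fu /= path_one.
Qed.

End TwoCells.

Context (hausM : hausdorff_space M) (connM : connected [set: M]).
Context (cells : forall x O, nbhs x O -> exists U K phi psi,
  [/\ @cell R M U K phi psi, U x & U `<=` O]).

Lemma nbhs_cell U K phi psi x : @cell R M U K phi psi -> U x -> nbhs x U.
Proof. by move=> cU Ux; apply: open_nbhs_nbhs; split=> //; exact: (cell_open cU). Qed.

(** For the points of one cell, to have a neighborhood whose square has its
    loops in [N] is equivalent to the same property of the whole cell. So this
    condition is locally constant on [M]. *)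
Lemma all_cells_loops_in (a : M) (O : set M) : nbhs a O -> loops_in N (box O O) ->
  forall U K phi psi x, @cell R M U K phi psi -> U x -> loops_in N (box U U).
Proof.
move=> aO LO U K phi psi x cU Ux.
pose G (x : M) := exists2 O, nbhs x O & loops_in N (box O O).
suff [W xO' LO'] : G x by exact: (cell_loops_in cU Ux xO').
apply: (connected_ind (G := G) connM _ (q0 := a)) => //; last by exists O.
move=> q _.
have [V [L [chi [xi [cV Vq _]]]]] := cells (filterT : nbhs q setT).
have : nbhs q V by exact: nbhs_cell cV Vq.
apply: filterS => y Vy _.
have trans x1 x2 : V x1 -> V x2 -> G x1 -> G x2.
  move=> Vx1 Vx2 [W xO' LO']; exists V; first exact: nbhs_cell cV Vx2.
  exact: (cell_loops_in cV Vx1 xO').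
by split; exact: trans.
Qed.

Lemma good_boxes (a : M) (O : set M) : nbhs a O -> loops_in N (box O O) ->
  forall x O', nbhs x O' -> exists W, [/\ good_set N W, W x & W `<=` O'].
Proof.
move=> aO LO [x y] W' [[A B] /= [xA yB] ABW].
have [xy|xy] := pselect (x = y).
  subst y; have [U [K [phi [psi [cU Ux UAB]]]]] := cells (filterI xA yB).
  exists (box U U); split=> //.
    by apply: (good_square cU); exact: (all_cells_loops_in aO LO cU Ux).
  by move=> [u v] [/= /UAB[Au _] /UAB[_ Bv]]; apply: ABW.
have [A' [B' [xA' yB' AB']]] := separate_points hausM xy.
have [U [K [phi [psi [cU Ux UA]]]]] := cells (filterI xA xA').
have [V [L [chi [xi [cV Vy VB]]]]] := cells (filterI yB yB').
exists (box U V); split=> //.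
  apply: (good_disjoint_box cU cV) => z /UA[_ A'z] /VB[_ B'z].
  exact: (AB' z).
by move=> [u v] [/= /UA[Au _] /VB[Bv _]]; apply: ABW.
Qed.

End GoodBoxes.

(** * Convex charts of a surface *)

Section SurfaceCells.
Context (R : realType) (M : topologicalType).

Lemma convex_itv (l h u v t : R) : l < u < h -> l < v < h -> 0 <= t <= 1 ->
  l < (1 - t) * u + t * v < h.
Proof.
move=> /andP[lu uh] /andP[lv vh] /andP[t0 t1].
have [t_gt0|t_le0] := ltP 0 t; last first.
  have -> : t = 0 by lra.
  by rewrite subr0 mul1r mul0r addr0 lu uh.
have tv1 : 0 < t * (v - l) by rewrite mulr_gt0 // subr_gt0.
have tv2 : 0 < t * (h - v) by rewrite mulr_gt0 // subr_gt0.
have tu1 : 0 <= (1 - t) * (u - l) by apply: mulr_ge0; lra.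
have tu2 : 0 <= (1 - t) * (h - u) by apply: mulr_ge0; lra.
by apply/andP; split; nra.
Qed.

(** The half-plane meets a square around the image of [x] in a convex set. *)
Lemma chart_cells (x : M) (O : set M) : has_chart (@half_plane R) x -> nbhs x O ->
  exists U K phi psi, [/\ @cell R M U K phi psi, U x & U `<=` O].
Proof.
move=> [U0 [V0 [[oU0 U0x] oV0 [f [g [cf cg fK gK]]]]]] xO.
pose D := V0 `&` @half_plane R.
pose phi (y : M) : R * R :=
  if pselect (U0 y) is left H then \val (f (to_set_type H)) else (0, 0).
pose psi (z : R * R) : M :=
  if pselect (D z) is left H then \val (g (to_set_type H)) else x.
have phiE (u : set_type U0) : phi (\val u) = \val (f u).
  rewrite /phi; case: pselect => [H|[]]; last exact: set_mem (valP u).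
  by congr (\val (f _)); exact: val_inj.
have psiE (u : set_type D) : psi (\val u) = \val (g u).
  rewrite /psi; case: pselect => [H|[]]; last exact: set_mem (valP u).
  by congr (\val (g _)); exact: val_inj.
have cphi : {within U0, continuous phi}.
  apply/subspace_sigL_continuousP.
  have -> : sigL U0 phi = \val \o f by apply/funext => u; exact: phiE.
  exact: (continuous_compT cf (@initial_continuous _ _ _)).
have cpsi : {within D, continuous psi}.
  apply/subspace_sigL_continuousP.
  have -> : sigL D psi = \val \o g by apply/funext => u; exact: psiE.
  exact: (continuous_compT cg (@initial_continuous _ _ _)).
have Dphi y : U0 y -> D (phi y).
  move=> Uy; rewrite -[y]/(\val (to_set_type Uy)) phiE.
  exact: set_mem (valP (f _)).
have Upsi z : D z -> U0 (psi z).
  move=> Dz; rewrite -[z]/(\val (to_set_type Dz)) psiE.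
  exact: set_mem (valP (g _)).
have phiK y : U0 y -> psi (phi y) = y.
  by move=> Uy; rewrite -[y]/(\val (to_set_type Uy)) phiE psiE fK.
have psiK z : D z -> phi (psi z) = z.
  by move=> Dz; rewrite -[z]/(\val (to_set_type Dz)) psiE phiE gK.
pose p := phi x; have Dp : D p := Dphi _ U0x.
have [r r0 Hr] : exists2 r : R, 0 < r & forall z, ball p r z -> half_plane z ->
    D z /\ O (psi z).
  have nV : nbhs p V0 by apply: open_nbhs_nbhs; split=> //; exact: Dp.1.
  have /subspace_continuousP/(_ _ Dp) cp := cpsi.
  have : nbhs (psi p) O by rewrite phiK.
  move=> /cp /= nO.
  have : nbhs p (V0 `&` [set z | D z -> O (psi z)]) by exact: filterI.
  move=> /nbhs_ballP[r r0 Hr].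
  exists r => // z /Hr[V0z HO] Ez; have Dz : D z by split.
  by split=> //; exact: HO.
pose K := ball p r `&` @half_plane R.
have KD z : K z -> D z by move=> [/Hr H /H[]].
have p2 : 0 <= p.2 by case: Dp.
exists (U0 `&` phi @^-1` ball p r), K, phi, psi; split.
- split.
  + rewrite openE => y [Uy py].
    have nU : nbhs y U0 by apply: open_nbhs_nbhs.
    have /subspace_continuousP/(_ _ Uy) cy := cphi.
    have : nbhs (phi y) (ball p r).
      by apply: open_nbhs_nbhs; split=> //; exact: ball_open.
    move=> /cy /= nb; apply: filterS2 nU nb => z Uz Hz; split=> //.
    exact: Hz.
  + by apply: continuous_subspaceW cphi => y [].
  + by apply: continuous_subspaceW cpsi => z /KD.
  + by move=> y [Uy py]; split=> //; case: (Dphi _ Uy).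
  + by move=> z Kz; split; [exact/Upsi/KD | rewrite /= psiK; [case: Kz | exact: KD]].
  + by move=> y [Uy _]; exact: phiK.
  + by move=> z /KD; exact: psiK.
  + move=> a b t [[/= a1 a2] Ea] [[/= b1 b2] Eb] /andP[t0 t1].
    rewrite /half_plane /= in Ea Eb.
    split; last first.
      rewrite /half_plane /=; apply: addr_ge0; apply: mulr_ge0 => //.
      by rewrite subr_ge0.
    by split; rewrite /ball /= ltr_distlC; apply: convex_itv;
      rewrite ?t0 // -ltr_distlC.
  + move=> w w0.
    have Kp : K p by split=> //; exact: ballxx.
    have [w2|w2] := eqVneq w.2 0.
      have w1 : w.1 != 0.
        by apply/eqP => w1; apply: w0; case: w w1 w2 => ? ? /= -> ->.
      exists (p.1, p.2 + r / 2), p; split=> //.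
        split; last by rewrite /half_plane /=; lra.
        by split; rewrite /ball /= ltr_distlC; lra.
      rewrite /det /= subrr mulr0 subr0 addrC addKr.
      by rewrite mulf_neq0 // lt0r_neq0 //; lra.
    exists (p.1 + r / 2, p.2), p; split=> //.
      split; last by [].
      by split; rewrite /ball /= ltr_distlC; lra.
    rewrite /det /= subrr mulr0 add0r oppr_eq0 (addrC p.1) addrK.
    by rewrite mulf_neq0 // lt0r_neq0 //; lra.
  + exists (`|p.1| + `|p.2| + r) => z [[/= z1 z2] _].
    have := ler_norm p.1; have := ler_norm (- p.1); rewrite normrN.
    have := ler_norm p.2; have := ler_norm (- p.2); rewrite normrN.
    move: z1 z2; rewrite /ball /= !ltr_distlC !ler_norml.
    move=> /andP[? ?] /andP[? ?] ? ? ? ?.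
    have := normr_ge0 p.1; have := normr_ge0 p.2.
    by move=> ? ?; split; apply/andP; split; lra.
- by split=> //=; exact: ballxx.
- move=> y [Uy py]; have [_ Ey] := Dphi _ Uy.
  by rewrite -(phiK _ Uy); case: (Hr _ py Ey).
Qed.

End SurfaceCells.

(** * Angles of plane vectors *)

Section Angles.
Context (R : realType).
Implicit Types (v : R * R) (a b : R).

(** The vector [v] is a positive multiple of (cos a, sin a): its coordinates in
    the frame rotated by [a] are positive and zero. This avoids the norm. *)
Definition has_angle v a : Prop :=
  0 < cos a * v.1 + sin a * v.2 /\ cos a * v.2 = sin a * v.1.

Lemma has_angle_polar v a : has_angle v a ->
  v = ((cos a * v.1 + sin a * v.2) * cos a, (cos a * v.1 + sin a * v.2) * sin a).
Proof.
case: v => v1 v2 [/= _ e]; have cs := cos2Dsin2 a.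
congr pair.
  have -> : (cos a * v1 + sin a * v2) * cos a =
    (cos a ^+ 2 + sin a ^+ 2) * v1 + sin a * (cos a * v2 - sin a * v1) by ring.
  by rewrite cs e subrr mulr0 addr0 mul1r.
have -> : (cos a * v1 + sin a * v2) * sin a =
  (cos a ^+ 2 + sin a ^+ 2) * v2 - cos a * (cos a * v2 - sin a * v1) by ring.
by rewrite cs e subrr mulr0 subr0 mul1r.
Qed.

(** In the frame rotated by [a] the vector lies in the right half-plane, where
    the arctangent of the slope is its angle. *)
Lemma has_angle_atan v a : 0 < cos a * v.1 + sin a * v.2 ->
  has_angle v (a + atan ((cos a * v.2 - sin a * v.1) / (cos a * v.1 + sin a * v.2))).
Proof.
case: v => v1 v2 /=; set p := _ + _ => p0; set q := _ - _.
have C0 : 0 < cos (atan (q / p)).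
  by apply: cos_gt0_pihalf; rewrite atan_gtNpi2 atan_ltpi2.
have SE : sin (atan (q / p)) * p = q * cos (atan (q / p)).
  have : tan (atan (q / p)) = q / p by rewrite atanK.
  rewrite /tan => /eqP; rewrite eqr_div ?lt0r_neq0 // => /eqP.
  by [].
rewrite /has_angle /= cosD sinD.
move: (cos (atan _)) (sin (atan _)) C0 SE => C S C0 SE; split.
  have -> : (cos a * C - sin a * S) * v1 + (sin a * C + cos a * S) * v2 =
    C * p + S * q by rewrite /p /q; ring.
  have qS : 0 <= S * q.
    rewrite -(pmulr_rge0 _ C0); have -> : C * (S * q) = S * (S * p).
      by rewrite SE; ring.
    by rewrite mulrA -expr2 mulr_ge0 ?sqr_ge0 ?ltW.
  by rewrite ltr_pwDl // mulr_gt0.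
apply/eqP; rewrite -subr_eq0; apply/eqP.
transitivity (q * C - S * p); first by rewrite /p /q; ring.
by rewrite SE subrr.
Qed.

Lemma exists_angle v : v <> (0, 0) -> exists a, has_angle v a.
Proof.
case: v => v1 v2 v0.
have [v1n|v1p|v10] := ltgtP v1 0.
- eexists; apply: (@has_angle_atan _ pi) => /=.
  by rewrite cospi sinpi; lra.
- eexists; apply: (@has_angle_atan _ 0) => /=.
  by rewrite cos0 sin0; lra.
- subst v1; have [v2n|v2p|v20] := ltgtP v2 0.
  + eexists; apply: (@has_angle_atan _ (- (pi / 2))) => /=.
    by rewrite cosN sinN cos_pihalf sin_pihalf; lra.
  + eexists; apply: (@has_angle_atan _ (pi / 2)) => /=.
    by rewrite cos_pihalf sin_pihalf; lra.
  + by subst v2.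
Qed.

Lemma has_angle_rotate v a b k : 0 < k -> has_angle v a ->
  has_angle ((cos b * v.1 - sin b * v.2) * k, (sin b * v.1 + cos b * v.2) * k) (a + b).
Proof.
move=> k0 [p0 e]; rewrite /has_angle /= cosD sinD.
case: v p0 e => v1 v2 /= p0 e; have cs := cos2Dsin2 b; split.
  have -> : (cos a * cos b - sin a * sin b) * ((cos b * v1 - sin b * v2) * k) +
    (sin a * cos b + cos a * sin b) * ((sin b * v1 + cos b * v2) * k) =
    (cos b ^+ 2 + sin b ^+ 2) * (cos a * v1 + sin a * v2) * k by ring.
  by rewrite cs mul1r mulr_gt0.
apply/eqP; rewrite -subr_eq0; apply/eqP.
transitivity ((cos b ^+ 2 + sin b ^+ 2) * (cos a * v2 - sin a * v1) * k).
  by ring.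
by rewrite e subrr mulr0 mul0r.
Qed.

Lemma has_angleN v a : has_angle v a -> has_angle (- v.1, - v.2) (a + pi).
Proof.
move=> /(has_angle_rotate pi ltr01); rewrite cospi sinpi /= !mulr1.
by rewrite !mul0r subr0 add0r !mulN1r.
Qed.

Lemma has_angle_period v a (n : nat) : has_angle v a -> has_angle v (a + pi *+ 2 *+ n).
Proof. by rewrite /has_angle !periodicn //; [exact: sinD2pi | exact: cosD2pi]. Qed.

Lemma cos_eq1 a : 0 <= a -> cos a = 1 -> exists n : nat, a = pi *+ 2 *+ n.
Proof.
move=> a0 ca; have pi0 := pi_gt0 R.
have p2 : 0 < (pi : R) *+ 2 by rewrite mulrn_wgt0.
pose n := Num.truncn (a / (pi *+ 2)).
have /andP[n1 n2] : n%:R <= a / (pi *+ 2) < n.+1%:R.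
  by apply: truncn_itv; rewrite divr_ge0 // ltW.
rewrite ler_pdivlMr // mulr_natl in n1; rewrite ltr_pdivrMr // mulr_natl mulrS in n2.
exists n; apply/eqP; rewrite eq_sym; apply: contraTT isT => an.
pose b := a - pi *+ 2 *+ n.
have b0 : 0 < b by rewrite subr_gt0 lt_neqAle an n1.
have b1 : b < pi *+ 2 by rewrite /b; lra.
have cb : cos b = 1.
  by rewrite -(periodicn (@cosD2pi R) n) subrK.
have s0 : 0 < sin (b / 2) by apply: sin_gt0_pi; lra.
have : cos b = 1 - 2 * sin (b / 2) ^+ 2.
  rewrite {1}(splitr b) cosD -!expr2; have := cos2Dsin2 (b / 2); lra.
have s2 : 0 < sin (b / 2) ^+ 2 by exact: exprn_gt0.
by rewrite cb => h; exfalso; lra.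
Qed.

Lemma has_angle_eq v a b : has_angle v a -> has_angle v b -> exists n : nat,
  b = a + pi *+ 2 *+ n \/ a = b + pi *+ 2 *+ n.
Proof.
move=> va vb; have [p0 _] := va; have [q0 _] := vb.
have ea := has_angle_polar va; have eb := has_angle_polar vb.
set p := _ + _ in p0 ea; set q := _ + _ in q0 eb.
have [pa1 pa2] : p * cos a = q * cos b /\ p * sin a = q * sin b.
  by split; [have := congr1 fst (etrans (esym ea) eb)
            |have := congr1 snd (etrans (esym ea) eb)].
have csa := cos2Dsin2 a; have csb := cos2Dsin2 b.
have pq : p = q.
  apply/eqP; rewrite -(eqrXn2 (n := 2)) ?ltW //; apply/eqP.
  transitivity ((p * cos a) ^+ 2 + (p * sin a) ^+ 2).
    by rewrite !exprMn -mulrDr csa mulr1.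
  by rewrite pa1 pa2 !exprMn -mulrDr csb mulr1.
have c : cos (b - a) = 1.
  rewrite cosB -csa !expr2.
  have pn : p != 0 by rewrite lt0r_neq0.
  by apply: (mulfI pn); rewrite !mulrDr !mulrA pa1 pa2 pq.
have [ab|ba] := leP a b.
  have [||n nE] := @cos_eq1 (b - a) => //; first by rewrite subr_ge0.
  by exists n; left; rewrite -nE addrC subrK.
have [||n nE] := @cos_eq1 (a - b) => //.
- by rewrite subr_ge0 ltW.
- by rewrite -opprB cosN.
- by exists n; right; rewrite -nE addrC subrK.
Qed.

(** On a short interval the vectors [v t] form acute angles with the first one,
    and [has_angle_atan] gives an angle that varies continuously. *)
Lemma angle_lift (v : R -> R * R) : continuous v -> (forall t, v t <> (0, 0)) ->
  forall a b, a <= b -> forall a0, has_angle (v a) a0 ->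
  exists w : R -> R, [/\ continuous w, w a = a0 &
    forall t, a <= t <= b -> has_angle (v t) (w t)].
Proof.
move=> cv v0.
have cv1 := continuous_compT cv (@continuous_fst R R).
have cv2 := continuous_compT cv (@continuous_snd R R).
apply: (interval_gluing (P := fun a b => forall a0, has_angle (v a) a0 ->
  exists w : R -> R, [/\ continuous w, w a = a0 &
    forall t, a <= t <= b -> has_angle (v t) (w t)])).
- move=> x.
  pose D (q : R * R) := (v q.1).1 * (v q.2).1 + (v q.1).2 * (v q.2).2.
  have cD : continuous D.
    rewrite /D; continuity.
    + by apply: (continuous_compT _ cv1); continuity.
    + by apply: (continuous_compT _ cv1); continuity.
    + by apply: (continuous_compT _ cv2); continuity.
    + by apply: (continuous_compT _ cv2); continuity.
  have D0 : 0 < D (x, x).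
    rewrite lt_neqAle addr_ge0 -?expr2 ?sqr_ge0 // andbT eq_sym.
    rewrite paddr_eq0 ?sqr_ge0 // !sqrf_eq0; apply/negP => /andP[/eqP e1 /eqP e2].
    by apply: (v0 x); case: (v x) e1 e2 => ? ? /= -> ->.
  have : nbhs (x, x) (D @^-1` [set r | 0 < r]).
    by apply: cD; apply: open_nbhs_nbhs; split=> //; exact: open_gt.
  move=> /nbhs_ballP[e e0 He]; exists e => // a b xa ab bx a0 va0.
  have pos t : a <= t <= b -> 0 < cos a0 * (v t).1 + sin a0 * (v t).2.
    move=> tab; have [p0 _] := va0; have := has_angle_polar va0.
    set p := _ + _ in p0 *; move=> vE.
    have : 0 < D (a, t) by apply: He; split; rewrite /ball /= ltr_distlC; lra.
    by rewrite /D /= vE /= -!mulrA -mulrDr pmulr_rgt0.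
  pose w t := a0 + atan ((cos a0 * (v t).2 - sin a0 * (v t).1) /
    (cos a0 * (v t).1 + sin a0 * (v t).2)).
  have ab' t : a <= clip a b t <= b by exact: clip_itv.
  exists (fun t => w (clip a b t)); split.
  + have cc := @clip_continuous R a b.
    have c1 := continuous_compT cc cv1; have c2 := continuous_compT cc cv2.
    apply: continuous_addf; first exact: cst_continuous.
    apply: (continuous_compT _ (@continuous_atan R)).
    apply: continuous_mulf; first by continuity.
    move=> t; apply: cvgV; first by rewrite gt_eqF // pos.
    have : continuous (fun t => cos a0 * (v (clip a b t)).1 + sin a0 * (v (clip a b t)).2).
      by continuity.
    by apply.
  + rewrite clip_id ?lexx // /w; case: va0 => _ ->.
    by rewrite subrr mul0r atan0 addr0.
  + by move=> t tab; rewrite clip_id //; apply: has_angle_atan; exact: pos.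
- move=> a b c ab bc P1 P2 a0 va0.
  have [w1 [cw1 w10 Hw1]] := P1 a0 va0.
  have [|w2 [cw2 w20 Hw2]] := P2 (w1 b); first by apply: Hw1; rewrite lexx ab.
  exists (fun t => if t <= b then w1 t else w2 t); split.
  + by apply: glue_continuous => //; [continuity | move=> t ->].
  + by rewrite ab.
  + move=> t /andP[ta tc]; have [tb|tb] := leP t b.
      by apply: Hw1; rewrite ta.
    by apply: Hw2; rewrite ltW.
Qed.

End Angles.

(** * Pairs of points in the disk *)

Section DiskLoops.
Context (R : realType).
Local Notation I := (interval01 R).
Local Notation D := (disk R).

Lemma disk_val_continuous : continuous (@disk_val R).
Proof. exact: initial_continuous. Qed.

Lemma disk_val_inj : injective (@disk_val R).
Proof. exact: val_inj. Qed.

Lemma closed_disk_shrink (z : R * R) (m : R) : 1 <= m ->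
  z.1 ^+ 2 + z.2 ^+ 2 <= m -> @closed_disk R (z.1 * m^-1, z.2 * m^-1).
Proof.
move=> m1 zm; have m0 : 0 < m by lra.
rewrite /closed_disk /= !exprMn -mulrDl.
apply: (@le_trans _ _ (m * m^-1 ^+ 2)).
  by rewrite ler_wpM2r // sqr_ge0.
by rewrite expr2 mulrA mulfV ?lt0r_neq0 // mul1r invf_le1.
Qed.

Lemma disk_map (T : topologicalType) (z : T -> R * R) : continuous z ->
  (forall t, @closed_disk R (z t)) -> exists f : T -> D, continuous f /\
    forall t, disk_val (f t) = z t.
Proof.
move=> cz Dz; exists (fun t => to_set_type (Dz t)); split=> //.
exact: continuous_comp_initial.
Qed.

Lemma disk_retraction : exists f : R * R -> D, continuous f /\
  forall d, f (disk_val d) = d.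
Proof.
pose m (z : R * R) := Num.max 1 (z.1 ^+ 2 + z.2 ^+ 2).
have m1 z : 1 <= m z by rewrite le_max lexx.
have cm : continuous m.
  apply: max_fun_continuous; first exact: cst_continuous.
  rewrite (_ : (fun z : R * R => _) = fun z => z.1 * z.1 + z.2 * z.2).
    by continuity.
  by apply/funext => z; rewrite !expr2.
have cmV : continuous (fun z => (m z)^-1).
  move=> z; apply: cvgV; last exact: cm.
  by rewrite gt_eqF // (lt_le_trans ltr01).
have [|z|f [cf fz]] := @disk_map (R * R)%type (fun z => (z.1 * (m z)^-1, z.2 * (m z)^-1)).
- by continuity.
- by apply: closed_disk_shrink => //; rewrite le_max lexx orbT.
exists f; split=> // d.
apply: disk_val_inj; rewrite fz /m (max_idPl (disk_valP d)) invr1 !mulr1.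
by case: (disk_val d).
Qed.

Lemma disk_compact : compact [set: D].
Proof.
have [f [cf fK]] := disk_retraction.
have -> : [set: D] = f @` (`[-1, 1] `*` `[-1, 1]).
  apply/seteqP; split=> // d _; exists (disk_val d) => //.
  have := disk_valP d; case: (disk_val d) => x y /= xy.
  by rewrite /= !in_itv /=; have := sqr_ge0 x; have := sqr_ge0 y;
    split; apply/andP; split; nra.
apply: continuous_compact; first exact: continuous_subspaceT.
by apply: compact_setX; exact: segment_compact.
Qed.

Lemma disk_cell : exists psi, cell [set: D] (@closed_disk R) (@disk_val R) psi.
Proof.
have [f [cf fK]] := disk_retraction; exists f; split=> //.
- exact: openT.
- exact/continuous_subspaceT/disk_val_continuous.
- exact: continuous_subspaceT.
- by move=> d _; exact: disk_valP.
- by move=> z Dz; have := fK (to_set_type Dz); move/(congr1 (@disk_val R)).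
- move=> [a1 a2] [b1 b2] t; rewrite /closed_disk /segment /= => Da Db /andP[t0 t1].
  have h : ((1 - t) * a1 + t * b1) ^+ 2 + ((1 - t) * a2 + t * b2) ^+ 2 =
      (1 - t) * (a1 ^+ 2 + a2 ^+ 2) + t * (b1 ^+ 2 + b2 ^+ 2) -
      t * (1 - t) * ((a1 - b1) ^+ 2 + (a2 - b2) ^+ 2) by ring.
  rewrite h; have t1' : 0 <= 1 - t by lra.
  have h1 : (1 - t) * (a1 ^+ 2 + a2 ^+ 2) <= (1 - t) * 1 by rewrite ler_wpM2l.
  have h2 : t * (b1 ^+ 2 + b2 ^+ 2) <= t * 1 by rewrite ler_wpM2l.
  have h3 : 0 <= t * (1 - t) * ((a1 - b1) ^+ 2 + (a2 - b2) ^+ 2).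
    by rewrite !mulr_ge0 // addr_ge0 ?sqr_ge0.
  by lra.
- move=> w w0.
  have D0 : @closed_disk R (0, 0) by rewrite /closed_disk /= !expr0n /= addr0.
  have [w2|w2] := eqVneq w.2 0.
    have w1 : w.1 != 0.
      by apply/eqP => w1; apply: w0; case: w w1 w2 => ? ? /= -> ->.
    exists (0, 1), (0, 0); split=> //.
      by rewrite /closed_disk /= expr0n expr1n add0r.
    by rewrite /det /= !subr0 mulr1 mulr0 subr0.
  exists (1, 0), (0, 0); split=> //.
    by rewrite /closed_disk /= expr0n expr1n addr0.
  by rewrite /det /= !subr0 mulr1 mulr0 sub0r oppr_eq0.
- exists 1 => -[x y] /=; rewrite /closed_disk /= => xy.
  by have := sqr_ge0 x; have := sqr_ge0 y; rewrite !ler_norml;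
    split; apply/andP; split; nra.
Qed.

Implicit Types (c : conf 2 D).

Definition midpoint c : R * R :=
  (((disk_val (points c ord0)).1 + (disk_val (points c ord_max)).1) / 2,
   ((disk_val (points c ord0)).2 + (disk_val (points c ord_max)).2) / 2).

Definition offset c : R * R :=
  (((disk_val (points c ord0)).1 - (disk_val (points c ord_max)).1) / 2,
   ((disk_val (points c ord0)).2 - (disk_val (points c ord_max)).2) / 2).

Let cpt j : continuous (fun c => disk_val (points c j)).
Proof. exact: (continuous_compT (@points_continuous _ _ j) disk_val_continuous). Qed.

Let cpt1 j : continuous (fun c => (disk_val (points c j)).1).
Proof. exact: (continuous_compT (cpt (j := j)) (@continuous_fst R R)). Qed.

Let cpt2 j : continuous (fun c => (disk_val (points c j)).2).
Proof. exact: (continuous_compT (cpt (j := j)) (@continuous_snd R R)). Qed.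

Lemma midpoint_continuous : continuous midpoint.
Proof. by rewrite /midpoint; continuity; do ?[exact: cpt1 | exact: cpt2]. Qed.

Lemma offset_continuous : continuous offset.
Proof. by rewrite /offset; continuity; do ?[exact: cpt1 | exact: cpt2]. Qed.

Lemma offset_neq0 c : offset c <> (0, 0).
Proof.
move=> [e1 e2]; suff : ord0 = ord_max :> 'I_2 by [].
apply: (@points_inj _ _ c); apply: disk_val_inj.
move: e1 e2; case: (disk_val (points c ord0)) (disk_val (points c ord_max)).
by move=> a1 a2 [b1 b2] /= e1 e2; congr pair; lra.
Qed.

Lemma midpoint_offset c :
  disk_val (points c ord0) =
    ((midpoint c).1 + (offset c).1, (midpoint c).2 + (offset c).2) /\
  disk_val (points c ord_max) =
    ((midpoint c).1 - (offset c).1, (midpoint c).2 - (offset c).2).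
Proof.
rewrite /midpoint /offset /=.
case: (disk_val (points c ord0)) (disk_val (points c ord_max)) => [a1 a2] [b1 b2] /=.
by split; congr pair; lra.
Qed.

(** The pair with midpoint [m t] and half-difference of modulus [r t] and angle
    [w t] may leave the disk. Dividing both points by one number, which is 1
    when they are in the disk, brings them back without making them collide. *)
Lemma polar_conf (T : topologicalType) (m : T -> R * R) (r w : T -> R) :
  continuous m -> continuous r -> continuous w -> (forall t, 0 < r t) ->
  exists f : T -> conf 2 D, continuous f /\ forall t c, midpoint c = m t ->
    offset c = (r t * cos (w t), r t * sin (w t)) -> f t = c.
Proof.
move=> cm cr cw r0.
have cC := continuous_compT cw (@continuous_cos R).
have cS := continuous_compT cw (@continuous_sin R).
have cm1 := continuous_compT cm (@continuous_fst R R).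
have cm2 := continuous_compT cm (@continuous_snd R R).
pose a1 t := (m t).1 + r t * cos (w t); pose a2 t := (m t).2 + r t * sin (w t).
pose b1 t := (m t).1 - r t * cos (w t); pose b2 t := (m t).2 - r t * sin (w t).
have ca1 : continuous a1 by rewrite /a1; continuity.
have ca2 : continuous a2 by rewrite /a2; continuity.
have cb1 : continuous b1 by rewrite /b1; continuity.
have cb2 : continuous b2 by rewrite /b2; continuity.
pose k t := Num.max 1 (Num.max (a1 t * a1 t + a2 t * a2 t) (b1 t * b1 t + b2 t * b2 t)).
have k1 t : 1 <= k t by rewrite le_max lexx.
have k0 t : 0 < k t by rewrite (lt_le_trans ltr01).
have ck : continuous k.
  apply: max_fun_continuous; first exact: cst_continuous.
  by apply: max_fun_continuous; continuity.
have ckV : continuous (fun t => (k t)^-1).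
  by move=> t; apply: cvgV; [rewrite gt_eqF | exact: ck].
have [|t|A [cA HA]] := @disk_map T (fun t => (a1 t * (k t)^-1, a2 t * (k t)^-1)).
- by continuity.
- by apply: (@closed_disk_shrink (a1 t, a2 t)) => //=; rewrite !expr2 !le_max lexx !orbT.
have [|t|B [cB HB]] := @disk_map T (fun t => (b1 t * (k t)^-1, b2 t * (k t)^-1)).
- by continuity.
- by apply: (@closed_disk_shrink (b1 t, b2 t)) => //=; rewrite !expr2 !le_max lexx !orbT.
have kV t : (k t)^-1 != 0 by rewrite invr_eq0 lt0r_neq0.
have [//|//|t|f [cf f0 f1]] := @conf2_map D T A B.
  move=> /(congr1 (@disk_val R)); rewrite HA HB => -[/(mulIf (kV t)) e1 /(mulIf (kV t)) e2].
  have rn : r t != 0 by rewrite lt0r_neq0.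
  have C0 : cos (w t) = 0.
    by apply: (mulfI rn); rewrite mulr0; move: e1; rewrite /a1 /b1; lra.
  have S0 : sin (w t) = 0.
    by apply: (mulfI rn); rewrite mulr0; move: e2; rewrite /a2 /b2; lra.
  have := cos2Dsin2 (w t); rewrite C0 S0 expr0n /= addr0 => /eqP.
  by rewrite eq_sym oner_eq0.
exists f; split=> // t c mE oE.
have [e0 e1] := midpoint_offset c; rewrite mE oE /= in e0 e1.
have kE : k t = 1.
  apply/max_idPl; rewrite ge_max -!expr2; apply/andP; split.
    by have := disk_valP (points c ord0); rewrite e0.
  by have := disk_valP (points c ord_max); rewrite e1.
apply: conf_eqP; elim/ord2_ind; apply: disk_val_inj.
  by rewrite f0 HA kE invr1 !mulr1 e0.
by rewrite f1 HB kE invr1 !mulr1 e1.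
Qed.

(** The angle of the vector from the second point to the first can be followed
    continuously along [l] from [a] to [b]. *)
Definition winds c c' (l : {path I from c to c'}) (a b : R) : Prop :=
  exists w : R -> R, [/\ continuous w, w 0 = a, w 1 = b &
    forall t, 0 <= t <= 1 -> has_angle (offset (extend_path l t)) (w t)].

(** Interpolate linearly between the midpoints, the moduli and the angles of the
    two paths. The end points stay fixed since the angles agree there as real
    numbers, not only up to full turns. *)
Lemma winds_homotopic c c' (l l' : {path I from c to c'}) (a b : R) :
  winds l a b -> winds l' a b -> homotopic l l'.
Proof.
move=> [w [cw w0 w1 Hw]] [w' [cw' w0' w1' Hw']].
pose u (q : R * R) := clip 0 1 q.1; pose v (q : R * R) := clip 0 1 q.2.
have cu : continuous u.
  by apply: (continuous_compT _ (@clip_continuous R 0 1)); continuity.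
have cv : continuous v.
  by apply: (continuous_compT _ (@clip_continuous R 0 1)); continuity.
have u01 q : 0 <= u q <= 1 by exact: clip_itv.
have v01 q : 0 <= v q <= 1 by exact: clip_itv.
pose rad (p : {path I from c to c'}) (z : R -> R) t :=
  cos (z t) * (offset (extend_path p t)).1 + sin (z t) * (offset (extend_path p t)).2.
have cL (p : {path I from c to c'}) := @extend_path_continuous _ _ _ _ p.
have crad p z : continuous z -> continuous (rad p z).
  move=> cz; have co := continuous_compT (cL p) offset_continuous.
  have o1 := continuous_compT co (@continuous_fst R R).
  have o2 := continuous_compT co (@continuous_snd R R).
  have cC := continuous_compT cz (@continuous_cos R).
  have cS := continuous_compT cz (@continuous_sin R).
  by rewrite /rad; continuity.
pose m q := segment (u q) (midpoint (extend_path l (v q)))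
                          (midpoint (extend_path l' (v q))).
pose r q := (1 - u q) * rad l w (v q) + u q * rad l' w' (v q).
pose z q := (1 - u q) * w (v q) + u q * w' (v q).
have cwv := continuous_compT cv cw; have cwv' := continuous_compT cv cw'.
have crv := continuous_compT cv (crad l _ cw).
have crv' := continuous_compT cv (crad l' _ cw').
have [|||q|f [cf Hf]] := @polar_conf (R * R)%type m r z.
- apply: segment_continuous => //.
    exact: (continuous_compT (continuous_compT cv (cL l)) midpoint_continuous).
  exact: (continuous_compT (continuous_compT cv (cL l')) midpoint_continuous).
- by rewrite /r; continuity.
- by rewrite /z; continuity.
- have [p0 _] := Hw _ (v01 q); have [p0' _] := Hw' _ (v01 q).
  rewrite /r; have /andP[] := u01 q; set s := u q => s0 s1.
  have [->|s_neq0] := eqVneq s 0; first by rewrite subr0 mul1r mul0r addr0.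
  apply: ltr_wpDl; first by apply: mulr_ge0; [lra | exact: ltW].
  by apply: mulr_gt0 => //; rewrite lt_neqAle eq_sym s_neq0.
have I0 : 0 <= (0 : R) <= 1 by rewrite lexx ler01.
have I1 : 0 <= (1 : R) <= 1 by rewrite lexx ler01.
have lin (s y : R) : (1 - s) * y + s * y = y by rewrite -mulrDl subrK mul1r.
apply: (@homotopicI _ _ _ _ _ _ f) => // [t t01|t t01|s s01|s s01].
- have u0 : u (0, t) = 0 by rewrite /u clip_id.
  have vt : v (0, t) = t by rewrite /v clip_id.
  apply: Hf; rewrite /m /r /z u0 vt; first by rewrite segment0.
  by rewrite subr0 !mul1r !mul0r !addr0; exact: has_angle_polar (Hw _ t01).
- have u0 : u (1, t) = 1 by rewrite /u clip_id.
  have vt : v (1, t) = t by rewrite /v clip_id.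
  apply: Hf; rewrite /m /r /z u0 vt; first by rewrite segment1.
  by rewrite subrr !mul1r !mul0r !add0r; exact: has_angle_polar (Hw' _ t01).
- have vt : v (s, 0) = 0 by rewrite /v clip_id.
  have El : extend_path l 0 = c by rewrite extend_path_le0.
  have El' : extend_path l' 0 = c by rewrite extend_path_le0.
  apply: Hf; rewrite /m /r /z vt /rad El El'; first by rewrite segmentxx.
  rewrite w0 w0' !lin; apply: has_angle_polar.
  by have := Hw _ I0; rewrite El w0.
- have vt : v (s, 1) = 1 by rewrite /v clip_id.
  have El : extend_path l 1 = c' by rewrite extend_path_ge1.
  have El' : extend_path l' 1 = c' by rewrite extend_path_ge1.
  apply: Hf; rewrite /m /r /z vt /rad El El'; first by rewrite segmentxx.
  rewrite w1 w1' !lin; apply: has_angle_polar.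
  by have := Hw _ I1; rewrite El w1.
Qed.

Lemma winds_exists c c' (l : {path I from c to c'}) (a : R) :
  has_angle (offset c) a -> exists b, winds l a b.
Proof.
move=> ca; have cl := @extend_path_continuous _ _ _ _ l.
have [||w [cw w0 Hw]] := @angle_lift R (fun t => offset (extend_path l t))
    (continuous_compT cl offset_continuous) _ 0 1 ler01 a.
- by move=> t; exact: offset_neq0.
- by rewrite extend_path_le0.
- by exists (w 1), w; split.
Qed.

Lemma winds_end c c' (l : {path I from c to c'}) (a b : R) :
  winds l a b -> has_angle (offset c) a /\ has_angle (offset c') b.
Proof.
move=> [w [cw <- <- Hw]]; split.
  by have := Hw 0; rewrite extend_path_le0 //; apply; rewrite lexx ler01.
by have := Hw 1; rewrite extend_path_ge1 //; apply; rewrite lexx ler01.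
Qed.

Lemma winds_eq c c' d d' (l : {path I from c to c'}) (l' : {path I from d to d'}) a b :
  (forall t, 0 <= t <= 1 -> extend_path l t = extend_path l' t) ->
  winds l a b -> winds l' a b.
Proof.
move=> ll' [w [cw w0 w1 Hw]]; exists w; split=> // t t01.
by rewrite -ll' //; exact: Hw.
Qed.

Lemma winds_concat c c' c'' (l : {path I from c to c'}) (l' : {path I from c' to c''})
    (a b e : R) :
  winds l a b -> winds l' b e -> winds (concat_path l l') a e.
Proof.
move=> [w [cw w0 w1 Hw]] [w' [cw' w0' w1' Hw']].
exists (fun t => if t <= 2^-1 then w (2 * t) else w' (2 * t - 1)); split.
- apply: glue_continuous.
  + by continuity.
  + by apply: (continuous_compT _ cw); continuity.
  + by apply: (continuous_compT _ cw'); continuity.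
  + by move=> t ->; rewrite mulfV ?pnatr_eq0 // subrr w1 w0'.
- by rewrite ifT ?mulr0 //; lra.
- rewrite ifF; first by rewrite (_ : 2 * 1 - 1 = 1) //; lra.
  by apply/negbTE; rewrite -ltNge; lra.
- move=> t t01; rewrite extend_concat // /concat_fun.
  by have [t2|t2] := leP t 2^-1; [apply: Hw | apply: Hw']; lra.
Qed.

Lemma winds_reverse c c' (l : {path I from c to c'}) (a b : R) :
  winds l a b -> winds (reverse_path l) b a.
Proof.
move=> [w [cw w0 w1 Hw]]; exists (fun t => w (1 - t)); split.
- by apply: (continuous_compT _ cw); continuity.
- by rewrite subr0.
- by rewrite subrr.
- by move=> t t01; rewrite extend_reverse //; apply: Hw; lra.
Qed.

Lemma winds_period c c' (l : {path I from c to c'}) (a b : R) (n : nat) :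
  winds l a b -> winds l (a + pi *+ 2 *+ n) (b + pi *+ 2 *+ n).
Proof.
move=> [w [cw w0 w1 Hw]]; exists (fun t => w t + pi *+ 2 *+ n); split.
- by apply: continuous_addf => //; exact: cst_continuous.
- by rewrite w0.
- by rewrite w1.
- by move=> t t01; apply: has_angle_period; exact: Hw.
Qed.

(** The angle varies by a multiple of a full turn along any loop, and by one
    turn along [g], so the loop is homotopic to a power of [g]. *)
Lemma disk_loops_cyclic c (g l : {path I from c to c}) (a : R)
    (H : set (pi1 R c)) : winds g a (a + pi *+ 2) -> is_subgroup H ->
  H (pi1_class g) -> H (pi1_class l).
Proof.
move=> ga subH Hg.
have ca := (winds_end ga).1.
have /choice[gn Hgn] : forall n, exists p : {path I from c to c},
    H (pi1_class p) /\ winds p a (a + pi *+ 2 *+ n).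
  elim=> [|n [p [Hp pa]]].
    exists (const_path R c); split; first by case: subH.
    exists (fun=> a); split=> //; last by rewrite mulr0n addr0.
    exact: cst_continuous.
  exists (concat_path g p); split.
    by rewrite -pi1_classM; exact: (subgroupM subH).
  apply: winds_concat ga _.
  have [w [cw w0 w1 Hw]] := pa; exists (fun t => w t + pi *+ 2); split.
  - by apply: continuous_addf => //; exact: cst_continuous.
  - by rewrite w0.
  - by rewrite w1 -addrA -mulrSr.
  - by move=> t t01; have := has_angle_period 1 (Hw _ t01); rewrite mulr1n.
have [b lb] := winds_exists l (winds_end ga).1.
have [n [bE|aE]] := has_angle_eq (winds_end lb).1 (winds_end lb).2.
  have [Hn wn] := Hgn n; rewrite -bE in wn.
  by rewrite (_ : pi1_class l = pi1_class (gn n)) //;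
    apply/pi1_classP/(winds_homotopic lb).
have [Hn wn] := Hgn n.
have := winds_period n (winds_reverse lb); rewrite -aE => lb'.
have e : pi1_class (reverse_path l) = pi1_class (gn n).
  exact/pi1_classP/(winds_homotopic lb').
have -> : pi1_class l = (pi1_class (gn n))^-1%g by rewrite -e -pi1_classV invgK.
exact: (subgroupV subH Hn).
Qed.

End DiskLoops.

(** * The full twist and the base disk *)

Section Doubling.
Context (R : realType) (X : topologicalType) (p : base_points X).
Local Notation I := (interval01 R).
Local Notation base := (base_conf p 2).

(* The square of a braid that exchanges two points ends at a configuration that
   is equal but not convertible to the base configuration. *)
Fact base_swap2 : conf_perm base (swap * swap)%g = base.
Proof. by rewrite tperm2 conf_perm1. Qed.

Definition squared_loop (g : strands R p swap) : {path I from base to base} :=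
  map_path (@continuous_idfun _) erefl base_swap2 (strands_comp g g).

Lemma squared_loop_class (g : strands R p swap) :
  pi1_map (@to_uconf_continuous 2 X) erefl (pi1_class (squared_loop g)) = (braid_of g ^+ 2)%g.
Proof.
rewrite expgS expg1 -braid_of_comp pi1_mapE.
by congr pi1_class; exact/path_eqP.
Qed.

End Doubling.

Section StrandsMap.
Context (R : realType) (X Y : topologicalType) (f : X -> Y).
Context (cf : continuous f) (injf : injective f).
Context (p : base_points X) (q : base_points Y) (fpq : forall j, f (p j) = q j).
Local Notation I := (interval01 R).

Fact conf_map_base (n : nat) : conf_map injf (base_conf p n) = base_conf q n.
Proof. by apply: conf_eqP => j; exact: fpq. Qed.

Fact conf_map_base_perm (n : nat) (s : 'S_n) :
  conf_map injf (conf_perm (base_conf p n) s) = conf_perm (base_conf q n) s.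
Proof. by apply: conf_eqP => j; exact: fpq. Qed.

Definition strands_map (n : nat) (s : 'S_n) (g : strands R p s) : strands R q s :=
  map_path (@conf_map_continuous n X Y f cf injf) (conf_map_base n)
    (conf_map_base_perm s) g.

Lemma braid_map_of (n : nat) (s : 'S_n) (g : strands R p s) :
  braid_map cf injf fpq (braid_of g) = braid_of (strands_map g).
Proof.
rewrite /braid_map pi1_mapE; congr pi1_class; apply/path_eqP => t.
exact: uconf_mapE.
Qed.

Lemma map_squared_loop (g : strands R p swap) :
  map_path (@conf_map_continuous 2 X Y f cf injf) (conf_map_base 2)
    (conf_map_base 2) (squared_loop g) = squared_loop (strands_map g).
Proof.
apply/path_eqP => t; rewrite /squared_loop /strands_comp /= /mk_path /= /concat_fun.
rewrite /extend_path /= /mk_path /=.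
by case: ifP => _ //; exact: conf_eqP.
Qed.

End StrandsMap.

Section DiskTwist.
Context (R : realType) (q : base_points (disk R)).

Lemma half_twist_winds (a : R) : has_angle (offset (base_conf q 2)) a ->
  winds (half_twist q) a (a + pi).
Proof.
move=> qa; exists (fun t => a + pi * t); split.
- by continuity.
- by rewrite mulr0 addr0.
- by rewrite mulr1.
move=> t t01.
have k0 : 0 < (1 + sin (pi * t))^-1.
  by rewrite invr_gt0 ltr_pwDl // sin_pi_ge0.
have := has_angle_rotate (pi * t) k0 qa.
congr (has_angle _ _); rewrite /offset /extend_path /= /mk_path /= /disk_val /=.
rewrite clampK // /swap tpermL tpermR /turn /=.
rewrite -/(disk_val (q ord0)) -/(disk_val (q ord_max)).
by congr pair; field; rewrite lt0r_neq0 // ltr_pwDl // sin_pi_ge0.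
Qed.

Lemma offset_swap (c : conf 2 (disk R)) :
  offset (conf_perm c swap) = (- (offset c).1, - (offset c).2).
Proof. by rewrite /offset !points_perm /swap tpermL tpermR /=; congr pair; lra. Qed.

(** In the second half of the full twist the two points have exchanged their
    roles, which adds a half turn to the angle. *)
Lemma full_twist_winds (a : R) : has_angle (offset (base_conf q 2)) a ->
  winds (squared_loop (half_twist q)) a (a + pi *+ 2).
Proof.
move=> qa; have h := half_twist_winds qa.
apply: (@winds_eq _ _ _ _ _ (strands_comp (half_twist q) (half_twist q))) => //.
rewrite mulr2n addrA; apply: winds_concat h _.
have [w [cw w0 w1 Hw]] := half_twist_winds qa; exists (fun t => w t + pi); split.
- by apply: continuous_addf => //; exact: cst_continuous.
- by rewrite w0.
- by rewrite w1.
- move=> t t01; have := has_angleN (Hw t t01).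
  by rewrite -offset_swap.
Qed.

End DiskTwist.

Section BaseDisk.
Context (R : realType) (M : topologicalType) (th : marked_curve R M).
Context (D : base_disk th) (hausM : hausdorff_space M).
Local Notation I := (interval01 R).
Local Notation e := (embed D).
Local Notation base := (base_conf (marked_points th) 2).

(** The embedding is a closed map, since the disk is compact and [M] is
    Hausdorff. *)
Lemma embed_inverse : exists2 d : M -> disk R, forall z, d (e z) = z &
  {within range e, continuous d}.
Proof.
have /choice[d dE] : forall x, exists z, range e x -> e z = x.
  move=> x; have [[z _ <-]|nx] := pselect (range e x); first by exists z.
  by exists (disk_points D 0%N) => /nx.
have dK z : d (e z) = z.
  by apply: (@embed_inj _ _ _ D); apply: dE; exists z.
exists d => //; apply/subspace_continuousP => _ [z _ <-] W.
rewrite (_ : from_subspace (range e) d (e z) = z); last exact: dK.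
move=> /nbhs_interior zW.
pose F := e @` (~` W°).
have clF : closed F.
  apply: (compact_closed hausM); apply: continuous_compact.
    exact/continuous_subspaceT/embed_continuous.
  apply: (subclosed_compact _ (@disk_compact R)) => //.
  exact/open_closedC/open_interior.
have : nbhs (e z) (~` F).
  apply: open_nbhs_nbhs; split; first exact: closed_openC.
  move=> [z' nW /(@embed_inj _ _ _ D) zz']; apply: nW; rewrite zz'.
  exact: nbhs_singleton zW.
rewrite /fmap /= /within /= => nF; apply: filterS nF => x nFx [z' _ xE].
rewrite -xE; change (W (d (e z'))); rewrite dK.
apply: interior_subset; apply: contrapT => nW.
by apply: nFx; exists z'.
Qed.

Lemma sigma1E : sigma1 D = braid_of (strands_map (@embed_continuous _ _ _ D)
  (@embed_inj _ _ _ D) (@embed_points _ _ _ D) (half_twist (disk_points D))).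
Proof. exact: braid_map_of. Qed.

Section Loops.
Context (N : set (pi1 R base)) (normN : is_normal_subgroup N).
Local Notation g := (strands_map (@embed_continuous _ _ _ D)
  (@embed_inj _ _ _ D) (@embed_points _ _ _ D) (half_twist (disk_points D))).

(** A loop of pairs in the embedded disk comes from the disk. Joined there to
    the base configuration, it becomes a power of the full twist; the path in
    the disk and the given path [d0] differ by a loop at the base configuration,
    and [N] is normal. *)
Lemma base_disk_loops : N (pi1_class (squared_loop g)) -> loops_in N (box (range e) (range e)).
Proof.
have [subN NJ] := normN; move=> Ng c l d0 le.
have {}le t j : range e (points (l t) j) by move: j; apply/box_positions.
have [d dK cd] := embed_inverse.
have eK x : range e x -> e (d x) = x by move=> [z _ <-]; rewrite dK.
have [f [cfd fE]] : exists f : I -> conf 2 (disk R), continuous f /\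
    forall t j, points (f t) j = d (points (l t) j).
  have inj t : injective (fun j => d (points (l t) j)).
    by move=> j k /(congr1 e); rewrite !eK // => /points_inj.
  exists (fun t => mk_conf (inj t)); split=> //.
  apply: conf_continuous => j; apply: (within_comp _ _ cd) => //.
  exact: (continuous_compT (@cts_fun _ _ l) (@points_continuous _ _ j)).
have fl t : conf_map (@embed_inj _ _ _ D) (f t) = l t.
  by apply: conf_eqP => j; rewrite points_mk /= fE eK.
have f01 : f one = f zero.
  by apply: conf_eqP => j; rewrite !fE path_zero path_one.
pose c' := f zero; pose l' : {path I from c' to c'} := mk_path cfd erefl f01.
have [psi cpsi] := disk_cell R.
have [r _] := cell_path_connected cpsi (c := base_conf (disk_points D) 2) (c' := c')
  (fun=> Logic.I) (fun=> Logic.I).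
pose cm := @conf_map_continuous 2 _ _ e (@embed_continuous _ _ _ D) (@embed_inj _ _ _ D).
have eb : conf_map (@embed_inj _ _ _ D) (base_conf (disk_points D) 2) = base.
  exact: (conf_map_base (@embed_inj _ _ _ D) (@embed_points _ _ _ D)).
have ec : conf_map (@embed_inj _ _ _ D) c' = c by rewrite fl path_zero.
pose H a := N (pi1_map cm eb a).
have subH : is_subgroup H by exact: preimage_subgroup.
pose lp := concat_path r (concat_path l' (reverse_path r)).
have [a qa] := exists_angle (@offset_neq0 R (base_conf (disk_points D) 2)).
have := disk_loops_cyclic lp (full_twist_winds qa) subH.
rewrite /H pi1_mapE (_ : map_path cm eb eb _ = squared_loop g); last first.
  rewrite -(map_squared_loop (@embed_continuous _ _ _ D) (@embed_inj _ _ _ D)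
    (@embed_points _ _ _ D)); exact/path_eqP.
move=> /(_ Ng); rewrite -loop_classE -loop_class_map -!hom_compE -hom_invE.
rewrite (hom_mapM cm eb ec eb) (hom_mapM cm ec ec eb) (hom_mapV cm eb ec).
have -> : hom_map cm ec ec (path_class l') = path_class l.
  by rewrite hom_mapE; congr path_class; apply/path_eqP => t; exact: fl.
set dl := hom_map cm eb ec (path_class r) => Nl.
have -> : d0 ** path_class l ** hom_inv d0 =
    (d0 ** hom_inv dl) ** (dl ** (path_class l ** hom_inv dl)) ** (dl ** hom_inv d0).
  by rewrite !hom_simpl.
rewrite !loop_classM (_ : dl ** hom_inv d0 = hom_inv (d0 ** hom_inv dl)); last first.
  by rewrite !hom_simpl.
rewrite loop_classV; set k := loop_class (_ ** hom_inv dl).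
by have := NJ _ k^-1%g Nl; rewrite /conjg invgK mulgA.
Qed.

End Loops.
End BaseDisk.

(** * Brunnian braids on two strands *)

Section SinglePoint.
Context (X : topologicalType).

Definition uconf1_point (u : uconf 1 X) : X := points (repr u) ord0.

Lemma uconf1_point_to (c : conf 1 X) : uconf1_point (to_uconf c) = points c ord0.
Proof.
have /to_uconfP[s cE] : to_uconf (repr (to_uconf c)) = to_uconf c by exact: reprK.
by rewrite /uconf1_point [in RHS]cE points_perm [s ord0]ord1.
Qed.

Lemma uconf1_point_continuous : continuous uconf1_point.
Proof.
apply/quotient_continuous.
have -> : uconf1_point \o \pi_(uconf 1 X) = fun c => points c ord0.
  by apply/funext => c; exact: uconf1_point_to.
exact: points_continuous.
Qed.

Lemma uconf1_point_inj : injective uconf1_point.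
Proof.
move=> u v uv; rewrite -(reprK u) -(reprK v); congr to_uconf.
by apply: conf_eqP => j; rewrite ord1.
Qed.

Lemma uconf1_of_point (T : topologicalType) (x : T -> X) : continuous x ->
  exists f : T -> uconf 1 X, continuous f /\ forall t, uconf1_point (f t) = x t.
Proof.
move=> cx.
have inj t : injective (fun _ : 'I_1 => x t) by move=> j k _; rewrite !ord1.
exists (fun t => to_uconf (mk_conf (inj t))); split.
  apply: (continuous_compT _ (@to_uconf_continuous 1 X)).
  exact: conf_continuous.
by move=> t; rewrite uconf1_point_to.
Qed.

End SinglePoint.

Section Sigma1.
Context (R : realType) (M : topologicalType) (th : marked_curve R M).
Context (D : base_disk th) (hausM : hausdorff_space M).
Local Notation I := (interval01 R).
Local Notation e := (embed D).

(** The disk is convex, so the loop contracts in it. *)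
Lemma range_embed_loop (u : uconf 1 M) (l : {path I from u to u}) :
  (forall t, range e (uconf1_point (l t))) -> path_class l = hom_id R u.
Proof.
move=> le; apply/path_classP.
have [d dK cd] := embed_inverse D hausM.
have eK x : range e x -> e (d x) = x by move=> [z _ <-]; rewrite dK.
have [psi cpsi] := disk_cell R.
have cl : continuous (fun t => d (uconf1_point (l t))).
  apply: (within_comp _ le cd).
  exact: (continuous_compT (@cts_fun _ _ l) (@uconf1_point_continuous M)).
pose z (q : I * I) := segment (ival q.1)
  (disk_val (d (uconf1_point (l q.2)))) (disk_val (d (uconf1_point u))).
have cz : continuous z.
  apply: segment_continuous.
  - by apply: (continuous_compT _ (@ival_continuous R)); continuity.
  - apply: (continuous_compT _ (@disk_val_continuous R)).
    by apply: (continuous_compT _ cl); continuity.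
  - exact: cst_continuous.
have Dz q : @closed_disk R (z q).
  by apply: (cell_convex cpsi); [exact: disk_valP|exact: disk_valP|exact: ival_itv].
have [H [cH HE]] := uconf1_of_point (continuous_compT
  (within_comp cz Dz (cell_psi_continuous cpsi)) (@embed_continuous _ _ _ D)).
have ul : uconf1_point u = uconf1_point (l zero) by rewrite path_zero.
have eu : e (d (uconf1_point u)) = uconf1_point u by apply: eK; rewrite ul.
exists H; split=> // [t|t|s|s]; apply: uconf1_point_inj; rewrite HE /z /=.
- by rewrite ival_zero segment0 (cell_phiK cpsi) // eK.
- by rewrite ival_one segment1 (cell_phiK cpsi) // eu.
- by rewrite path_zero segmentxx (cell_phiK cpsi) // eu.
- by rewrite path_one segmentxx (cell_phiK cpsi) // eu.
Qed.

Lemma slide_in_disk (i : 'I_2) (t : I) : range e (uconf1_point (slide th i t)).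
Proof.
have -> : uconf1_point (slide th i t) = curve th (slide_time th i (ival t) ord0).
  exact: uconf1_point_to.
apply: interior_subset; apply: (arc_in_disk D (j := 1)).
have t01 := ival_itv t; have m01 := mark_lt th (ltnSn 0).
rewrite /slide_time; move: (ival t) t01 => r r01.
have m0 : mark th 0 <= mark th (lift i ord0) <= mark th 1.
  by move: i; elim/ord2_ind; rewrite /= /bump /= ?lexx ?ltW.
have h1 : r * mark th 0 <= r * mark th (lift i ord0) by rewrite ler_wpM2l //; lra.
have h2 : r * mark th (lift i ord0) <= r * mark th 1 by rewrite ler_wpM2l //; lra.
have h3 : (1 - r) * mark th 0 <= (1 - r) * mark th 1 by rewrite ler_wpM2l //; lra.
rewrite /=; apply/andP; split; lra.
Qed.

(** The remaining strand moves within the disk, and it is completed to a loop by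
    arcs of the curve between the first two base points, which lie in the disk
    as well. *)
Lemma sigma1_brunnian : brunnian th 2 (sigma1 D).
Proof.
move=> i; rewrite sigma1E (removal_braid_of hausM).
set g := strands_map _ _ _ _.
have E : to_uconf (conf_drop i (conf_perm (base_conf (marked_points th) 2) swap)) =
    to_uconf (conf_drop (swap i) (base_conf (marked_points th) 2)).
  exact: conf_drop_perm.
rewrite /remove_strand -loop_classE range_embed_loop ?loop_class1 //.
pose A := [set u : uconf 1 M | range e (uconf1_point u)].
apply: (concat_path_in (A := A)); first exact: slide_in_disk.
apply: (concat_path_in (A := A)); last first.
  by apply: (reverse_path_in (A := A)); exact: slide_in_disk.
move=> t; rewrite /A /=.
have -> : uconf1_point (to_uconf (conf_drop i (g t))) = points (g t) (lift i ord0).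
  exact: uconf1_point_to.
by exists (points (half_twist (disk_points D) t) (lift i ord0)).
Qed.

End Sigma1.

Section Coordinates.
Context (R : realType) (M : topologicalType) (th : marked_curve R M).
Context (hausM : hausdorff_space M).
Local Notation I := (interval01 R).
Local Notation base := (base_conf (marked_points th) 2).

(** The removal of a strand of a pure braid is the other coordinate loop,
    conjugated by a path, so this loop is null-homotopic. *)
Lemma removal_null (g : strands R (marked_points th) (1%g : 'S_2)) (i : 'I_2) :
  removal i (braid_of g) = 1%g -> exists H : I * I -> M,
    [/\ continuous H,
        forall t, H (zero, t) = points (g t) (lift i ord0),
        forall t, H (one, t) = points base (lift i ord0),
        forall s, H (s, zero) = points base (lift i ord0) &
        forall s, H (s, one) = points base (lift i ord0)].
Proof.
have ii : (1%g : 'S_2) i = i by rewrite perm1.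
rewrite (removal_braid_of hausM) (remove_strandE ii) -loop_class1.
move=> /loop_class_inj E.
have : drop_strand ii g = hom_id R _.
  set a := path_class (slide th i) in E.
  have -> : drop_strand ii g = hom_inv a ** (a ** drop_strand ii g ** hom_inv a) ** a.
    by rewrite !hom_simpl.
  by rewrite E hom_compp1 hom_compVp.
move=> /path_classP[H [cH H0 H1 Hx Hy]].
have base_i : uconf1_point (to_uconf (conf_drop i base)) = points base (lift i ord0).
  exact: uconf1_point_to.
exists (fun q => uconf1_point (H q)); split=> [|t|t|s|s].
- exact: (continuous_compT cH (@uconf1_point_continuous M)).
- by rewrite H0; exact: uconf1_point_to.
- by rewrite H1; exact: base_i.
- by rewrite Hx.
- by rewrite Hy.
Qed.

End Coordinates.

Lemma perm2P (s : 'S_2) : s = 1%g \/ s = swap.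
Proof.
have ord2 (j : 'I_2) : j = ord0 \/ j = ord_max by elim/ord2_ind: j; [left | right].
have s01 : s ord0 <> s ord_max by move=> /perm_inj.
have [s0|s0] := ord2 (s ord0); have [s1|s1] := ord2 (s ord_max).
- by case: s01; rewrite s0 s1.
- by left; apply/permP; elim/ord2_ind; rewrite perm1.
- by right; apply/permP; elim/ord2_ind; rewrite /swap ?tpermL ?tpermR.
- by case: s01; rewrite s0 s1.
Qed.

Section Main.
Context (R : realType) (M : topologicalType) (th : marked_curve R M).
Context (D : base_disk th) (surfM : surface R M) (connM : connected [set: M]).
Local Notation I := (interval01 R).
Local Notation base := (base_conf (marked_points th) 2).
Local Notation N := (normal_closure [set (sigma1 D ^+ 2)%g]).

Let hausM : hausdorff_space M. Proof. by case: surfM. Qed.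

Lemma sigma1_perm : braid_perm (sigma1 D) swap.
Proof. by rewrite sigma1E; eexists. Qed.

(** The subgroup [N] of [collision_null] is the preimage of the normal closure;
    it contains the full twist of the base disk, from which the basis of good
    boxes is obtained. *)
Lemma brunnian_pure_sub : brunnian th 2 `&` pure R (marked_points th) 2 `<=` N.
Proof.
move=> b [Bb /pureP[g gb]]; rewrite -{}gb in Bb *.
pose l : {path I from base to base} :=
  map_path (@continuous_idfun _) erefl (conf_perm1 base) g.
have -> : braid_of g = pi1_map (@to_uconf_continuous 2 M) erefl (pi1_class l).
  by rewrite pi1_mapE; congr pi1_class; exact/path_eqP.
have normN := preimage_normal (@to_uconf_continuous 2 M) (erefl (to_uconf base))
  (@normal_closure_normal _ [set (sigma1 D ^+ 2)%g]).
have LO : loops_in (pi1_map (@to_uconf_continuous 2 M) erefl @^-1` N)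
    (box (range (embed D))° (range (embed D))°).
  move=> c k d lO; apply: (base_disk_loops (D := D) hausM normN); last first.
    by move=> t; have [/interior_subset ? /interior_subset ?] := lO t.
  rewrite /preimage /= squared_loop_class -sigma1E.
  by apply: sub_gen_smallest.
have aO : nbhs (marked_points th 0) (range (embed D))°.
  apply: open_nbhs_nbhs; split; first exact: open_interior.
  by apply: (arc_in_disk D (j := 0%N)); rewrite lexx.
have cells x O : nbhs x O -> exists U K phi psi,
    [/\ @cell R M U K phi psi, U x & U `<=` O].
  by move=> xO; apply: chart_cells => //; case: surfM.
have basis := good_boxes normN.1 hausM connM cells aO LO.
apply: (collision_null normN.1 basis).
have [H0 [cH0 H00 H01 H0x H0y]] := removal_null hausM (Bb ord_max).
have [H1 [cH1 H10 H11 H1x H1y]] := removal_null hausM (Bb ord0).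
have e0 : lift (ord_max : 'I_2) ord0 = ord0 by exact: val_inj.
have e1 : lift (ord0 : 'I_2) ord0 = ord_max by exact: val_inj.
exists (fun q => (H0 q, H1 q)); split=> [|t|t|s|s].
- exact: continuous_pair.
- by rewrite H00 H10 e0 e1.
- by rewrite H01 H11 e0 e1.
- by rewrite H0x H1x e0 e1.
- by rewrite H0y H1y e0 e1.
Qed.

Lemma sigma1_sqr_brunnian_pure :
  (brunnian th 2 `&` pure R (marked_points th) 2) (sigma1 D ^+ 2)%g.
Proof.
have Bs := sigma1_brunnian D hausM; split.
  exact: (subgroupM (@brunnian_subgroup R M hausM th 1) Bs Bs).
apply/pureP; have := braid_permM sigma1_perm sigma1_perm.
by rewrite tperm2 expgS expg1.
Qed.

End Main.

Theorem proposition3p3 (R : realType) (M : topologicalType)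
    (th : marked_curve R M) (D : base_disk th) (surfM : surface R M)
    (connM : connected [set: M]) (compM : compact [set: M]) :
  brunnian th 2 `&` pure R (marked_points th) 2 =
    normal_closure [set (sigma1 D ^+ 2)%g] /\
  brunnian th 2 =
    generated ((brunnian th 2 `&` pure R (marked_points th) 2)
               `|` [set sigma1 D]).
Proof.
have hausM : hausdorff_space M by case: surfM.
have subB := @brunnian_subgroup R M hausM th 1.
split; apply/seteqP; split.
- exact: brunnian_pure_sub.
- apply: smallest_sub; first exact: (brunnian_pure_normal hausM).
  by move=> _ ->; exact: sigma1_sqr_brunnian_pure.
- move=> b Bb; have Bs := sigma1_brunnian D hausM.
  have subG := @generated_subgroup _ ((brunnian th 2 `&`
    pure R (marked_points th) 2) `|` [set sigma1 D]).
  have [s pb] := braid_strands hausM b.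
  have [s1|s1] := perm2P s; move: pb; rewrite {}s1 => pb.
    by apply: sub_gen_smallest; left; split=> //; exact/pureP.
  have sG : generated ((brunnian th 2 `&` pure R (marked_points th) 2)
      `|` [set sigma1 D]) (sigma1 D) by apply: sub_gen_smallest; right.
  rewrite -(mulgVK (sigma1 D) b); apply: (subgroupM subG) => //.
  apply: sub_gen_smallest; left; split; first exact: subB.2.
  apply/pureP; have := braid_permM pb (braid_permV hausM (sigma1_perm D)).
  by rewrite mulgV.
- apply: smallest_sub => // b [[]//|->]; exact: sigma1_brunnian.
Qed.
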